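(* Let $E$ be a complex vector space of dimension $n\ge 1$ with a positive definite Hermitian metric and let $1\le i\le n$. Then: (1) The stratum $\Sigma_i^0$ is diffeomorphic to the total space of $\mathbb{HPD}_1(S^{\perp}_{\mathbb{G}_i})$. (2) There is a neighborhood of $\Sigma_i^0$ in $\mathbb{HP}_1(E)$ which is isomorphic, as a stratified space, to a neighborhood of $\mathbb{HPD}_1(S^{\perp}_{\mathbb{G}_i})$ inside the total space of $$\mathcal{C}(S_{\mathbb{G}_i})\oplus\mathbb{HPD}_1(S^{\perp}_{\mathbb{G}_i})\subset\mathbb{H}(S_{\mathbb{G}_i})\oplus\mathbb{HPD}_1(S^{\perp}_{\mathbb{G}_i}).$$
   Context: For a finite-dimensional complex vector space $V$ with a positive definite Hermitian metric, $\mathbb{H}(V)\subset\mathrm{End}(V)$ is the real vector space of Hermitian endomorphisms, $\mathbb{HP}(V)$ the subset of positive (semidefinite) ones, $\mathbb{HPD}(V)$ the subset of positive definite ones. The lower index $1$ denotes the subset of elements of trace $1$. $\mathbb{HP}_1(E)$ is identified with the state space of $M_n(\mathbb{C})$. Put $\Sigma_i^0:=\{f\in\mathbb{HP}_1(E):\mathrm{rk}(f)=i\}$, a smooth submanifold of $\mathrm{End}(E)$. For a Hermitian vector bundle $\mathcal{F}$ the same symbols $\mathbb{H}(\mathcal{F})$, $\mathbb{HP}_1(\mathcal{F})$, $\mathbb{HPD}_1(\mathcal{F})$ denote the bundles defined fibrewise. $\mathbb{G}_i$ is the Grassmann manifold of $(n-i)$-dimensional complex subspaces of $E$. $S_{\mathbb{G}_i}$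 is the tautological vector bundle on $\mathbb{G}_i$, with fibre $W$ at $W\in\mathbb{G}_i$, and $S^\perp_{\mathbb{G}_i}$ is its orthogonal bundle in the trivial bundle $\mathbb{G}_i\times E$, with fibre $W^\perp$; both carry the induced Hermitian metrics. $\mathcal{C}(S_{\mathbb{G}_i})\subset\mathbb{H}(S_{\mathbb{G}_i})$ is the sub cone bundle whose fibre at $W$ is the cone in $\mathbb{H}(W)$ with vertex $0$ and base $\mathbb{HP}_1(W)$, i.e. $\{0\}\cup\{th:0\le t\le 1,\ h\in\mathbb{HP}_1(W)\}$. The symbol $\oplus$ is the fibre product over $\mathbb{G}_i$: the total space of $\mathcal{C}(S_{\mathbb{G}_i})\oplus\mathbb{HPD}_1(S^\perp_{\mathbb{G}_i})$ consists of triples $(h,k,W)$ with $h\in\mathcal{C}(S_{\mathbb{G}_i})_W$ and $k\in\mathbb{HPD}_1(W^\perp)$. In it, $\mathbb{HPD}_1(S^\perp_{\mathbb{G}_i})$ is identified with the subset $h=0$. Stratifications: $\mathbb{HP}_1(E)$ is stratified by the sets $\Sigma_r^0$, $1\le r\le n$. The cone bundle has the conical stratification induced by the rank stratification of $\mathbb{HP}_1(S_{\mathbb{G}_i})$, so the strata of $\mathcal{C}(S_{\mathbb{G}_i})\oplus\mathbb{HPD}_1(S^\perp_{\mathbb{G}_i})$ near $h=0$ are the sets $\{\mathrm{rk}(h)=j\}$, $0\le j\le n-i$ (smooth submanifolds of $\mathbb{H}(S_{\mathbb{G}_i})\oplus\mathbb{H}(S^\perp_{\mathbb{G}_i})$).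 Neighborhoods carry the strata obtained by intersection. An isomorphism of stratified spaces is a homeomorphism that maps each stratum onto a stratum and restricts to a diffeomorphism between corresponding strata. *)

(* Defs.v *)
From HB Require Import structures.
From mathcomp Require Import all_boot all_order all_algebra.
From mathcomp Require Import complex.
From mathcomp Require Import all_classical all_reals all_analysis.

Set Implicit Arguments.
Unset Strict Implicit.
Unset Printing Implicit Defensive.

Import Order.TTheory GRing.Theory Num.Theory Num.Def.
Import numFieldNormedType.Exports.
Import ComplexField.

Local Open Scope classical_set_scope.
Local Open Scope complex_scope.
Local Open Scope ring_scope.

(* For k = 0 this is continuity on O; for an open O, [C_on k O F] is the usual
   C^k condition, phrased with iterated directional derivatives. *)
Fixpoint C_on (R : realType) (m p k : nat) (O : set 'rV[R]_m)
    (F : 'rV[R]_m -> 'rV[R]_p) : Prop :=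
  if k is k'.+1 then
    (forall x, O x -> differentiable F x) /\ (forall v, C_on k' O ('D_v F))
  else forall x, O x -> {for x, continuous F}.

Definition Cinfty_on (R : realType) (m p : nat) (O : set 'rV[R]_m)
    (F : 'rV[R]_m -> 'rV[R]_p) := forall k, C_on k O F.

(* The value [cmap c x] is meaningful only for x in [cdom c]. *)
Record chart (R : realType) (T : Type) := Chart {
  cdim : nat;
  cdom : set T;
  cmap : T -> 'rV[R]_cdim }.

Definition chart_open (R : realType) (T : Type) (A : set (chart R T))
    (O : set T) :=
  forall c, A c -> forall x, O x -> cdom c x ->
    \forall v \near cmap c x, forall y, cdom c y -> cmap c y = v -> O y.

(* The topology is the one induced by the charts.  Smoothness of the transition
   maps is not recorded in the structure: every notion below quantifies over
   all the charts of the atlas. *)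
HB.mixin Record isCharted (R : realType) M of Topological M := {
  atlas : set (chart R M);
  atlas_cover : forall x : M, exists2 c, atlas c & cdom c x;
  atlas_openE : forall O : set M, open O <-> chart_open atlas O }.

#[short(type="chartedType")]
HB.structure Definition Charted (R : realType) :=
  {M of Topological M & isCharted R M}.

HB.factory Record hasAtlas (R : realType) M of Choice M := {
  atlas : set (chart R M);
  atlas_cover : forall x : M, exists2 c, atlas c & cdom c x }.

HB.builders Context (R : realType) M of hasAtlas R M.

Let op := chart_open atlas.

Let opT : op setT.
Proof. by move=> c _ x _ _; near=> v. Unshelve. all: by end_near. Qed.

Let opI : setI_closed op.
Proof.
move=> O O' opO opO' c Ac x [Ox O'x] cx.
by apply: filterS2 (opO c Ac x Ox cx) (opO' c Ac x O'x cx) => v h h' y cy yv;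
  split; [exact: h | exact: h'].
Qed.

Let op_bigU (I : Type) (f : I -> set M) :
  (forall i, op (f i)) -> op (\bigcup_i f i).
Proof.
move=> opf c Ac x [i _ fix_] cx.
by apply: filterS (opf i c Ac x fix_ cx) => v h y cy yv; exists i => //; exact: h.
Qed.

HB.instance Definition _ := isOpenTopological.Build M opT opI op_bigU.

Let atlas_openE (O : set M) : open O <-> chart_open atlas O.
Proof. by []. Qed.

HB.instance Definition _ := isCharted.Build R M atlas_cover atlas_openE.

HB.end.

Section charted.
Context {R : realType}.
Implicit Types M N : chartedType R.

(* A map between arbitrary subsets of charted spaces is smooth when, read in
   any charts, it extends locally to a C^oo map on an open set; on embedded
   submanifolds this is smoothness for the submanifold structures. *)
Definition smooth_on M N (A : set M) (f : M -> N) :=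
  forall x, A x -> forall (c : chart R M) (d : chart R N),
    atlas c -> atlas d -> cdom c x -> cdom d (f x) ->
  exists (O : set 'rV[R]_(cdim c)) (F : 'rV[R]_(cdim c) -> 'rV[R]_(cdim d)),
    [/\ open O, O (cmap c x), Cinfty_on O F &
      forall y, A y -> cdom c y -> O (cmap c y) ->
        cdom d (f y) /\ cmap d (f y) = F (cmap c y)].

(* f and g are mutually inverse bijections between A and B; their values
   outside A and B are irrelevant. *)
Definition bij_on M N (A : set M) (B : set N) (f : M -> N) (g : N -> M) :=
  (forall x, A x -> B (f x) /\ g (f x) = x) /\
  (forall y, B y -> A (g y) /\ f (g y) = y).

Definition diffeo_on M N (A : set M) (B : set N) (f : M -> N) (g : N -> M) :=
  [/\ bij_on A B f g, smooth_on A f & smooth_on B g].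

Definition diffeomorphic M N (A : set M) (B : set N) :=
  exists f g, diffeo_on A B f g.

Definition homeo_on M N (A : set M) (B : set N) (f : M -> N) (g : N -> M) :=
  [/\ bij_on A B f g, {within A, continuous f} & {within B, continuous g}].

(* A stratification is given by its set of (nonempty) strata.  As the strata
   partition A and B, f @` S ranges over all of SB. *)
Definition stratified_isomorphic M N (SA : set (set M)) (A : set M)
    (SB : set (set N)) (B : set N) :=
  exists (f : M -> N) (g : N -> M), homeo_on A B f g /\
    forall S, SA S -> SB (f @` S) /\ diffeo_on S (f @` S) f g.

(* U is an open neighborhood of Z in the subspace X: openness guarantees that
   the intersections of U with the strata of X are submanifolds. *)
Definition open_nbhd_in M (X Z U : set M) :=
  Z `<=` U /\ exists2 O, open O & U = X `&` O.

Definition restrict_strata M (SX : set (set M)) (U : set M) : set (set M) :=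
  [set S | S !=set0 /\ exists2 S', SX S' & S = S' `&` U].

End charted.

Section realify.
Context {R : realType} (V : vectType R[i]).

(* Real and imaginary parts of the coordinates in a fixed basis. *)
Definition realify (v : V) : 'rV[R]_(\dim {:V} + \dim {:V}) :=
  row_mx (\row_j complex.Re (coord (vbasis {:V}) j v))
         (\row_j complex.Im (coord (vbasis {:V}) j v)).

Definition vect_mfd : Type := V.

HB.instance Definition _ := Choice.on vect_mfd.

Definition vect_atlas : set (chart R vect_mfd) :=
  [set Chart setT (realify : vect_mfd -> _)].

Lemma vect_atlas_cover (x : vect_mfd) : exists2 c, vect_atlas c & cdom c x.
Proof. by exists (Chart setT (realify : vect_mfd -> _)). Qed.

HB.instance Definition _ := hasAtlas.Build R vect_mfd vect_atlas_cover.

End realify.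

(* b is the metric of V; the definitions are applied to E and, with the induced
   metric, to its subspaces. *)
Section hermitian_endo.
Context {R : realType} {V : vectType R[i]} (b : V -> V -> R[i]).

Definition endo_trace (f : 'End(V)) : R[i] :=
  \sum_j coord (vbasis {:V}) j (f (vbasis {:V})`_j).

Definition endo_rank (f : 'End(V)) : nat := \dim (limg f).

Definition HE : set 'End(V) := [set f | forall x y, b (f x) y = b x (f y)].

Definition HP : set 'End(V) := [set f | HE f /\ forall x, 0 <= b (f x) x].

Definition HPD : set 'End(V) :=
  [set f | HE f /\ forall x, x != 0 -> 0 < b (f x) x].

Definition HP1 : set 'End(V) := [set f | HP f /\ endo_trace f = 1].

Definition HPD1 : set 'End(V) := [set f | HPD f /\ endo_trace f = 1].

(* The cone with vertex 0 and base HP1; it is {0} when V = 0. *)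
Definition HP1_cone : set 'End(V) :=
  [set f | f = 0 \/
     exists (t : R) (h : 'End(V)), [/\ 0 <= t <= 1, HP1 h & f = t%:C *: h]].

Definition rank_stratum (r : nat) : set 'End(V) :=
  [set f | HP1 f /\ endo_rank f = r].

End hermitian_endo.

Section bundles.
Context {R : realType} {E : vectType R[i]}.
Variables (dot : {dot E for (@conjC R[i])}) (d : nat).

Definition perp (W : {vspace E}) : {vspace E} := orthov dot W.

Definition sub_metric (W : {vspace E}) (u v : subvs_of W) : R[i] :=
  dot (vsval u) (vsval v).

Definition grassmannian := {W : {vspace E} | \dim W == d}.

(* The orthogonal projection onto W2, restricted to W1. *)
Definition proj_between (W1 W2 : {vspace E}) :
    'Hom(subvs_of W1, subvs_of W2) :=
  (linfun (vsproj W2) \o daddv_pi W2 (perp W2) \o linfun vsval)%VF.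

Definition conj_endo (V1 V2 : vectType R[i]) (p : 'Hom(V1, V2))
    (h : 'End(V1)) : 'End(V2) := (p \o h \o p^-1)%VF.

(* The standard chart domain of the Grassmannian at W0 is the set of the
   W with W :&: perp W0 = 0, on which the orthogonal projections W -> W0 and
   perp W -> perp W0 are isomorphisms.  Such a W is the graph of the linear map
   [graph_map W0 W] : W0 -> perp W0, its coordinate in the standard chart, and
   the projections trivialize the tautological bundle and its orthogonal
   bundle, hence, by conjugation, their endomorphism bundles. *)
Definition graph_map (W0 W : {vspace E}) :
    'Hom(subvs_of W0, subvs_of (perp W0)) :=
  (proj_between W (perp W0) \o (proj_between W W0)^-1)%VF.

(* The total spaces of the vector bundles End(S^perp) and End(S) (+) End(S^perp),
   in which the bundles of Hermitian endomorphisms lie as subbundles. *)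
Definition EndSperp : Type :=
  {W : grassmannian & 'End(subvs_of (perp (val W)))}.

HB.instance Definition _ := Choice.on EndSperp.

Definition EndSperp_chart (W0 : grassmannian) : chart R EndSperp :=
  Chart [set x : EndSperp | (val (tag x) :&: perp (val W0) = 0)%VS]
    (fun x : EndSperp => realify
      (graph_map (val W0) (val (tag x)),
       conj_endo (proj_between (perp (val (tag x))) (perp (val W0)))
         (tagged x))).

Definition EndSSperp : Type :=
  {W : grassmannian &
    ('End(subvs_of (val W)) * 'End(subvs_of (perp (val W))))%type}.

HB.instance Definition _ := Choice.on EndSSperp.

Definition EndSSperp_chart (W0 : grassmannian) : chart R EndSSperp :=
  Chart [set x : EndSSperp | (val (tag x) :&: perp (val W0) = 0)%VS]
    (fun x : EndSSperp => realify
      (graph_map (val W0) (val (tag x)),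
       conj_endo (proj_between (val (tag x)) (val W0)) (tagged x).1,
       conj_endo (proj_between (perp (val (tag x))) (perp (val W0)))
         (tagged x).2)).

Lemma cap_perp (W : {vspace E}) : (W :&: perp W = 0)%VS.
Proof.
apply/eqP; rewrite -subv0; apply/subvP => u /memv_capP[uW /mem_orthovP uW'].
rewrite memv0; apply: contraT => /(@neq0_dnorm_gt0 _ _ _ dot).
by rewrite uW' ?ltxx.
Qed.

Lemma EndSperp_cover (x : EndSperp) :
  exists2 c, range EndSperp_chart c & cdom c x.
Proof.
case: x => W h; exists (EndSperp_chart W); first by exists W.
exact: cap_perp.
Qed.

HB.instance Definition _ := hasAtlas.Build R EndSperp EndSperp_cover.

Lemma EndSSperp_cover (x : EndSSperp) :
  exists2 c, range EndSSperp_chart c & cdom c x.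
Proof.
case: x => W h; exists (EndSSperp_chart W); first by exists W.
exact: cap_perp.
Qed.

HB.instance Definition _ := hasAtlas.Build R EndSSperp EndSSperp_cover.

Definition HPD1_Sperp : set EndSperp :=
  [set x : EndSperp | HPD1 (@sub_metric (perp (val (tag x)))) (tagged x)].

Definition cone_HPD1 : set EndSSperp :=
  [set x : EndSSperp | HP1_cone (@sub_metric (val (tag x))) (tagged x).1 /\
           HPD1 (@sub_metric (perp (val (tag x)))) (tagged x).2].

(* HPD_1(S^perp) as the subset h = 0 of the fibre product. *)
Definition zero_HPD1 : set EndSSperp :=
  [set x : EndSSperp | (tagged x).1 = 0 /\
           HPD1 (@sub_metric (perp (val (tag x)))) (tagged x).2].

(* The strata of the conical stratification, away from t = 1.  A point with
   t = 1 is a boundary point of its set, so it lies in no open set that is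
   stratified-isomorphic to an open subset of HP1. *)
Definition cone_stratum (j : nat) : set EndSSperp :=
  [set x : EndSSperp | cone_HPD1 x /\ endo_rank (tagged x).1 = j].

Definition cone_strata : set (set EndSSperp) :=
  [set cone_stratum j | j in [set j | (j <= d)%N]].

End bundles.

Section base_strata.
Context {R : realType} {E : vectType R[i]}.
Variable dot : {dot E for (@conjC R[i])}.

Definition HP1_mfd : set (vect_mfd 'End(E)) := HP1 dot.

Definition Sigma0 (r : nat) : set (vect_mfd 'End(E)) := rank_stratum dot r.

Definition HP1_strata : set (set (vect_mfd 'End(E))) :=
  [set Sigma0 r | r in [set r | (1 <= r <= \dim {:E})%N]].

End base_strata.

(* Main.v *)
Require Import Defs.
From HB Require Import structures.
From mathcomp Require Import all_boot all_order all_algebra.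
From mathcomp Require Import complex ring.
From mathcomp Require Import all_classical all_reals all_analysis.
Import Order.TTheory GRing.Theory Num.Theory Num.Def.
Import numFieldNormedType.Exports.
Import ComplexField.

Set Implicit Arguments.
Unset Strict Implicit.
Unset Printing Implicit Defensive.

Local Open Scope classical_set_scope.
Local Open Scope complex_scope.
Local Open Scope ring_scope.
Local Open Scope sesquilinear_scope.

(** The map [glue] sends a triple (h, k, W) to h + (1 - tr h) k, where h and k
    are extended by zero from W and from its orthogonal.  The image f is a
    positive endomorphism of trace 1 that commutes with the orthogonal
    projection P onto W, and it determines h and k once P is known: h is f P,
    and k is f (1 - P) divided by its trace.  Near h = 0 it determines P as
    well, because the eigenvalues of f on W are small while those on the
    orthogonal of W are not.  So let U be the set of the f for which some c > 0
    has exactly n - i eigenvalues below it and is not itself an eigenvalue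
    ([gapped]), and let V be the set of the triples for which some c > 0
    separates the eigenvalues of h from those of (1 - tr h) k ([glue_gapped]).
    Then [glue] is a bijection from V to U ([glue_inj], [glue_surj]).  The
    kernel of f is the kernel of h, so that rk f + (n - i) = rk h + n
    ([glue_rank]): strata correspond to strata, and the stratum of rank i to
    the zero section h = 0, which gives the first claim.

    That P separates the spectrum of a Hermitian A at 0 is expressed by the
    positivity of the Hermitian part of (1 - 2P) A ([splits]).  This is an open
    condition on the pair (P, A) that does not presuppose commutation; if it
    holds for one projection, then it holds for the spectral projection, which
    has the same rank ([spectral_splitting]), and the latter is unique
    ([splits_uniq]).  Openness of U and V follows.

    Everything is computed with complex matrices, in an orthonormal basis of E.
    In a chart of a bundle, a point (h, k, W) is obtained from the center W0
    and the coordinates by conjugation with the inverse T of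
    P0 P + (1 - P0)(1 - P), which is the explicit matrix 1 + X - adj X when W is
    the graph of X ([trans_graph]); hence [glue] is smooth, and a map into the
    bundle is smooth as soon as the matrices of P, h and k are
    ([smooth_into_bundle]).  For the inverse map this reduces to the smoothness
    of the spectral projection.  It equals (1 - A B^-1) / 2, where B is the
    positive square root of A^2, and square roots of positive definite matrices
    are smooth ([sqrt_smooth]) because the derivative B' of B solves the
    Sylvester equation B B' + B' B = (A^2)'. *)

(** * Positive definite matrices *)

Section Adjoint.
Context {C : numClosedFieldType}.

Definition adj m n (A : 'M[C]_(m, n)) : 'M[C]_(n, m) := A ^t*.

Lemma adjE m n (A : 'M[C]_(m, n)) i j : adj A i j = conjC (A j i).
Proof. by rewrite !mxE. Qed.

Lemma adjK m n (A : 'M[C]_(m, n)) : adj (adj A) = A.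
Proof. exact: trmxCK. Qed.

Lemma adjM m n p (A : 'M[C]_(m, n)) (B : 'M[C]_(n, p)) :
  adj (A *m B) = adj B *m adj A.
Proof. by rewrite /adj trmx_mul map_mxM. Qed.

Lemma adjD m n (A B : 'M[C]_(m, n)) : adj (A + B) = adj A + adj B.
Proof. by rewrite /adj raddfD /= map_mxD. Qed.

Lemma adjN m n (A : 'M[C]_(m, n)) : adj (- A) = - adj A.
Proof. by rewrite /adj raddfN /= map_mxN. Qed.

Lemma adjB m n (A B : 'M[C]_(m, n)) : adj (A - B) = adj A - adj B.
Proof. by rewrite adjD adjN. Qed.

Lemma adjZ m n (a : C) (A : 'M[C]_(m, n)) : adj (a *: A) = conjC a *: adj A.
Proof. by apply/matrixP => i j; rewrite !mxE rmorphM. Qed.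

Lemma adj0 m n : adj (0 : 'M[C]_(m, n)) = 0.
Proof. by apply/matrixP => i j; rewrite !mxE rmorph0. Qed.

Lemma adj1 n : adj (1%:M : 'M[C]_n) = 1%:M.
Proof. by rewrite /adj trmx1 map_mx1. Qed.

Lemma adj_scalar n (a : C) : a \is Num.real -> adj (a%:M : 'M[C]_n) = a%:M.
Proof. by move=> /CrealP ra; rewrite -scalemx1 adjZ adj1 ra. Qed.

End Adjoint.

Section Positive.
Context {C : numClosedFieldType}.

Definition qf n (A : 'M[C]_n) (x : 'cV[C]_n) : C := (adj x *m A *m x) 0 0.

Definition psd n (A : 'M[C]_n) := forall x, 0 <= qf A x.

Definition pd n (A : 'M[C]_n) := forall x, x != 0 -> 0 < qf A x.

Lemma qfD n (A B : 'M[C]_n) x : qf (A + B) x = qf A x + qf B x.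
Proof. by rewrite /qf mulmxDr mulmxDl mxE. Qed.

Lemma qfN n (A : 'M[C]_n) x : qf (- A) x = - qf A x.
Proof. by rewrite /qf mulmxN mulNmx mxE. Qed.

Lemma qfB n (A B : 'M[C]_n) x : qf (A - B) x = qf A x - qf B x.
Proof. by rewrite qfD qfN. Qed.

Lemma qfZ n a (A : 'M[C]_n) x : qf (a *: A) x = a * qf A x.
Proof. by rewrite /qf -scalemxAr -scalemxAl mxE. Qed.

Lemma qf_scalar n (a : C) (x : 'cV[C]_n) : qf a%:M x = a * qf 1%:M x.
Proof. by rewrite -[a%:M]scalemx1 qfZ. Qed.

Lemma qf0 n (A : 'M[C]_n) : qf A 0 = 0.
Proof. by rewrite /qf mulmx0 mxE. Qed.

Lemma qf1 n (x : 'cV[C]_n) : qf 1%:M x = \sum_i `|x i 0| ^+ 2.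
Proof.
rewrite /qf mulmx1 mxE; apply: eq_bigr => i _.
by rewrite adjE normCK mulrC.
Qed.

Lemma qf_adj n (A : 'M[C]_n) x : qf (adj A) x = conjC (qf A x).
Proof. by rewrite /qf -adjE !adjM adjK mulmxA. Qed.

Lemma qf_congr n p (A : 'M[C]_n) (Y : 'M[C]_(n, p)) x :
  qf (adj Y *m A *m Y) x = qf A (Y *m x).
Proof. by rewrite /qf adjM !mulmxA. Qed.

Lemma qf_gram n p (Y : 'M[C]_(p, n)) x : qf (adj Y *m Y) x = qf 1%:M (Y *m x).
Proof. by rewrite -qf_congr mulmx1. Qed.

Lemma pd1 n : pd (1%:M : 'M[C]_n).
Proof.
move=> x; apply: contraNT; rewrite qf1 => le0.
have ge0 i : 0 <= `|x i 0| ^+ 2 by rewrite exprn_ge0.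
have s0 : \sum_i `|x i 0| ^+ 2 = 0.
  apply/eqP; move: le0; rewrite lt0r sumr_ge0 ?andbT ?negbK //.
apply/eqP/matrixP => i j; rewrite ord1 mxE; apply/eqP.
by have := @psumr_eq0P _ _ predT _ (fun i _ => ge0 i) s0 i isT;
  move/eqP; rewrite expf_eq0 /= normr_eq0.
Qed.

Lemma qf1_ge0 n (x : 'cV[C]_n) : 0 <= qf 1%:M x.
Proof. by rewrite qf1 sumr_ge0 // => i _; rewrite exprn_ge0. Qed.

Lemma qf1_eq0 n (x : 'cV[C]_n) : qf 1%:M x = 0 -> x = 0.
Proof.
by move=> q0; apply/eqP; apply: contra_eqT q0 => /pd1; rewrite lt0r => /andP[].
Qed.

Lemma pd_psd n (A : 'M[C]_n) : pd A -> psd A.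
Proof.
by move=> pA x; have [->|/pA/ltW//] := eqVneq x 0; rewrite qf0.
Qed.

Lemma pdD n (A B : 'M[C]_n) : pd A -> psd B -> pd (A + B).
Proof. by move=> pA pB x x0; rewrite qfD ltr_pwDl ?pA. Qed.

Lemma trace_qf n p (A : 'M[C]_n) (Y : 'M[C]_(n, p)) :
  \tr (adj Y *m A *m Y) = \sum_j qf A (col j Y).
Proof.
apply: eq_bigr => j _; rewrite /qf /col !mxE; apply: eq_bigr => k _.
rewrite !mxE; congr (_ * _); apply: eq_bigr => l _.
by rewrite !mxE.
Qed.

Lemma psd_trace_ge0 n p (A : 'M[C]_n) (Y : 'M[C]_(n, p)) :
  psd A -> 0 <= \tr (adj Y *m A *m Y).
Proof. by move=> pA; rewrite trace_qf sumr_ge0. Qed.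

Lemma pd_trace_gt0 n p (A : 'M[C]_n) (Y : 'M[C]_(n, p)) :
  pd A -> Y != 0 -> 0 < \tr (adj Y *m A *m Y).
Proof.
move=> pA Y0; rewrite lt0r psd_trace_ge0 ?andbT; last exact: pd_psd.
apply: contraNneq Y0; rewrite trace_qf => s0.
have q0 j : qf A (col j Y) = 0.
  exact: (@psumr_eq0P _ _ predT _ (fun j _ => pd_psd pA (col j Y)) s0 j isT).
apply/eqP/matrixP => i j; rewrite mxE.
have c0 : col j Y = 0.
  by apply/eqP; apply: contra_eqT (q0 j) => /pA; rewrite lt0r => /andP[].
by have /matrixP/(_ i 0) := c0; rewrite !mxE.
Qed.

Lemma psd_trace n (A : 'M[C]_n) : psd A -> 0 <= \tr A.
Proof. by move=> /(psd_trace_ge0 1%:M); rewrite adj1 mul1mx mulmx1. Qed.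

Lemma kernel_unitmx n (A : 'M[C]_n) :
  (forall x : 'cV_n, A *m x = 0 -> x = 0) -> A \in unitmx.
Proof.
move=> kerA; rewrite -unitmx_tr unitmxE unitfE; apply/det0P => -[v v0 vA].
move: v0; rewrite -trmx_eq0 => /eqP; apply; apply: kerA.
by rewrite -[A]trmxK -trmx_mul vA trmx0.
Qed.

Lemma pd_unit n (A : 'M[C]_n) : pd A -> A \in unitmx.
Proof.
move=> pA; apply: kernel_unitmx => x Ax0; apply/eqP.
apply: contraT => /pA; rewrite /qf -mulmxA Ax0 mulmx0 mxE ltxx //.
Qed.

End Positive.

Section Spectral.
Context {C : numClosedFieldType} {n : nat}.
Implicit Types A B : 'M[C]_n.

(** The eigenvalues are also written as values of the quadratic form, so that
    positivity of A passes to them. *)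
Lemma spectral_hermitian A : adj A = A ->
  exists U (d : 'rV[C]_n), [/\ adj U *m U = 1%:M, U *m adj U = 1%:M,
    A = adj U *m diag_mx d *m U, forall j, d 0 j \is Num.real &
    forall j, d 0 j = qf A (adj U *m delta_mx j 0)].
Proof.
move=> hA; have AH : A \is hermsymmx.
  by apply/is_hermitianmxP; rewrite expr0 scale1r; exact: esym hA.
have /orthomx_spectralP := hermitian_normalmx AH.
set U := spectralmx A; set d := spectral_diag A => AE.
have Uu : U \is unitarymx by exact: spectral_unitarymx.
have UU : U *m adj U = 1%:M by apply/unitarymxP.
have UU' : adj U *m U = 1%:M by exact: mulmx1C.
rewrite invmx_unitary // -/(adj U) in AE.
exists U, d; split=> //.
  by move=> j; have /mxOverP := hermitian_spectral_diag_real AH; exact.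
move=> j; rewrite -qf_congr adjK AE !mulmxA UU mul1mx -mulmxA UU mulmx1 /qf.
rewrite -mulmxA mul_diag_mx mxE (bigD1 j) //= !mxE !eqxx rmorph1 mul1r mulr1.
by rewrite big1 ?addr0 // => i ij; rewrite !mxE (negPf ij) rmorph0 mul0r.
Qed.

Lemma diag_sandwich (U : 'M[C]_n) (d e : 'rV[C]_n) : U *m adj U = 1%:M ->
  (adj U *m diag_mx d *m U) *m (adj U *m diag_mx e *m U) =
  adj U *m diag_mx (\row_j (d 0 j * e 0 j)) *m U.
Proof.
move=> UU; rewrite !mulmxA -(mulmxA _ U) UU mulmx1.
rewrite -(mulmxA _ (diag_mx d)); congr (_ *m _ *m _).
by apply/matrixP => i j; rewrite mul_diag_mx !mxE -mulrnAr; case: eqP => // ->.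
Qed.

Lemma adj_diag_sandwich (U : 'M[C]_n) (d : 'rV[C]_n) :
  (forall j, d 0 j \is Num.real) ->
  adj (adj U *m diag_mx d *m U) = adj U *m diag_mx d *m U.
Proof.
move=> dr; rewrite !adjM adjK mulmxA; congr (_ *m _ *m _).
apply/matrixP => i j; rewrite adjE !mxE eq_sym; case: eqP => [->|_].
  by rewrite mulr1n; apply/CrealP.
by rewrite rmorph0.
Qed.

Lemma qf_diag_sandwich (U : 'M[C]_n) (d : 'rV[C]_n) x :
  qf (adj U *m diag_mx d *m U) x = \sum_j d 0 j * `|(U *m x) j 0| ^+ 2.
Proof.
rewrite qf_congr /qf -mulmxA mxE; apply: eq_bigr => j _.
by rewrite mul_diag_mx !mxE normCK mulrCA [conjC _ * _]mulrC.
Qed.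

Lemma pd_diag_sandwich (U : 'M[C]_n) (d : 'rV[C]_n) :
  adj U *m U = 1%:M -> (forall j, 0 < d 0 j) -> pd (adj U *m diag_mx d *m U).
Proof.
move=> UU d0 x x0; rewrite qf_diag_sandwich lt0r sumr_ge0 ?andbT; last first.
  by move=> j _; rewrite mulr_ge0 ?exprn_ge0 ?normr_ge0 ?(ltW (d0 j)).
apply: contraNneq x0 => s0; rewrite -[x]mul1mx -UU -mulmxA.
suff -> : U *m x = 0 by rewrite mulmx0.
apply/matrixP => j k; rewrite ord1 [RHS]mxE; apply/eqP.
have := @psumr_eq0P _ _ predT _
  (fun j _ => mulr_ge0 (ltW (d0 j)) (exprn_ge0 2 (normr_ge0 _))) s0 j isT.
by move/eqP; rewrite mulf_eq0 gt_eqF ?d0 //= expf_eq0 /= normr_eq0.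
Qed.

Lemma psd_sqrt A : adj A = A -> psd A -> exists B, adj B *m B = A.
Proof.
move=> hA pA; have [U [d [UU UU' AE _ dE]]] := spectral_hermitian hA.
have d0 j : 0 <= d 0 j by rewrite dE.
exists (diag_mx (\row_j sqrtC (d 0 j)) *m U); rewrite adjM AE !mulmxA.
rewrite -(mulmxA (adj U)); congr (_ *m _ *m _).
apply/matrixP => i j; rewrite mul_mx_diag mxE adjE !mxE eq_sym.
case: eqP => [->|_]; last by rewrite rmorph0 mul0r.
by rewrite mulr1n conj_Creal ?ger0_real ?sqrtC_ge0 // -expr2 sqrtCK.
Qed.

Lemma psd_qf_eq0 A x : adj A = A -> psd A -> qf A x = 0 -> A *m x = 0.
Proof.
move=> hA pA; have [B <-] := psd_sqrt hA pA.
by rewrite qf_gram -mulmxA => /qf1_eq0 ->; rewrite mulmx0.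
Qed.

Lemma psd_trace_eq0 A : adj A = A -> psd A -> \tr A = 0 -> A = 0.
Proof.
move=> hA pA; have [B <-] := psd_sqrt hA pA.
have [->|B0] := eqVneq B 0; first by rewrite mulmx0.
have := pd_trace_gt0 (@pd1 C n) B0; rewrite mulmx1 => /[swap] ->.
by rewrite ltxx.
Qed.

Lemma pd_coercive A : adj A = A -> pd A ->
  exists2 eps, 0 < eps & psd (A - eps%:M).
Proof.
move=> hA pA; have [U [d [UU UU' AE _ dE]]] := spectral_hermitian hA.
have d0 j : 0 < d 0 j.
  rewrite dE pA //; apply/eqP => /(congr1 (mulmx U)).
  rewrite mulmxA UU' mul1mx mulmx0 => /matrixP/(_ j 0); rewrite !mxE !eqxx.
  by move/eqP; rewrite oner_eq0.
(* s exceeds every inverse eigenvalue, so s^-1 is below every eigenvalue. *)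
set s := 1 + \sum_j (d 0 j)^-1.
have s0 : 0 < s by rewrite ltr_pwDl // sumr_ge0 // => j _; rewrite invr_ge0 ltW.
exists s^-1; rewrite ?invr_gt0 // => x.
have -> : (s^-1)%:M = adj U *m diag_mx (const_mx s^-1) *m U :> 'M[C]_n.
  by rewrite diag_const_mx scalar_mxC -mulmxA UU mulmx1.
rewrite qfB AE !qf_diag_sandwich -sumrB sumr_ge0 // => j _.
rewrite -mulrBl mulr_ge0 ?exprn_ge0 // subr_ge0 mxE.
rewrite invf_ple ?posrE // /s (bigD1 j) //= addrCA lerDl addr_ge0 //.
by rewrite sumr_ge0 // => k _; rewrite invr_ge0 ltW.
Qed.

End Spectral.

(** * Hermitian matrices with a spectral gap *)

Section Gap.
Context {C : numClosedFieldType} {n : nat}.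
Implicit Types (A B P f : 'M[C]_n) (x : 'cV[C]_n).

Definition oproj P := adj P = P /\ P *m P = P.

Definition symm A := A + adj A.

(** For a projection P commuting with a Hermitian A, this says that P projects
    onto the span of the eigenvectors with negative eigenvalue and that 0 is not
    an eigenvalue.  The condition is open in P and A together. *)
Definition splits P A := pd (symm ((1%:M - P *+ 2) *m A)).

Lemma oproj_compl P : oproj P -> oproj (1%:M - P).
Proof.
case=> hP PP; split; first by rewrite adjB adj1 hP.
by rewrite mulmxBl mul1mx mulmxBr mulmx1 PP subrr subr0.
Qed.

Lemma adj_symm A : adj (symm A) = symm A.
Proof. by rewrite /symm adjD adjK addrC. Qed.

Lemma qf_symm A x : qf (symm A) x = qf A x + conjC (qf A x).
Proof. by rewrite qfD qf_adj. Qed.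

Lemma adj_refl P : oproj P -> adj (1%:M - P *+ 2) = 1%:M - P *+ 2.
Proof. by case=> hP _; rewrite !mulr2n adjB adjD adj1 hP. Qed.

(** The reflection 1 - 2P acts on Z by the sign e and disappears from the
    compression to Z. *)
Lemma symm_refl_compress m P A (Z : 'M[C]_(n, m)) e : oproj P -> adj A = A ->
  (1%:M - P *+ 2) *m Z = e *: Z -> e \is Num.real ->
  adj Z *m symm ((1%:M - P *+ 2) *m A) *m Z = e *: (adj Z *m A *m Z) *+ 2.
Proof.
move=> oP hA ZE er; have hS := adj_refl oP; set S := 1%:M - _ in ZE hS *.
rewrite /symm adjM hA hS mulmxDr mulmxDl mulmxA -{1}hS -adjM ZE adjZ.
by rewrite (CrealP er) -!mulmxA ZE -!scalemxAr -scalemxAl -scalerDr scalerMnr mulr2n.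
Qed.

Lemma refl_fix m P (Z : 'M[C]_(n, m)) : P *m Z = Z ->
  (1%:M - P *+ 2) *m Z = -1 *: Z.
Proof.
by move=> PZ; rewrite mulmxBl mul1mx mulr2n mulmxDl PZ opprD addrA subrr sub0r scaleN1r.
Qed.

Lemma refl_ker m P (Z : 'M[C]_(n, m)) : P *m Z = 0 ->
  (1%:M - P *+ 2) *m Z = 1 *: Z.
Proof. by move=> PZ; rewrite mulmxBl mul1mx mulr2n mulmxDl PZ addr0 subr0 scale1r. Qed.

Lemma splits_neg P A x : oproj P -> adj A = A -> splits P A ->
  P *m x = x -> x != 0 -> qf A x < 0.
Proof.
move=> oP hA sPA Px /sPA; rewrite {1}/qf.
rewrite (symm_refl_compress oP hA (refl_fix Px)) ?realN ?real1 // scaleN1r.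
by rewrite mulmxnE pmulrn_lgt0 // mxE oppr_gt0.
Qed.

Lemma splits_pos P A x : oproj P -> adj A = A -> splits P A ->
  P *m x = 0 -> x != 0 -> 0 < qf A x.
Proof.
move=> oP hA sPA Px /sPA; rewrite {1}/qf.
rewrite (symm_refl_compress oP hA (refl_ker Px)) ?real1 // scale1r.
by rewrite mulmxnE pmulrn_lgt0.
Qed.

(** It maps the range of P to that of P0 and the kernel of P to that of P0, so
    that its inverse carries the splitting of P0 to the splitting of P. *)
Definition trans P0 P := P0 *m P + (1%:M - P0) *m (1%:M - P).

Lemma oproj_complr P : oproj P -> P *m (1%:M - P) = 0.
Proof. by case=> _ PP; rewrite mulmxBr mulmx1 PP subrr. Qed.

Lemma oproj_compll P : oproj P -> (1%:M - P) *m P = 0.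
Proof. by case=> _ PP; rewrite mulmxBl mul1mx PP subrr. Qed.

Lemma trans_projr P0 P : oproj P -> trans P0 P *m P = P0 *m P.
Proof.
move=> oP; rewrite /trans [LHS]mulmxDl -!mulmxA (proj2 oP) oproj_compll //.
by rewrite mulmx0 addr0.
Qed.

Lemma trans_conj P0 P (H T : 'M[C]_n) : oproj P -> P *m H = H -> H *m P = H ->
  P0 *m P *m H *m (P *m T) = trans P0 P *m H *m T.
Proof.
move=> oP PH HP; rewrite -(trans_projr P0 oP) -[_ *m P *m H]mulmxA PH.
by rewrite -mulmxA [H *m (P *m T)]mulmxA HP mulmxA.
Qed.

Lemma trans_projl P0 P : oproj P0 -> P0 *m trans P0 P = P0 *m P.
Proof.
move=> o0; rewrite /trans [LHS]mulmxDr !mulmxA (proj2 o0) oproj_complr //.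
by rewrite mul0mx addr0.
Qed.

Lemma trans_comm P0 P : oproj P0 -> oproj P ->
  P0 *m trans P0 P = trans P0 P *m P.
Proof. by move=> o0 oP; rewrite trans_projr ?trans_projl. Qed.

(** The two projections are conjugate, by [trans_comm]. *)
Lemma trans_unit_trace P0 P : oproj P0 -> oproj P -> trans P0 P \in unitmx ->
  \tr P = \tr P0.
Proof.
move=> o0 oP uN; rewrite -[P in LHS](mulKmx uN) -trans_comm // mulmxA.
by rewrite mxtrace_mulC mulmxA mulmxV // mul1mx.
Qed.

Lemma trans_unit P0 P : oproj P0 -> oproj P ->
  (forall x, P *m x = x -> P0 *m x = 0 -> x = 0) ->
  (forall x, P *m x = 0 -> P0 *m x = x -> x = 0) -> trans P0 P \in unitmx.
Proof.
move=> o0 oP h1 h2; apply: kernel_unitmx => x Nx.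
have Px : P *m x = 0.
  apply: h1; first by rewrite mulmxA (proj2 oP).
  by rewrite mulmxA -trans_projl // -mulmxA Nx mulmx0.
apply: h2 => //.
have : trans P0 P *m x = (1%:M - P0) *m x.
  rewrite /trans [LHS]mulmxDl -!mulmxA Px mulmx0 add0r; congr (_ *m _).
  by rewrite mulmxBl mul1mx Px subr0.
by rewrite Nx mulmxBl mul1mx => /esym/eqP; rewrite subr_eq0 => /eqP.
Qed.

Lemma trans_inv_comm P0 P : oproj P0 -> oproj P -> trans P0 P \in unitmx ->
  invmx (trans P0 P) *m P0 = P *m invmx (trans P0 P).
Proof.
move=> o0 oP uN.
have := congr1 (fun M => invmx (trans P0 P) *m M *m invmx (trans P0 P)) (trans_comm o0 oP).
by rewrite !mulmxA mulVmx // mul1mx -mulmxA mulmxV // mulmx1.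
Qed.

Lemma trans_inv_fix P0 P : oproj P0 -> oproj P -> trans P0 P \in unitmx ->
  P0 *m invmx (trans P0 P) *m P0 = P0.
Proof.
move=> o0 oP uN; rewrite -mulmxA trans_inv_comm // mulmxA -(trans_projr P0 oP).
by rewrite -mulmxA -trans_inv_comm // mulmxA mulmxV // mul1mx.
Qed.

Lemma trans_compl P0 P : trans (1%:M - P0) (1%:M - P) = trans P0 P.
Proof.
by rewrite /trans addrC !opprD !opprK !addrA !subrr !add0r.
Qed.

(** The range of P is the graph of X over the range of P0, and its orthogonal
    is the graph of - adj X over the kernel of P0. *)
Lemma trans_graph P0 P : oproj P0 -> oproj P -> trans P0 P \in unitmx ->
  let T := invmx (trans P0 P) in let X := (1%:M - P0) *m T *m P0 in
  T = 1%:M + X - adj X.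
Proof.
move=> o0 oP uN T X.
have NT : trans P0 P *m T = 1%:M by exact: mulmxV.
have TP : T *m P0 = P *m T by exact: trans_inv_comm.
have PTP : P0 *m T *m P0 = P0 by exact: trans_inv_fix.
have TP0 : T *m P0 = P0 + X.
  by rewrite /X mulmxBl mul1mx mulmxBl PTP addrC subrK.
have o1 := oproj_compl o0.
set Q0 := 1%:M - P0 in X TP0 o1 *.
have TQ : T *m Q0 = (1%:M - P) *m T by rewrite mulmxBr mulmx1 TP mulmxBl mul1mx.
have NQ : Q0 *m trans P0 P = Q0 *m (1%:M - P).
  by rewrite /trans [LHS]mulmxDr !mulmxA (proj2 o1) oproj_compll // mul0mx add0r.
have NQr : trans P0 P *m (1%:M - P) = Q0 *m (1%:M - P).
  by rewrite [LHS]mulmxBr mulmx1 trans_projr // /trans addrAC subrr add0r.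
have QTQ : Q0 *m T *m Q0 = Q0.
  by rewrite -mulmxA TQ mulmxA -NQr -mulmxA -TQ mulmxA NT mul1mx.
set Z := P0 *m T *m Q0.
have TQ0 : T *m Q0 = Q0 + Z.
  by rewrite /Z -{2}QTQ -!mulmxDl subrK mul1mx.
have adjX : adj X = P0 *m adj T *m Q0.
  by rewrite /X !adjM (proj1 o0) (proj1 o1) mulmxA.
have Q0P0 : Q0 *m P0 = 0 by exact: oproj_compll.
have P0Q0 : P0 *m Q0 = 0 by exact: oproj_complr.
(* Orthogonality of the ranges of P and 1 - P determines the block Z. *)
have : adj (T *m P0) *m (T *m Q0) = 0.
  rewrite TP TQ adjM (proj1 oP) -mulmxA (mulmxA P) mulmxBr mulmx1 (proj2 oP).
  by rewrite subrr mul0mx mulmx0.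
rewrite TP0 TQ0 adjD (proj1 o0) (mulmxDl P0) (mulmxDr P0 Q0) (mulmxDr _ Q0).
rewrite P0Q0 add0r.
have -> : P0 *m Z = Z by rewrite /Z !mulmxA (proj2 o0).
have -> : adj X *m Q0 = adj X by rewrite adjX -!mulmxA (proj2 o1).
have -> : adj X *m Z = 0.
  by rewrite adjX /Z -!mulmxA (mulmxA Q0) Q0P0 mul0mx !mulmx0.
rewrite addr0 => /eqP; rewrite addr_eq0 => /eqP ZX.
rewrite -[LHS]mulmx1 -(subrK P0 1%:M) -/Q0 mulmxDr TQ0 TP0 ZX.
by rewrite /Q0 addrACA [- adj X + X]addrC subrK addrA.
Qed.

(** A vector in the range of one projection and the kernel of the other is
    zero, as A would be both negative and positive on it. *)
Lemma splits_trans_unit P0 P A : oproj P0 -> oproj P -> adj A = A ->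
  splits P0 A -> splits P A -> trans P0 P \in unitmx.
Proof.
move=> o0 oP hA s0 sP; apply: trans_unit => // x Px P0x; apply/eqP.
  apply: contraT => x0; have := splits_neg oP hA sP Px x0.
  by rewrite lt_gtF // (splits_pos o0 hA s0 P0x x0).
apply: contraT => x0; have := splits_neg o0 hA s0 P0x x0.
by rewrite lt_gtF // (splits_pos oP hA sP Px x0).
Qed.

Lemma splits_unit P A : splits P A -> A \in unitmx.
Proof.
move=> sPA; apply: kernel_unitmx => x Ax; apply/eqP; apply: contraT => /sPA.
by rewrite qf_symm /qf -!mulmxA Ax !mulmx0 mxE rmorph0 addr0 ltxx.
Qed.

(** B is the absolute value of A, so that A *m invmx B is its sign and P
    projects onto the eigenvectors with negative eigenvalue.  P has the trace of
    P0 because [trans] conjugates P to P0. *)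
Lemma spectral_splitting P0 A : oproj P0 -> adj A = A -> splits P0 A ->
  exists B P, [/\ adj B = B, pd B, B *m B = A *m A, oproj P & splits P A] /\
    [/\ P *m A = A *m P, \tr P = \tr P0 &
        P = 2^-1 *: (1%:M - A *m invmx B)].
Proof.
move=> o0 hA s0; have uA := splits_unit s0.
have [U [d [UU UU' AE dr _]]] := spectral_hermitian hA.
have d0 j : d 0 j != 0.
  apply/eqP => dj; have : A *m (adj U *m delta_mx j 0) = 0 :> 'cV_n.
    rewrite AE !mulmxA -(mulmxA _ U) UU' mulmx1 -mulmxA; apply/matrixP => i k.
    rewrite mxE big1 ?mxE // => l _; rewrite mul_diag_mx !mxE.
    by case: eqP => [->|]; rewrite ?dj ?mul0r ?mulr0.
  move/(congr1 (mulmx (U *m invmx A))); rewrite mulmx0 -!mulmxA mulKmx //.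
  rewrite mulmxA UU' mul1mx => /matrixP/(_ j 0); rewrite !mxE !eqxx.
  by move/eqP; rewrite oner_eq0.
pose b := \row_j `|d 0 j|; pose p := \row_j ((d 0 j < 0)%R%:R : C).
set B := adj U *m diag_mx b *m U; set P := adj U *m diag_mx p *m U.
have pr j : p 0 j \is Num.real by rewrite mxE realn.
have hB : adj B = B by apply: adj_diag_sandwich => j; rewrite mxE normr_real.
have pB : pd B by apply: pd_diag_sandwich => // j; rewrite mxE normr_gt0.
have BB : B *m B = A *m A.
  rewrite /B AE !diag_sandwich //; congr (_ *m diag_mx _ *m _).
  by apply/rowP => j; rewrite !mxE -expr2 real_normK ?expr2.
have oP : oproj P.
  split; first exact: adj_diag_sandwich.
  rewrite /P diag_sandwich //; congr (_ *m diag_mx _ *m _).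
  by apply/rowP => j; rewrite !mxE; case: (_ < _); rewrite ?mulr1 ?mulr0.
have PAB : (1%:M - P *+ 2) *m A = B.
  have -> : 1%:M - P *+ 2 = adj U *m diag_mx (const_mx 1 - p *+ 2) *m U.
    have -> : diag_mx (const_mx 1 - p *+ 2) = 1%:M - (diag_mx p + diag_mx p).
      apply/matrixP => i j; rewrite !mxE.
      by case: (i == j); rewrite ?mulr1n ?mulr0n ?addr0 ?subr0 ?mulr2n.
    rewrite mulr2n mulmxBr mulmx1 mulmxBl UU.
    by rewrite mulmxDr mulmxDl.
  rewrite AE diag_sandwich //; congr (_ *m diag_mx _ *m _).
  apply/rowP => j; rewrite !mxE; have [dj|dj] := real_ltP (dr j) (real0 C).
    by rewrite ltr0_norm // opprD addrA subrr sub0r mulN1r.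
  by rewrite addr0 subr0 mul1r ger0_norm.
have sP : splits P A.
  by rewrite /splits PAB /symm hB; apply: pdD => //; apply: pd_psd.
have PA : P *m A = A *m P.
  rewrite /P AE !diag_sandwich //; congr (_ *m diag_mx _ *m _).
  by apply/rowP => j; rewrite !mxE mulrC.
exists B, P; split; split=> //.
  exact/(trans_unit_trace o0 oP)/(splits_trans_unit o0 oP hA).
have PBA : (1%:M - P *+ 2) *m B = A.
  rewrite -PAB mulmxA.
  have -> : (1%:M - P *+ 2) *m (1%:M - P *+ 2) = 1%:M.
    rewrite {2}[P *+ 2]mulr2n mulmxBr mulmx1 mulmxDr (refl_fix (proj2 oP)).
    by rewrite scaleN1r -opprD opprK -mulr2n subrK.
  by rewrite mul1mx.
rewrite -{1}PBA mulmxK ?pd_unit // opprB addrC subrK -[P *+ 2]scaler_nat scalerA.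
by rewrite mulVf ?pnatr_eq0 // scale1r.
Qed.

(** The matrix Y = (1 - P2) P1 commutes with f and has its range in the part of
    f above c2, while the range of its adjoint Y' lies in the part below c1.
    As tr (Y' f Y) = tr (Y f Y'), this is impossible for c1 <= c2 unless Y = 0. *)
Lemma splits_le P1 P2 f c1 c2 : oproj P1 -> oproj P2 -> adj f = f ->
  c1 \is Num.real -> c2 \is Num.real -> c1 <= c2 ->
  P1 *m f = f *m P1 -> P2 *m f = f *m P2 ->
  splits P1 (f - c1%:M) -> splits P2 (f - c2%:M) -> P2 *m P1 = P1.
Proof.
move=> o1 o2 hf r1 r2 c12 Pf1 Pf2 s1 s2.
set Y := (1%:M - P2) *m P1.
suff Y0 : Y = 0 by move/eqP: Y0; rewrite /Y mulmxBl mul1mx subr_eq0 => /eqP.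
apply/eqP; apply: contraT => Yn0.
have o2' := oproj_compl o2.
have P2Y : P2 *m Y = 0 by rewrite mulmxA oproj_complr // mul0mx.
have YP1 : Y *m P1 = Y by rewrite /Y -mulmxA (proj2 o1).
have P1Y : P1 *m adj Y = adj Y by rewrite -{1}(proj1 o1) -adjM YP1.
have Yf : Y *m f = f *m Y.
  by rewrite /Y -mulmxA Pf1 !mulmxA; congr (_ *m _); rewrite mulmxBl mulmxBr mul1mx mulmx1 Pf2.
clearbody Y.
have hA c : c \is Num.real -> adj (f - c%:M) = f - c%:M.
  by move=> rc; rewrite adjB hf adj_scalar.
have := pd_trace_gt0 s2 Yn0.
rewrite (symm_refl_compress o2 (hA _ r2) (refl_ker P2Y)) ?real1 // scale1r raddfMn /=.
have aYn0 : adj Y != 0 by apply: contraNneq Yn0 => Y0; rewrite -[Y]adjK Y0 adj0.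
have := pd_trace_gt0 s1 aYn0.
rewrite (symm_refl_compress o1 (hA _ r1) (refl_fix P1Y)) ?realN ?real1 // scaleN1r.
rewrite raddfMn raddfN /=.
rewrite !pmulrn_lgt0 // adjK !mulmxBr !mulmxBl ![\tr (_ - _)]raddfB /=.
rewrite !mul_mx_scalar -!scalemxAl !mxtraceZ.
have -> : \tr (adj Y *m f *m Y) = \tr (Y *m f *m adj Y).
  by rewrite [RHS]mxtrace_mulC Yf mulmxA.
have -> : \tr (Y *m adj Y) = \tr (adj Y *m Y) by rewrite mxtrace_mulC.
set t := \tr (Y *m f *m adj Y); set u := \tr (adj Y *m Y).
have u0 : 0 <= u.
  by rewrite /u -[adj Y]mulmx1 psd_trace_ge0 //; apply/pd_psd/pd1.
move=> h1 h2; have := addr_gt0 h1 h2.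
rewrite opprB addrA subrK subr_gt0 => h.
have := le_lt_trans (ler_wpM2r u0 c12) h; by rewrite ltxx.
Qed.

(** By [splits_le] one projection dominates the other, and then equal traces
    make them equal. *)
Lemma splits_uniq P1 P2 f c1 c2 : oproj P1 -> oproj P2 -> adj f = f ->
  c1 \is Num.real -> c2 \is Num.real ->
  P1 *m f = f *m P1 -> P2 *m f = f *m P2 ->
  splits P1 (f - c1%:M) -> splits P2 (f - c2%:M) ->
  \tr P1 = \tr P2 -> P1 = P2.
Proof.
wlog c12 : P1 P2 c1 c2 / c1 <= c2.
  move=> W o1 o2 hf r1 r2 f1 f2 s1 s2 rk.
  by have [c12|/ltW c12] := real_leP r1 r2; [|symmetry]; apply: W c12 _ _ _ _ _ _ _ _ _ _.
move=> o1 o2 hf r1 r2 f1 f2 s1 s2 rk.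
have P21 := splits_le o1 o2 hf r1 r2 c12 f1 f2 s1 s2.
have P12 : P1 *m P2 = P1.
  by have := congr1 (@adj _ _ _) P21; rewrite adjM (proj1 o1) (proj1 o2).
have oD : oproj (P2 - P1).
  split; first by rewrite adjB (proj1 o1) (proj1 o2).
  by rewrite mulmxBl !mulmxBr (proj2 o1) (proj2 o2) P12 P21 subrr subr0.
have pD : psd (P2 - P1).
  by move=> x; rewrite -(proj2 oD) -{1}(proj1 oD) qf_gram qf1_ge0.
have := psd_trace_eq0 (proj1 oD) pD; rewrite raddfB /= rk subrr.
by move=> /(_ erefl)/eqP; rewrite subr_eq0 => /eqP.
Qed.

End Gap.

(** * Quantitative positivity and the Sylvester equation *)

Section Sylvester.
Context {C : numClosedFieldType} {n : nat}.
Implicit Types (A B D Y : 'M[C]_n) (x : 'cV[C]_n).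

Lemma trace_gram_entries Y : \tr (adj Y *m Y) = \sum_j \sum_i `|Y i j| ^+ 2.
Proof.
rewrite -[adj Y]mulmx1 trace_qf; apply: eq_bigr => j _; rewrite qf1.
by apply: eq_bigr => i _; rewrite mxE.
Qed.

Lemma entry_qf1 x i : `|x i 0| ^+ 2 <= qf 1%:M x.
Proof.
rewrite qf1 (bigD1 i) //= lerDl; apply: sumr_ge0 => k _; exact: exprn_ge0.
Qed.

Lemma entry_mul_qf1 x i j : `|x i 0| * `|x j 0| <= qf 1%:M x.
Proof.
have [ij|/ltW ij] := real_leP (normr_real (x i 0)) (normr_real (x j 0)).
  by apply: le_trans (entry_qf1 x j); rewrite expr2 ler_wpM2r.
by apply: le_trans (entry_qf1 x i); rewrite expr2 ler_wpM2l.
Qed.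

Lemma qf_small D x (delta : C) : (forall i j, `|D i j| <= delta) ->
  `|qf D x| <= delta * (n * n)%N%:R * qf 1%:M x.
Proof.
move=> Ds.
have -> : qf D x = \sum_i \sum_j adj x 0 i * (D i j * x j 0).
  by rewrite /qf -mulmxA mxE; apply: eq_bigr => i _; rewrite [(D *m x) i 0]mxE mulr_sumr.
apply: le_trans (ler_norm_sum _ _ _) _.
apply: (@le_trans _ _ (\sum_(i < n) \sum_(j < n) delta * qf 1%:M x)).
  apply: ler_sum => i _; apply: le_trans (ler_norm_sum _ _ _) _.
  apply: ler_sum => j _; rewrite adjE !normrM norm_conjC mulrCA.
  by rewrite ler_pM ?mulr_ge0 ?entry_mul_qf1.
by rewrite !sumr_const card_ord -mulrnA -mulrA mulr_natl mulrnAr lexx.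
Qed.

(** Coercivity leaves a margin eps, and a perturbation with entries at most
    delta changes the quadratic form by at most n^2 delta times the square norm. *)
Lemma pd_open A : adj A = A -> pd A -> exists2 delta, 0 < delta &
  forall D, adj D = D -> (forall i j, `|D i j| <= delta) -> pd (A + D).
Proof.
move=> hA pA; have [eps e0 cA] := pd_coercive hA pA.
have k0 : 0 < (n * n)%N%:R + 1 :> C by rewrite ltr_wpDl.
exists (eps / ((n * n)%N%:R + 1)) => [|D hD Ds x x0]; first by rewrite divr_gt0.
have qr : qf D x \is Num.real by apply/CrealP; rewrite -qf_adj hD.
have q1 := pd1 x0.
have h1 : eps * qf 1%:M x <= qf A x.
  by have := cA x; rewrite qfB qf_scalar subr_ge0.
have := qf_small x Ds; rewrite real_ler_norml // => /andP[h2 _].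
rewrite qfD; apply: lt_le_trans (lerD h1 h2); rewrite -mulrBl mulr_gt0 //.
by rewrite subr_gt0 -mulrA gtr_pMr // mulrC ltr_pdivrMr // mul1r ltrDl.
Qed.

Definition sylvester A B Y := A *m Y + Y *m B.

(** Pairing with Y turns the left side into tr (Y' A Y) + tr (Y B Y') for the
    adjoint Y' of Y, which is positive unless Y = 0. *)
Lemma sylvester_inj A B Y : psd A -> pd B -> sylvester A B Y = 0 -> Y = 0.
Proof.
move=> pA pB /(congr1 (fun Z => \tr (adj Y *m Z))).
rewrite mulmx0 mxtrace0 mulmxDr raddfD /= mulmxA.
have -> : \tr (adj Y *m (Y *m B)) = \tr (adj (adj Y) *m B *m adj Y).
  by rewrite adjK [RHS]mxtrace_mulC.
move=> t0; apply/eqP; apply: contraT => Y0.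
have aY0 : adj Y != 0 by apply: contraNneq Y0 => a0; rewrite -[Y]adjK a0 adj0.
have := ltr_wpDl (psd_trace_ge0 Y pA) (pd_trace_gt0 pB aY0).
by rewrite t0 ltxx.
Qed.

(** The matrix of the Sylvester operator: its entries are linear in those of A
    and B, so that its inverse inherits their regularity. *)
Definition sylvester_mx A B : 'M[C]_(n * n) := lin_mulmx A + lin_mulmxr B.

Lemma mul_sylvester_mx A B Y :
  mxvec Y *m sylvester_mx A B = mxvec (sylvester A B Y).
Proof. by rewrite mulmxDr !mul_vec_lin /= raddfD. Qed.

Lemma sylvester_mx_unit A B : psd A -> pd B -> sylvester_mx A B \in unitmx.
Proof.
move=> pA pB; rewrite unitmxE unitfE; apply/det0P => -[v v0].
rewrite -[v]vec_mxK mul_sylvester_mx => /(canRL mxvecK).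
rewrite raddf0 => /(sylvester_inj pA pB) v'0.
by rewrite -[v]vec_mxK v'0 raddf0 eqxx in v0.
Qed.

Lemma sylvester_solve A B Y D : psd A -> pd B -> sylvester A B Y = D ->
  Y = vec_mx (mxvec D *m invmx (sylvester_mx A B)).
Proof.
move=> pA pB <-; rewrite -mul_sylvester_mx mulmxK ?mxvecK //.
exact: sylvester_mx_unit.
Qed.

(** Pairing with Y bounds eps times the square norm of Y by tr (Y' D) for the
    adjoint Y' of Y, and
    there are n^2 entries of size at most delta.  The bound does not involve A,
    which makes it uniform along a family. *)
Lemma sylvester_bound A B Y D (eps delta : C) i j : psd A -> psd (B - eps%:M) ->
  0 < eps -> sylvester A B Y = D -> (forall i j, `|D i j| <= delta) ->
  eps * `|Y i j| <= delta * n%:R.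
Proof.
move=> pA pB e0 YD Ds; have d0 : 0 <= delta by apply: le_trans (Ds i j).
have h1 : eps * \tr (adj Y *m Y) <= \tr (adj Y *m D).
  rewrite -YD mulmxDr raddfD /= mulmxA -[X in X <= _]add0r lerD ?psd_trace_ge0 //.
  have -> : \tr (adj Y *m (Y *m B)) = \tr (adj (adj Y) *m B *m adj Y).
    by rewrite adjK [RHS]mxtrace_mulC.
  have := psd_trace_ge0 (adj Y) pB.
  rewrite mulmxBr mulmxBl mul_mx_scalar -scalemxAl raddfB /= mxtraceZ subr_ge0.
  by rewrite adjK [\tr (Y *m adj Y)]mxtrace_mulC.
pose S := \sum_j \sum_i `|Y i j| ^+ 2; pose L := \sum_j \sum_i `|Y i j|.
have h2 : eps * S <= delta * L.
  have SE : \tr (adj Y *m Y) = S by exact: trace_gram_entries.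
  have S0 : 0 <= S by do 2![rewrite sumr_ge0 // => ? _]; rewrite exprn_ge0.
  have t0 : 0 <= \tr (adj Y *m D).
    by apply: le_trans h1; rewrite SE mulr_ge0 // ltW.
  apply: le_trans (_ : `|\tr (adj Y *m D)| <= _); first by rewrite ger0_norm -?SE.
  rewrite mulr_sumr; apply: le_trans (ler_norm_sum _ _ _) _.
  apply: ler_sum => k _; rewrite mxE mulr_sumr.
  apply: le_trans (ler_norm_sum _ _ _) _; apply: ler_sum => l _.
  by rewrite adjE normrM norm_conjC mulrC ler_wpM2r.
(* The arithmetic-geometric mean inequality, entry by entry. *)
have h3 : eps * delta * L *+ 2 <= eps ^+ 2 * S + delta ^+ 2 * (n * n)%N%:R.
  have -> : delta ^+ 2 * (n * n)%N%:R = \sum_(j < n) \sum_(i < n) delta ^+ 2.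
    by rewrite !sumr_const card_ord mulr_natr mulrnA.
  rewrite !mulr_sumr -big_split -sumrMnl; apply: ler_sum => k _.
  rewrite !mulr_sumr -big_split -sumrMnl; apply: ler_sum => l _ /=.
  rewrite -subr_ge0 -exprMn -mulrA [delta * _]mulrC mulrA addrAC -sqrrB.
  by rewrite real_exprn_even_ge0 // realB // ger0_real ?mulr_ge0 ?(ltW e0).
have h4 : eps ^+ 2 * S <= delta ^+ 2 * (n * n)%N%:R.
  have := ler_wpM2l (ltW e0) h2; rewrite mulrA -expr2 mulrA -(ler_pMn2r (ltn0Sn 1)).
  by move=> /le_trans/(_ h3); rewrite mulr2n lerD2l.
rewrite -ler_sqr ?nnegrE ?mulr_ge0 ?(ltW e0) // !exprMn -natrX -mulnn.
apply: le_trans h4; rewrite ler_wpM2l ?exprn_ge0 ?(ltW e0) // /S (bigD1 j) //=.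
rewrite (bigD1 i) //= -addrA lerDl; apply: addr_ge0; apply: sumr_ge0 => k _.
  exact: exprn_ge0.
by apply: sumr_ge0 => l _; exact: exprn_ge0.
Qed.

End Sylvester.

(** * Gluing positive matrices supported on orthogonal subspaces *)

Section BlockSum.
Context {C : numClosedFieldType} {n : nat}.
Variables (P H K : 'M[C]_n).

(** The matrix form of a point (h, k, W): H is carried by the range W of P, and
    K by the kernel of P, where it is positive definite. *)
Definition block_data := [/\ oproj P,
  [/\ adj H = H, psd H & \tr H <= 1],
  [/\ adj K = K, forall v : 'cV_n, P *m v = 0 -> v != 0 -> 0 < qf K v & \tr K = 1],
  P *m H = H /\ H *m P = H & P *m K = 0 /\ K *m P = 0].

Definition block_sum : 'M[C]_n := H + (1 - \tr H) *: K.

Hypothesis bd : block_data.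

Lemma block_psdK : psd K.
Proof.
have [oP _ [_ pK _] _ [PK KP]] := bd => v.
have -> : qf K v = qf K ((1%:M - P) *m v).
  rewrite -qf_congr (proj1 (oproj_compl oP)) mulmxBl mul1mx PK subr0.
  by rewrite mulmxBr mulmx1 KP subr0.
have [->|v0] := eqVneq ((1%:M - P) *m v) 0; first by rewrite qf0.
by rewrite ltW // pK // mulmxA oproj_complr // mul0mx.
Qed.

Lemma block_sum_projr : block_sum *m P = H.
Proof.
have [_ _ _ [_ HP] [_ KP]] := bd.
by rewrite /block_sum mulmxDl -scalemxAl HP KP scaler0 addr0.
Qed.

Lemma block_sum_projl : P *m block_sum = H.
Proof.
have [_ _ _ [PH _] [PK _]] := bd.
by rewrite /block_sum mulmxDr -scalemxAr PH PK scaler0 addr0.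
Qed.

Lemma block_trace_real : 1 - \tr H \is Num.real.
Proof.
by have [_ [_ pH _] _ _ _] := bd; rewrite realB ?real1 // ger0_real // psd_trace.
Qed.

Lemma adj_block_sum : adj block_sum = block_sum.
Proof.
have [_ [hH _ _] [hK _ _] _ _] := bd.
by rewrite /block_sum adjD adjZ hH hK (CrealP block_trace_real).
Qed.

Lemma psd_block_sum : psd block_sum.
Proof.
have [_ [_ pH tH] _ _ _] := bd => v.
by rewrite /block_sum qfD qfZ addr_ge0 // mulr_ge0 ?subr_ge0 //; exact: block_psdK.
Qed.

Lemma trace_block_sum : \tr block_sum = 1.
Proof.
have [_ _ [_ _ tK] _ _] := bd.
by rewrite /block_sum mxtraceD mxtraceZ tK mulr1 addrC subrK.
Qed.

Lemma block_sumK : 1 - \tr H != 0 ->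
  K = (1 - \tr H)^-1 *: (block_sum *m (1%:M - P)).
Proof.
move=> t1; rewrite mulmxBr mulmx1 block_sum_projr /block_sum addrAC subrr add0r.
by rewrite scalerA mulVf // scale1r.
Qed.

(** Applying P shows that H kills v; so does K then, which is definite off the
    range of P. *)
Lemma block_sum_ker (v : 'cV[C]_n) : 1 - \tr H != 0 -> block_sum *m v = 0 ->
  P *m v = v /\ H *m v = 0.
Proof.
have [oP _ [_ pK _] _ [_ KP]] := bd => t1 Fv.
have Hv : H *m v = 0 by rewrite -block_sum_projl -mulmxA Fv mulmx0.
have Kv : K *m v = 0.
  apply/eqP; have := Fv; rewrite /block_sum mulmxDl Hv add0r -scalemxAl => /eqP.
  by rewrite scaler_eq0 (negPf t1).
split=> //; apply/esym/eqP; rewrite -subr_eq0.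
have -> : v - P *m v = (1%:M - P) *m v by rewrite mulmxBl mul1mx.
apply: contraT => v0; have := pK _ _ v0.
rewrite mulmxA oproj_complr // mul0mx => /(_ erefl); rewrite /qf -mulmxA.
by rewrite [K *m _]mulmxA mulmxBr mulmx1 KP subr0 Kv mulmx0 mxE ltxx.
Qed.

(** If tr H = 1, the sum is H, which vanishes on v; but the sum
    exceeds c on the kernel of P. *)
Lemma block_trace_neq1 c (v : 'cV_n) : 0 < c -> splits P (block_sum - c%:M) ->
  P *m v = 0 -> v != 0 -> 1 - \tr H != 0.
Proof.
have [oP _ _ [_ HP] _] := bd => c0 s Pv v0; apply/eqP => t1.
have hA : adj (block_sum - c%:M) = block_sum - c%:M.
  by rewrite adjB adj_block_sum adj_scalar // ger0_real // ltW.
have := splits_pos oP hA s Pv v0.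
rewrite /block_sum t1 scale0r addr0 qfB qf_scalar.
have -> : qf H v = 0 by rewrite /qf -mulmxA -HP -mulmxA Pv !mulmx0 mxE.
by rewrite sub0r oppr_gt0 lt_gtF // mulr_gt0 // pd1.
Qed.

End BlockSum.

Section BlockSumExtra.
Context {C : numClosedFieldType} {n : nat}.
Implicit Types (P F H K : 'M[C]_n).

Lemma psdZ a H : 0 <= a -> adj H = H -> psd H ->
  adj (a *: H) = a *: H /\ psd (a *: H).
Proof.
move=> a0 hH pH; split; last by move=> x; rewrite qfZ mulr_ge0.
by rewrite adjZ hH (CrealP (ger0_real a0)).
Qed.

(** F commutes with P, so it is the sum of its compressions to the range and to
    the kernel of P.  The second one exceeds c, hence has a nonzero trace s. *)
Lemma block_data_compress P F c (v : 'cV_n) (s := 1 - \tr (F *m P)) :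
  oproj P -> adj F = F -> psd F -> \tr F = 1 -> P *m F = F *m P ->
  0 < c -> splits P (F - c%:M) -> P *m v = 0 -> v != 0 ->
  [/\ s != 0, block_data P (F *m P) (s^-1 *: (F *m (1%:M - P))) &
      block_sum (F *m P) (s^-1 *: (F *m (1%:M - P))) = F].
Proof.
move=> oP hF pF tF cPF c0 sp Pv v0.
have oQ := oproj_compl oP; set Q := 1%:M - P in oQ *.
have cQF : Q *m F = F *m Q by rewrite mulmxBl mulmxBr mul1mx mulmx1 cPF.
have pc (D : 'M[C]_n) : oproj D -> D *m F = F *m D -> adj (F *m D) = F *m D /\ psd (F *m D).
  move=> oD cD; have -> : F *m D = adj D *m F *m D.
    by rewrite (proj1 oD) cD -mulmxA (proj2 oD).
  split; first by rewrite !adjM adjK hF mulmxA.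
  by move=> x; rewrite qf_congr.
have [hP pP] := pc P oP cPF; have [hQ pQ] := pc Q oQ cQF.
have hA : adj (F - c%:M) = F - c%:M.
  by rewrite adjB hF adj_scalar // ger0_real // ltW.
have Fpos w : P *m w = 0 -> w != 0 -> 0 < qf F w.
  move=> Pw w0; have := splits_pos oP hA sp Pw w0.
  rewrite qfB qf_scalar subr_gt0; apply: lt_trans.
  by rewrite mulr_gt0 // pd1.
have FQE w : P *m w = 0 -> qf (F *m Q) w = qf F w.
  move=> Pw; rewrite /qf mulmxA -mulmxA; congr ((_ *m _) 0 0).
  by rewrite mulmxBl mul1mx Pw subr0.
have sE : s = \tr (F *m Q) by rewrite mulmxBr mulmx1 raddfB /= tF.
have s0 : s != 0.
  apply/eqP => s0; rewrite s0 in sE.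
  have FQ0 := psd_trace_eq0 hQ pQ (esym sE).
  have := Fpos v Pv v0; rewrite -FQE // FQ0 /qf mulmx0 mul0mx mxE ltxx.
  by [].
have sp0 : 0 < s by rewrite lt0r s0 sE psd_trace.
split=> //.
- split=> //.
  + by split=> //; rewrite -subr_ge0 -/s ltW.
  + have si : 0 <= s^-1 by rewrite invr_ge0 ltW.
    have [hs ps] := psdZ si hQ pQ; split=> //.
      by move=> w Pw w0; rewrite qfZ mulr_gt0 ?invr_gt0 // FQE // Fpos.
    by rewrite mxtraceZ -sE mulVf.
  + by rewrite mulmxA cPF -mulmxA (proj2 oP).
  + split; last by rewrite -scalemxAl -mulmxA oproj_compll // mulmx0 scaler0.
    by rewrite -scalemxAr mulmxA cPF -mulmxA oproj_complr // mulmx0 scaler0.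
- rewrite /block_sum -/s scalerA divff // scale1r -mulmxDr /Q addrC subrK.
  by rewrite mulmx1.
Qed.

(** The projection is determined by the sum because it is spectral: it
    projects onto the eigenspaces below the gap. *)
Lemma block_sum_inj P P' H H' K K' c c' :
  block_data P H K -> block_data P' H' K' ->
  0 < c -> splits P (block_sum H K - c%:M) ->
  0 < c' -> splits P' (block_sum H' K' - c'%:M) ->
  \tr P = \tr P' -> 1 - \tr H != 0 -> 1 - \tr H' != 0 ->
  block_sum H K = block_sum H' K' -> [/\ P = P', H = H' & K = K'].
Proof.
move=> b b' c0 s c0' s' tPP t t' F; rewrite -F in s'.
have [oP _ _ _ _] := b; have [oP' _ _ _ _] := b'.
have PE : P = P'.
  apply: (splits_uniq oP oP' (adj_block_sum b) _ _ _ _ s s' tPP).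
  - exact: gtr0_real.
  - exact: gtr0_real.
  - by rewrite (block_sum_projl b) (block_sum_projr b).
  - by rewrite F (block_sum_projl b') (block_sum_projr b').
have HE : H = H' by rewrite -(block_sum_projr b) -(block_sum_projr b') F PE.
by split=> //; rewrite (block_sumK b t) (block_sumK b' t') F HE PE.
Qed.

(** F vanishes on the range of P and is bounded below on the kernel of P, by
    the coercivity constant eps of F + P; so eps / 2 separates the two parts. *)
Lemma kernel_splits P F : oproj P -> adj F = F -> psd F -> F *m P = 0 ->
  (forall v : 'cV_n, P *m v = 0 -> v != 0 -> 0 < qf F v) ->
  exists2 c, 0 < c & splits P (F - c%:M).
Proof.
move=> oP hF pF FP Fpos; have PF : P *m F = 0.
  by have := congr1 (@adj _ _ _) FP; rewrite adjM hF (proj1 oP) adj0.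
have hFP : adj (F + P) = F + P by rewrite adjD hF (proj1 oP).
have qP w : qf P w = qf 1%:M (P *m w).
  by rewrite -{1}(proj2 oP) -{1}(proj1 oP) qf_gram.
have pFP : pd (F + P).
  move=> w w0; rewrite qfD qP; have [Pw|Pw] := eqVneq (P *m w) 0.
    by rewrite Pw qf0 addr0 Fpos.
  by rewrite ltr_wpDl // pd1.
have [eps e0 ce] := pd_coercive hFP pFP.
exists (eps / 2); first by rewrite divr_gt0 ?ltr0n.
set c := eps / 2; have c2 : c *+ 2 = eps by rewrite -mulr_natr divfK ?pnatr_eq0.
have QE : (1%:M - P *+ 2) *m (F - c%:M) =
    adj (1%:M - P) *m (F + P - eps%:M) *m (1%:M - P) + c%:M.
  have -> : adj (1%:M - P) = 1%:M - P by exact: (proj1 (oproj_compl oP)).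
  have -> : (1%:M - P) *m (F + P - eps%:M) *m (1%:M - P) = F - eps *: (1%:M - P).
    have -> : (1%:M - P) *m (F + P - eps%:M) = F - eps *: (1%:M - P).
      rewrite mulmxBr mulmxDr oproj_compll // addr0 mulmxBl PF subr0 mul1mx.
      by rewrite mul_mx_scalar.
    rewrite mulmxBl -scalemxAl (proj2 (oproj_compl oP)).
    by rewrite mulmxBr mulmx1 FP subr0.
  rewrite mulr2n mulmxBl mul1mx mulmxDl mulmxBr PF sub0r mul_mx_scalar.
  rewrite -c2 mulr2n scalerDl !scalerBr !scalemx1.
  move: (c%:M) (c *: P) => x y; rewrite !opprD !opprK -!addrA [y + x]addrC.
  by rewrite addKr.
have hX : adj ((1%:M - P *+ 2) *m (F - c%:M)) = (1%:M - P *+ 2) *m (F - c%:M).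
  have hM : adj (F + P - eps%:M) = F + P - eps%:M.
    by rewrite adjB hFP adj_scalar // ger0_real // ltW.
  rewrite QE adjD adjM [adj (adj _ *m _)]adjM hM adjK adj_scalar ?mulmxA //.
  by rewrite ger0_real // ltW // divr_gt0 ?ltr0n.
move=> v v0; rewrite /symm hX QE !qfD qf_congr qf_scalar.
have := ce ((1%:M - P) *m v); set q := qf _ _ => q0.
have c0 : 0 < c * qf 1%:M v by rewrite mulr_gt0 ?pd1 // divr_gt0 ?ltr0n.
by rewrite addr_gt0 // ltr_wpDl.
Qed.

End BlockSumExtra.

(** * Functions of class C^k *)

Section Ck.
Context {R : realType} {V : normedModType R}.
Implicit Types (O : set V).

(** [C_on] with an arbitrary normed module as source and target, to be applied
    to the real and imaginary parts of matrix entries. *)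
Fixpoint Ck (W : normedModType R) (k : nat) O (F : V -> W) : Prop :=
  if k is k'.+1 then
    (forall x, O x -> differentiable F x) /\ (forall v, Ck k' O ('D_v F))
  else forall x, O x -> {for x, continuous F}.

Section vector_valued.
Context {W : normedModType R}.
Implicit Types F G : V -> W.

Lemma open_nbhs_eq O F G x : open O -> O x -> (forall y, O y -> F y = G y) ->
  \forall y \near x, F y = G y.
Proof. by move=> oO Ox FG; apply: filterS FG _; exact: open_nbhs_nbhs. Qed.

(** A plain epsilon estimate that yields differentiability with zero
    differential. *)
Lemma differentiable_small F x : F x = 0 ->
  (forall e : R, 0 < e -> \forall y \near 0, `|F (y + x)| <= e * `|y|) ->
  differentiable F x.
Proof.
move=> Fx0 Fs.
have E : F \o shift x = cst (F x) + 0 +o_ 0 id.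
  apply/eqaddoP => e e0; apply: filterS (Fs e e0) => y.
  by rewrite Fx0 addr0 -[(_ - _) y]/(F (y + x) - 0) subr0.
have c0 : continuous (0 : V -> W) by move=> y; exact: cvg_cst.
have dE : 'd F x = 0 :> (V -> W) by exact: diff_unique.
by apply/diff_locallyP; rewrite dE.
Qed.

Lemma differentiable_near F G x : (\forall y \near x, F y = G y) ->
  differentiable F x -> differentiable G x.
Proof.
move=> FG dF.
suff dH : differentiable (fun y => G y - F y) x.
  rewrite (_ : G = F + (fun y => G y - F y)); first exact: differentiableD.
  by apply/funext => y; rewrite fctE addrC subrK.
apply: differentiable_small; first by rewrite (nbhs_singleton FG) subrr.
move=> e e0; move: FG; rewrite (near_shift 0 x) => FG.
apply: filterS FG => y; rewrite /= subr0 => ->.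
by rewrite subrr normr0 mulr_ge0 // ltW.
Qed.

Lemma Ck_eq k O F G : open O -> (forall x, O x -> F x = G x) ->
  Ck k O F -> Ck k O G.
Proof.
move=> oO; elim: k F G => [|k IH] F G FG /=.
  move=> cF x Ox; have nFG := open_nbhs_eq oO Ox FG.
  have := cF x Ox; rewrite /prop_for /continuous_at -(FG x Ox) => Fc.
  by apply: cvg_trans Fc; exact: near_eq_cvg.
case=> dF cF; split=> [x Ox|v].
  by apply: differentiable_near (dF x Ox); exact: open_nbhs_eq FG.
apply: IH (cF v) => x Ox; apply: near_eq_derive.
exact: open_nbhs_eq FG.
Qed.

Lemma Ck_sub k O O' F : O' `<=` O -> Ck k O F -> Ck k O' F.
Proof.
move=> sO; elim: k F => [|k IH] F /=; first by move=> cF x /sO/cF.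
by case=> dF cF; split=> [x /sO/dF|v] //; exact: IH.
Qed.

Lemma Ck_cont k O F : Ck k O F -> forall x, O x -> {for x, continuous F}.
Proof.
case: k => [//|k] [dF _] x /dF; exact: differentiable_continuous.
Qed.

Lemma Ck_pred k O F : Ck k.+1 O F -> Ck k O F.
Proof.
elim: k F => [|k IH] F; first by move=> /Ck_cont.
by case=> dF cF; split=> // v; apply: IH.
Qed.

Lemma Ck_cst k O (a : W) : Ck k O (fun=> a).
Proof.
elim: k a => [|k IH] a /=; first by move=> x _; exact: cvg_cst.
split=> [x _|v]; first exact: differentiable_cst.
by rewrite (_ : 'D_v _ = fun=> 0) //; apply/funext => x; exact: derive_cst.
Qed.

Lemma CkD k O F G : open O -> Ck k O F -> Ck k O G -> Ck k O (fun x => F x + G x).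
Proof.
move=> oO; elim: k F G => [|k IH] F G /=.
  by move=> cF cG x Ox; apply: cvgD; [exact: cF | exact: cG].
move=> [dF cF] [dG cG]; split=> [x Ox|v].
  by apply: differentiableD; [exact: dF | exact: dG].
apply: (Ck_eq oO _ (IH _ _ (cF v) (cG v))) => x Ox.
by rewrite (deriveD (diff_derivable (dF x Ox)) (diff_derivable (dG x Ox))).
Qed.

Lemma Ck_sum k O I (r : seq I) (P : pred I) (F : I -> V -> W) : open O ->
  (forall i, P i -> Ck k O (F i)) -> Ck k O (fun x => \sum_(i <- r | P i) F i x).
Proof.
move=> oO cF; elim: r => [|i r IH].
  by apply: (Ck_eq oO _ (Ck_cst k O 0)) => x _; rewrite big_nil.
case Pi: (P i); last by apply: (Ck_eq oO _ IH) => x _; rewrite big_cons Pi.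
by apply: (Ck_eq oO _ (CkD oO (cF i Pi) IH)) => x _; rewrite big_cons Pi.
Qed.

End vector_valued.

Lemma Ck_lin (W W' : normedModType R) k O (L : {linear W -> W'}) (F : V -> W) :
  open O ->
  continuous L -> Ck k O F -> Ck k O (fun x => L (F x)).
Proof.
move=> oO cL; elim: k F => [|k IH] F /=.
  by move=> cF x Ox; apply: continuous_comp; [exact: cF | exact: cL].
move=> [dF cF]; have dL y : differentiable L y by exact: linear_differentiable.
split=> [x Ox|v]; first by apply: differentiable_comp; [exact: dF|].
apply: (Ck_eq oO _ (IH _ (cF v))) => x Ox.
rewrite (deriveE v (dF x Ox)) deriveE; last exact: differentiable_comp (dF x Ox) _.
by rewrite (diff_comp (dF x Ox) (dL _)) /= (diff_lin _ cL).
Qed.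

Section scalar_valued.
Implicit Types f g : V -> R.

Lemma CkM k O f g : open O -> Ck k O f -> Ck k O g -> Ck k O (fun x => f x * g x).
Proof.
move=> oO; elim: k f g => [|k IH] f g.
  by move=> cf cg x Ox; apply: cvgM; [exact: cf | exact: cg].
move=> cf cg; have [df cDf] := cf; have [dg cDg] := cg; split=> [x Ox|v].
  by apply: differentiableM; [exact: df | exact: dg].
apply: (Ck_eq oO _ (CkD oO (IH _ _ (Ck_pred cf) (cDg v)) (IH _ _ (Ck_pred cg) (cDf v)))).
move=> x Ox.
by rewrite (deriveM (diff_derivable (df x Ox)) (diff_derivable (dg x Ox))).
Qed.

Lemma CkN k O f : open O -> Ck k O f -> Ck k O (fun x => - f x).
Proof.
move=> oO cf; have c1 : Ck k O (fun=> -1 : R) := Ck_cst k O _.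
by apply: (Ck_eq oO _ (CkM oO c1 cf)) => x _; rewrite mulN1r.
Qed.

Lemma CkV k O f : open O -> (forall x, O x -> f x != 0) -> Ck k O f ->
  Ck k O (fun x => (f x)^-1).
Proof.
move=> oO f0; elim: k f f0 => [|k IH] f f0.
  by move=> cf x Ox; apply: cvgV; [exact: f0 | exact: cf].
move=> cf; have [df cDf] := cf; split=> [x Ox|v].
  by apply: differentiableV; [exact: df | exact: f0].
have ci := IH _ f0 (Ck_pred cf).
apply: (Ck_eq oO _ (CkN oO (CkM oO (CkM oO ci ci) (cDf v)))) => x Ox.
rewrite (deriveV (f0 x Ox) (diff_derivable (df x Ox))).
by rewrite -exprVn expr2 /GRing.scale /= mulNr.
Qed.

Lemma differentiable_lipschitz g x : differentiable g x ->
  exists2 k, 0 < k & \forall y \near 0, `|g (y + x) - g x| <= k * `|y|.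
Proof.
move=> dg; have [k k0 kg] := linear_lipschitz (diff_continuous dg).
exists (k + 1); first by rewrite addr_gt0.
have /eqaddoP/(_ 1 ltr01) := diff_locally dg; apply: filterS => y.
rewrite /= mul1r !fctE /= => h.
have -> : g (y + x) - g x = (g (y + x) - (g x + 'd g x y)) + 'd g x y.
  by rewrite opprD addrA subrK.
by apply: le_trans (ler_normD _ _) _; rewrite mulrDl mul1r addrC lerD.
Qed.

(** The increment of the continuous factor only contributes to second order,
    because the other factor vanishes at the point. *)
Lemma differentiable_mul_vanish f g x : {for x, continuous f} ->
  differentiable g x -> g x = 0 -> differentiable (fun y => f y * g y) x.
Proof.
move=> cf dg gx0.
suff dH : differentiable (fun y => (f y - f x) * g y) x.
  rewrite (_ : (fun y => _) = (fun y => (f y - f x) * g y) + cst (f x) * g).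
    by apply: differentiableD => //; apply: differentiableM.
  by apply/funext => y; rewrite !fctE mulrBl subrK.
have [k k0 kg] := differentiable_lipschitz dg.
apply: differentiable_small; first by rewrite subrr mul0r.
move=> e e0; have ek : 0 < e / k by rewrite divr_gt0.
have cf' : \forall y \near x, `|f x - f y| <= e / k.
  by have /cvgrPdist_le/(_ _ ek) := cf.
move: cf'; rewrite (near_shift 0 x) => cf'.
apply: filterS2 kg cf' => y; rewrite gx0 subr0 /= subr0 => h1 h2.
have -> : e * `|y| = e / k * (k * `|y|) by rewrite mulrA divfK // lt0r_neq0.
by rewrite normrM distrC ler_pM.
Qed.

End scalar_valued.
End Ck.

Section ComplexCk.
Context {R : realType} {V : normedModType R}.
Implicit Types (O : set V) (f g : V -> R[i]).

Local Notation re z := (complex.Re z).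
Local Notation im z := (complex.Im z).

(** Derivatives are taken along real directions, so complex values are split
    into real and imaginary parts. *)
Definition Cc k O f := Ck k O (fun x => re (f x)) /\ Ck k O (fun x => im (f x)).

Lemma Cc_eq k O f g : open O -> (forall x, O x -> f x = g x) ->
  Cc k O f -> Cc k O g.
Proof.
move=> oO fg [cr ci]; split; [apply: Ck_eq cr | apply: Ck_eq ci] => //.
  by move=> x /fg->.
by move=> x /fg->.
Qed.

Lemma Cc_pred k O f : Cc k.+1 O f -> Cc k O f.
Proof. by case=> cr ci; split; exact: Ck_pred. Qed.

Lemma Cc_sub k O O' f : O' `<=` O -> Cc k O f -> Cc k O' f.
Proof. by move=> sO [cr ci]; split; apply: Ck_sub sO _. Qed.

Lemma Cc_cst k O (a : R[i]) : Cc k O (fun=> a).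
Proof. by split; exact: Ck_cst. Qed.

Lemma CcD k O f g : open O -> Cc k O f -> Cc k O g -> Cc k O (fun x => f x + g x).
Proof.
move=> oO [fr fi] [gr gi]; split.
  by apply: (Ck_eq oO _ (CkD oO fr gr)) => x _; case: (f x) (g x) => ? ? [].
by apply: (Ck_eq oO _ (CkD oO fi gi)) => x _; case: (f x) (g x) => ? ? [].
Qed.

Lemma CcM k O f g : open O -> Cc k O f -> Cc k O g -> Cc k O (fun x => f x * g x).
Proof.
move=> oO [fr fi] [gr gi]; split.
  apply: (Ck_eq oO _ (CkD oO (CkM oO fr gr) (CkN oO (CkM oO fi gi)))) => x _.
  by case: (f x) (g x) => ? ? [].
apply: (Ck_eq oO _ (CkD oO (CkM oO fr gi) (CkM oO fi gr))) => x _.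
by case: (f x) (g x) => ? ? [].
Qed.

Lemma CcN k O f : open O -> Cc k O f -> Cc k O (fun x => - f x).
Proof.
move=> oO cf; apply: (Cc_eq oO _ (CcM oO (Cc_cst k O (-1)) cf)) => x _.
by rewrite mulN1r.
Qed.

Lemma CcB k O f g : open O -> Cc k O f -> Cc k O g -> Cc k O (fun x => f x - g x).
Proof. by move=> oO cf cg; apply: CcD => //; exact: CcN. Qed.

Lemma Cc_conj k O f : open O -> Cc k O f -> Cc k O (fun x => conjC (f x)).
Proof.
move=> oO [fr fi]; split.
  by apply: (Ck_eq oO _ fr) => x _; case: (f x).
by apply: (Ck_eq oO _ (CkN oO fi)) => x _; case: (f x).
Qed.

Lemma Cc_sum k O I (r : seq I) (P : pred I) (F : I -> V -> R[i]) : open O ->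
  (forall i, P i -> Cc k O (F i)) -> Cc k O (fun x => \sum_(i <- r | P i) F i x).
Proof.
move=> oO cF; elim: r => [|i r IH].
  by apply: (Cc_eq oO _ (Cc_cst k O 0)) => x _; rewrite big_nil.
case Pi: (P i); last by apply: (Cc_eq oO _ IH) => x _; rewrite big_cons Pi.
by apply: (Cc_eq oO _ (CcD oO (cF i Pi) IH)) => x _; rewrite big_cons Pi.
Qed.

Lemma Cc_prod k O I (r : seq I) (P : pred I) (F : I -> V -> R[i]) : open O ->
  (forall i, P i -> Cc k O (F i)) -> Cc k O (fun x => \prod_(i <- r | P i) F i x).
Proof.
move=> oO cF; elim: r => [|i r IH].
  by apply: (Cc_eq oO _ (Cc_cst k O 1)) => x _; rewrite big_nil.
case Pi: (P i); last by apply: (Cc_eq oO _ IH) => x _; rewrite big_cons Pi.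
by apply: (Cc_eq oO _ (CcM oO (cF i Pi) IH)) => x _; rewrite big_cons Pi.
Qed.

Lemma CcV k O f : open O -> (forall x, O x -> f x != 0) -> Cc k O f ->
  Cc k O (fun x => (f x)^-1).
Proof.
move=> oO f0 [fr fi].
have n0 x : O x -> re (f x) * re (f x) + im (f x) * im (f x) != 0.
  move=> /f0; apply: contra => /eqP e0.
  have := add_Re2_Im2 (f x); rewrite !expr2 e0 => /esym/eqP.
  by rewrite mulf_eq0 normr_eq0 orbb.
have cn := CkV oO n0 (CkD oO (CkM oO fr fr) (CkM oO fi fi)).
split.
  apply: (Ck_eq oO _ (CkM oO fr cn)) => x _; case: (f x) => a b /=.
  by rewrite !expr2.
apply: (Ck_eq oO _ (CkN oO (CkM oO fi cn))) => x _; case: (f x) => a b /=.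
by rewrite !expr2.
Qed.

Lemma normc_le_ReIm (z : R[i]) : `|z| <= (`|re z| + `|im z|)%:C.
Proof.
rewrite {1}[z]complexE; apply: le_trans (ler_normD _ _) _.
rewrite normrM rmorphD /= lerD //.
  by rewrite normc_def /= expr0n /= addr0 sqrtr_sqr.
rewrite !normc_def /= !expr0n /= add0r addr0 expr1n sqrtr1 mul1r.
by rewrite sqrtr_sqr.
Qed.

Lemma Re_le_normc (z : R[i]) : (`|re z|)%:C <= `|z|.
Proof.
rewrite normc_def lecR -sqrtr_sqr ler_wsqrtr // lerDl.
exact: sqr_ge0.
Qed.

Lemma Im_le_normc (z : R[i]) : (`|im z|)%:C <= `|z|.
Proof.
rewrite normc_def lecR -sqrtr_sqr ler_wsqrtr // lerDr.
exact: sqr_ge0.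
Qed.

(** Continuity with epsilon in R[i], the form in which matrix estimates come. *)
Definition ccont f x := forall e : R[i], 0 < e ->
  \forall y \near x, `|f y - f x| <= e.

Lemma ccontP f x : ccont f x <->
  {for x, continuous (fun y => re (f y))} /\ {for x, continuous (fun y => im (f y))}.
Proof.
split.
  move=> cf; split; apply/cvgrPdist_le => e e0.
    have e0' : 0 < e%:C by rewrite ltcR.
    apply: filterS (cf _ e0') => y h; rewrite distrC -lecR.
    apply: le_trans h; apply: le_trans (Re_le_normc _).
    by case: (f y) (f x) => ? ? [].
  have e0' : 0 < e%:C by rewrite ltcR.
  apply: filterS (cf _ e0') => y h; rewrite distrC -lecR.
  apply: le_trans h; apply: le_trans (Im_le_normc _).
  by case: (f y) (f x) => ? ? [].
case=> /cvgrPdist_le cr /cvgrPdist_le ci [e1 e2]; rewrite ltcE /= => /andP[/eqP-> e0].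
have e0' : 0 < e1 / 2 by apply: divr_gt0; [exact: e0 | rewrite ltr0n].
apply: filterS2 (cr _ e0') (ci _ e0') => y hr hi.
apply: le_trans (normc_le_ReIm _) _; rewrite -[_ +i* 0]/(e1%:C) lecR.
rewrite [e1]splitr lerD //.
  by apply: le_trans hr; rewrite distrC; case: (f y) (f x) => ? ? [].
by apply: le_trans hi; rewrite distrC; case: (f y) (f x) => ? ? [].
Qed.

Lemma Cc_ccont k O f x : Cc k O f -> O x -> ccont f x.
Proof.
move=> [cr ci] Ox; apply/ccontP; split; first exact: (Ck_cont cr).
exact: (Ck_cont ci).
Qed.

Lemma ccont_Cc0 O f : (forall x, O x -> ccont f x) -> Cc 0 O f.
Proof. by move=> cf; split=> x /cf/ccontP[]. Qed.

Definition cdiff f x :=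
  differentiable (fun y => re (f y)) x /\ differentiable (fun y => im (f y)) x.

Definition cderive v f x : R[i] :=
  'D_v (fun y => re (f y)) x +i* 'D_v (fun y => im (f y)) x.

Lemma CcS k O f : Cc k.+1 O f <->
  (forall x, O x -> cdiff f x) /\ (forall v, Cc k O (cderive v f)).
Proof.
split=> [[[dr cr] [di ci]]|[df cf]].
  by split=> [x Ox|v]; split; [exact: dr | exact: di | exact: cr | exact: ci].
split; split=> [x /df[]|v] //.
  by have [] := cf v.
by have [] := cf v.
Qed.

Lemma cdiff_near f g x : (\forall y \near x, f y = g y) -> cdiff f x -> cdiff g x.
Proof.
move=> fg [dr di]; split.
  by apply: differentiable_near dr; apply: filterS fg => y ->.
by apply: differentiable_near di; apply: filterS fg => y ->.
Qed.

Lemma cderive_near v f g x : (\forall y \near x, f y = g y) ->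
  cderive v f x = cderive v g x.
Proof.
move=> fg; rewrite /cderive; congr (_ +i* _).
  by apply: near_eq_derive; apply: filterS fg => y ->.
by apply: near_eq_derive; apply: filterS fg => y ->.
Qed.

Lemma cdiff_cst a x : cdiff (fun=> a) x.
Proof. by split; exact: differentiable_cst. Qed.

Lemma cdiffD f g x : cdiff f x -> cdiff g x -> cdiff (fun y => f y + g y) x.
Proof.
move=> [fr fi] [gr gi]; split.
  rewrite (_ : (fun y => _) = (fun y => re (f y)) + (fun y => re (g y))).
    exact: differentiableD.
  by apply/funext => y; rewrite fctE; case: (f y) (g y) => ? ? [].
rewrite (_ : (fun y => _) = (fun y => im (f y)) + (fun y => im (g y))).
  exact: differentiableD.
by apply/funext => y; rewrite fctE; case: (f y) (g y) => ? ? [].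
Qed.

Lemma cdiff_sum I (r : seq I) (F : I -> V -> R[i]) x :
  (forall i, cdiff (F i) x) -> cdiff (fun y => \sum_(i <- r) F i y) x.
Proof.
move=> cF; elim: r => [|i r IH].
  by rewrite (_ : (fun y => _) = fun=> 0); [exact: cdiff_cst |
    apply/funext => y; rewrite big_nil].
rewrite (_ : (fun y => _) = (fun y => F i y + \sum_(j <- r) F j y)).
  exact: cdiffD.
by apply/funext => y; rewrite big_cons.
Qed.

Lemma cdiff_mul_vanish f g x : ccont f x -> cdiff g x -> g x = 0 ->
  cdiff (fun y => f y * g y) x.
Proof.
move=> /ccontP[fr fi] [gr gi] gx0.
have r0 : re (g x) = 0 by rewrite gx0.
have i0 : im (g x) = 0 by rewrite gx0.
split.
  rewrite (_ : (fun y => _) =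
      (fun y => re (f y) * re (g y)) - (fun y => im (f y) * im (g y))).
    by apply: differentiableB; exact: differentiable_mul_vanish.
  by apply/funext => y; rewrite !fctE; case: (f y) (g y) => ? ? [].
rewrite (_ : (fun y => _) =
    (fun y => re (f y) * im (g y)) + (fun y => im (f y) * re (g y))).
  by apply: differentiableD; exact: differentiable_mul_vanish.
by apply/funext => y; rewrite !fctE; case: (f y) (g y) => ? ? [].
Qed.

Lemma cderiveM v f g x : cdiff f x -> cdiff g x ->
  cderive v (fun y => f y * g y) x = cderive v f x * g x + f x * cderive v g x.
Proof.
move=> [/diff_derivable fr /diff_derivable fi] [/diff_derivable gr /diff_derivable gi].
rewrite {1}/cderive.
rewrite (_ : (fun y => re (f y * g y)) =
    (fun y => re (f y)) * (fun y => re (g y)) - (fun y => im (f y)) * (fun y => im (g y))); last first.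
  apply/funext => y.
  by change (re (f y * g y) = re (f y) * re (g y) - im (f y) * im (g y)); case: (f y) (g y) => ? ? [].
rewrite (_ : (fun y => im (f y * g y)) =
    (fun y => re (f y)) * (fun y => im (g y)) + (fun y => im (f y)) * (fun y => re (g y))); last first.
  apply/funext => y.
  by change (im (f y * g y) = re (f y) * im (g y) + im (f y) * re (g y)); case: (f y) (g y) => ? ? [].
rewrite deriveB; [|exact: derivableM..].
rewrite deriveD; [|exact: derivableM..].
rewrite !deriveM // /cderive /GRing.scale /=.
move: ('D_v (fun y => re (f y)) x) ('D_v (fun y => im (f y)) x) => f1 f2.
move: ('D_v (fun y => re (g y)) x) ('D_v (fun y => im (g y)) x) => g1 g2.
case: (f x) (g x) => a b [c d] /=; apply/eqP; rewrite eq_complex /=.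
by apply/andP; split; apply/eqP; ring.
Qed.

Lemma cderiveD v f g x : cdiff f x -> cdiff g x ->
  cderive v (fun y => f y + g y) x = cderive v f x + cderive v g x.
Proof.
move=> [/diff_derivable fr /diff_derivable fi] [/diff_derivable gr /diff_derivable gi].
rewrite {1}/cderive.
rewrite (_ : (fun y => re (f y + g y)) = (fun y => re (f y)) + (fun y => re (g y))); last first.
  by apply/funext => y; rewrite !fctE; case: (f y) (g y) => ? ? [].
rewrite (_ : (fun y => im (f y + g y)) = (fun y => im (f y)) + (fun y => im (g y))); last first.
  by apply/funext => y; rewrite !fctE; case: (f y) (g y) => ? ? [].
by rewrite !deriveD.
Qed.

Lemma cderive_cst v a x : cderive v (fun=> a) x = 0.
Proof. by rewrite /cderive !derive_cst. Qed.

Lemma cdiffM f g x : cdiff f x -> cdiff g x -> cdiff (fun y => f y * g y) x.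
Proof.
move=> [fr fi] [gr gi]; split.
  rewrite (_ : (fun y => _) =
      (fun y => re (f y)) * (fun y => re (g y)) - (fun y => im (f y)) * (fun y => im (g y))).
    by apply: differentiableB; exact: differentiableM.
  apply/funext => y.
  by change (re (f y * g y) = re (f y) * re (g y) - im (f y) * im (g y)); case: (f y) (g y) => ? ? [].
rewrite (_ : (fun y => _) =
    (fun y => re (f y)) * (fun y => im (g y)) + (fun y => im (f y)) * (fun y => re (g y))).
  by apply: differentiableD; exact: differentiableM.
apply/funext => y.
by change (im (f y * g y) = re (f y) * im (g y) + im (f y) * re (g y)); case: (f y) (g y) => ? ? [].
Qed.

Lemma cderive_sum v I (r : seq I) (F : I -> V -> R[i]) x :
  (forall i, cdiff (F i) x) ->
  cderive v (fun y => \sum_(i <- r) F i y) x = \sum_(i <- r) cderive v (F i) x.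
Proof.
move=> cF; elim: r => [|i r IH].
  rewrite big_nil; apply: etrans (cderive_cst v 0 x); congr (cderive v _ x).
  by apply/funext => y; rewrite big_nil.
rewrite big_cons -IH -cderiveD //; last exact: cdiff_sum.
by congr (cderive v _ x); apply/funext => y; rewrite big_cons.
Qed.

End ComplexCk.

(** * Matrix-valued functions and the smoothness of square roots *)

Section MatrixCk.
Context {R : realType} {V : normedModType R}.
Implicit Types (O : set V).
Local Notation C := R[i].

Definition Mc p q k O (A : V -> 'M[C]_(p, q)) :=
  forall i j, Cc k O (fun x => A x i j).

Lemma Mc_eq p q k O (A B : V -> 'M[C]_(p, q)) : open O ->
  (forall x, O x -> A x = B x) -> Mc k O A -> Mc k O B.
Proof. by move=> oO AB cA i j; apply: Cc_eq (cA i j) => // x /AB->. Qed.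

Lemma Mc_sub p q k O O' (A : V -> 'M[C]_(p, q)) : O' `<=` O -> Mc k O A -> Mc k O' A.
Proof. by move=> sO cA i j; exact: Cc_sub (cA i j). Qed.

Lemma Mc_cst p q k O (A : 'M[C]_(p, q)) : Mc k O (fun=> A).
Proof. by move=> i j; exact: Cc_cst. Qed.

Lemma McD p q k O (A B : V -> 'M[C]_(p, q)) : open O -> Mc k O A -> Mc k O B ->
  Mc k O (fun x => A x + B x).
Proof.
by move=> oO cA cB i j; apply: Cc_eq (CcD oO (cA i j) (cB i j)) => // x _; rewrite mxE.
Qed.

Lemma McN p q k O (A : V -> 'M[C]_(p, q)) : open O -> Mc k O A ->
  Mc k O (fun x => - A x).
Proof.
by move=> oO cA i j; apply: Cc_eq (CcN oO (cA i j)) => // x _; rewrite mxE.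
Qed.

Lemma McB p q k O (A B : V -> 'M[C]_(p, q)) : open O -> Mc k O A -> Mc k O B ->
  Mc k O (fun x => A x - B x).
Proof. by move=> oO cA cB; apply: McD => //; exact: McN. Qed.

Lemma McM p q r k O (A : V -> 'M[C]_(p, q)) (B : V -> 'M[C]_(q, r)) : open O ->
  Mc k O A -> Mc k O B -> Mc k O (fun x => A x *m B x).
Proof.
move=> oO cA cB i j.
suff : Cc k O (fun x => \sum_l A x i l * B x l j).
  by apply: Cc_eq => // x _; rewrite mxE.
by apply: Cc_sum => // l _; exact: CcM.
Qed.

Lemma McZ p q k O (a : V -> C) (A : V -> 'M[C]_(p, q)) : open O ->
  Cc k O a -> Mc k O A -> Mc k O (fun x => a x *: A x).
Proof.
by move=> oO ca cA i j; apply: Cc_eq (CcM oO ca (cA i j)) => // x _; rewrite mxE.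
Qed.

Lemma Mc_adj p q k O (A : V -> 'M[C]_(p, q)) : open O -> Mc k O A ->
  Mc k O (fun x => adj (A x)).
Proof.
by move=> oO cA i j; apply: Cc_eq (Cc_conj oO (cA j i)) => // x _; rewrite adjE.
Qed.

Lemma Cc_trace p k O (A : V -> 'M[C]_p) : open O -> Mc k O A ->
  Cc k O (fun x => \tr (A x)).
Proof. by move=> oO cA; apply: Cc_sum => // i _; exact: cA. Qed.

Lemma Cc_det p k O (A : V -> 'M[C]_p) : open O -> Mc k O A ->
  Cc k O (fun x => \det (A x)).
Proof.
move=> oO cA; rewrite /determinant; apply: Cc_sum => // s _.
by apply: CcM => //; [exact: Cc_cst | apply: Cc_prod].
Qed.

Lemma Mc_inv p k O (A : V -> 'M[C]_p) : open O ->
  (forall x, O x -> A x \in unitmx) -> Mc k O A -> Mc k O (fun x => invmx (A x)).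
Proof.
move=> oO uA cA.
have d0 x : O x -> \det (A x) != 0 by move/uA; rewrite unitmxE unitfE.
have cadj : Mc k O (fun x => \adj (A x)).
  move=> i j.
  suff : Cc k O (fun x => cofactor (A x) j i).
    by apply: Cc_eq => // x _; rewrite mxE.
  apply: CcM => //; first exact: Cc_cst.
  apply: Cc_det => // a b.
  by apply: Cc_eq (cA (lift j a) (lift i b)) => // x _; rewrite !mxE.
apply: (Mc_eq oO _ (McZ oO (CcV oO d0 (Cc_det oO cA)) cadj)) => x Ox.
by rewrite /invmx uA.
Qed.

Lemma Mc_mxvec p q k O (A : V -> 'M[C]_(p, q)) : Mc k O A ->
  Mc k O (fun x => mxvec (A x)).
Proof.
move=> cA i l; case/mxvec_indexP: l => a b.
rewrite (_ : (fun x => _) = fun x => A x a b) //.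
by apply/funext => x; rewrite ord1 mxvecE.
Qed.

Lemma Mc_vec_mx p q k O (u : V -> 'rV[C]_(p * q)) : Mc k O u ->
  Mc k O (fun x => vec_mx (u x)).
Proof.
move=> cu a b; rewrite (_ : (fun x => _) = fun x => u x 0 (mxvec_index a b)) //.
by apply/funext => x; rewrite mxE.
Qed.

Lemma Mc_sylvester n k O (A B : V -> 'M[C]_n) : open O -> Mc k O A -> Mc k O B ->
  Mc k O (fun x => sylvester_mx (A x) (B x)).
Proof.
move=> oO cA cB i j.
have := Mc_mxvec (McD oO (McM oO cA (Mc_cst k O (vec_mx (delta_mx 0 i))))
  (McM oO (Mc_cst k O (vec_mx (delta_mx 0 i))) cB)).
move=> /(_ 0 j); congr (Cc k O _); apply/funext => x.
rewrite -/(sylvester (A x) (B x) _) -mul_sylvester_mx vec_mxK -rowE.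
by rewrite mxE.
Qed.

Definition mderive p q v (A : V -> 'M[C]_(p, q)) x : 'M[C]_(p, q) :=
  \matrix_(i, j) cderive v (fun y => A y i j) x.

Lemma McS p q k O (A : V -> 'M[C]_(p, q)) : Mc k.+1 O A <->
  (forall x, O x -> forall i j, cdiff (fun y => A y i j) x) /\
  (forall v, Mc k O (mderive v A)).
Proof.
have E v i j : (fun x => mderive v A x i j) = cderive v (fun x => A x i j).
  by apply/funext => x; rewrite mxE.
split=> [cA|[dA cA] i j].
  split=> [x Ox i j|v i j]; first exact: (proj1 ((CcS _ _ _).1 (cA i j))).
  by rewrite E; exact: (proj2 ((CcS _ _ _).1 (cA i j))).
by apply/CcS; split=> [x Ox|v]; [exact: dA | rewrite -E; exact: cA].
Qed.

Lemma mderiveM p q r v (A : V -> 'M[C]_(p, q)) (B : V -> 'M[C]_(q, r)) x :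
  (forall i j, cdiff (fun y => A y i j) x) ->
  (forall i j, cdiff (fun y => B y i j) x) ->
  mderive v (fun y => A y *m B y) x = mderive v A x *m B x + A x *m mderive v B x.
Proof.
move=> dA dB; apply/matrixP => i j; rewrite !mxE.
rewrite (_ : (fun y => _) = fun y => \sum_l A y i l * B y l j); last first.
  by apply/funext => y; rewrite mxE.
rewrite cderive_sum; last by move=> l; exact: cdiffM.
by rewrite -big_split; apply: eq_bigr => l _; rewrite cderiveM // !mxE.
Qed.

Lemma mderive_near p q v (A B : V -> 'M[C]_(p, q)) x :
  (\forall y \near x, A y = B y) -> mderive v A x = mderive v B x.
Proof.
move=> AB; apply/matrixP => i j; rewrite !mxE; apply: cderive_near.
by apply: filterS AB => y ->.
Qed.

Lemma Mc0_near_small n O (A : V -> 'M[C]_n) x (e : C) : Mc 0 O A -> O x -> 0 < e ->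
  \forall y \near x, forall i j, `|(A y - A x) i j| <= e.
Proof.
move=> cA Ox e0.
have small ij : \forall y \near x, `|A y ij.1 ij.2 - A x ij.1 ij.2| <= e.
  exact: (Cc_ccont (cA ij.1 ij.2) Ox).
have h : \forall y \near x, forall ij, `|A y ij.1 ij.2 - A x ij.1 ij.2| <= e.
  exact: filter_forall small.
by apply: filterS h => y h i j; rewrite !mxE; exact: (h (i, j)).
Qed.

End MatrixCk.

Section SmoothSqrt.
Context {R : realType} {V : normedModType R} {n : nat}.
Local Notation C := R[i].
Variables (O : set V) (A B : V -> 'M[C]_n).
Hypothesis oO : open O.
Hypothesis hB : forall x, O x -> adj (B x) = B x.
Hypothesis pB : forall x, O x -> pd (B x).
Hypothesis BB : forall x, O x -> B x *m B x = A x.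

Let syl_diff x y : O x -> O y -> sylvester (B y) (B x) (B y - B x) = A y - A x.
Proof.
move=> Ox Oy; rewrite /sylvester mulmxBr mulmxBl -!BB // addrA subrK.
by [].
Qed.

(** B y - B x solves a Sylvester equation with right side A y - A x, and
    [sylvester_bound] makes the solution small uniformly in y. *)
Lemma sqrt_continuous : Mc 0 O A -> Mc 0 O B.
Proof.
move=> cA i j; apply: ccont_Cc0 => x Ox e e0.
have [eps eps0 Beps] := pd_coercive (hB Ox) (pB Ox).
pose delta := eps * e / (n%:R + 1).
have n1 : 0 < n%:R + 1 :> C by rewrite ltr_wpDl.
have delta0 : 0 < delta by rewrite divr_gt0 // mulr_gt0.
have nO : nbhs x O by exact: open_nbhs_nbhs.
apply: filterS2 nO (Mc0_near_small cA Ox delta0) => y Oy small.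
have := sylvester_bound i j (pd_psd (pB Oy)) Beps eps0 (syl_diff Ox Oy) small.
rewrite !mxE => h; rewrite -(ler_pM2l eps0); apply: le_trans h _.
rewrite /delta mulrAC ler_pdivrMr // ler_wpM2l ?(ltW (mulr_gt0 eps0 e0)) //.
by rewrite lerDl.
Qed.

(** B y - B x is A y - A x, which vanishes at x, multiplied by a matrix that
    is continuous in y. *)
Lemma sqrt_cdiff x i j : Mc 1 O A -> O x -> cdiff (fun y => B y i j) x.
Proof.
move=> cA Ox.
have cA0 : Mc 0 O A by move=> a b; exact: Cc_pred (cA a b).
have cB := sqrt_continuous cA0.
pose Q y := invmx (sylvester_mx (B y) (B x)).
have cQ : Mc 0 O Q.
  apply: Mc_inv => //; last exact/Mc_sylvester/Mc_cst.
  by move=> y Oy; apply: sylvester_mx_unit; [exact/pd_psd/pB | exact: pB].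
pose D y := mxvec (A y - A x).
pose S y := B x i j + \sum_l Q y l (mxvec_index i j) * D y 0 l.
have SB : \forall y \near x, S y = B y i j.
  have nO : nbhs x O by exact: open_nbhs_nbhs.
  apply: filterS nO => y Oy.
  have /(congr1 (fun M : 'M[C]_n => M i j)) :=
    sylvester_solve (pd_psd (pB Oy)) (pB Ox) (syl_diff Ox Oy).
  rewrite !mxE /S => /(canRL (subrK _)) ->; rewrite addrC; congr (_ + _).
  by apply: eq_bigr => l _; rewrite mulrC.
apply: cdiff_near SB _; apply: cdiffD; first exact: cdiff_cst.
apply: cdiff_sum => l; apply: cdiff_mul_vanish.
- exact: Cc_ccont (cQ _ _) Ox.
- have cD : Mc 1 O D by exact: Mc_mxvec (McB oO cA (Mc_cst 1 O (A x))).
  exact: (proj1 ((CcS _ _ _).1 (cD 0 l))).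
- by rewrite /D subrr raddf0 mxE.
Qed.

(** Square roots of positive definite matrices depend smoothly on the matrix:
    differentiating B^2 = A gives the Sylvester equation B B' + B' B = A', whose
    solution is a rational function of B and A', so regularity bootstraps. *)
Lemma sqrt_smooth : (forall k, Mc k O A) -> forall k, Mc k O B.
Proof.
move=> cA; elim=> [|k IH]; first exact: sqrt_continuous.
have dB x i j : O x -> cdiff (fun y => B y i j) x by move=> Ox; exact: sqrt_cdiff.
apply/McS; split=> [x Ox i j|v]; first exact: dB.
have cdA := proj2 ((McS k O A).1 (cA k.+1)) v.
pose Q y := invmx (sylvester_mx (B y) (B y)).
have cQ : Mc k O Q.
  apply: Mc_inv => //; last exact: Mc_sylvester.
  by move=> y Oy; apply: sylvester_mx_unit; [exact/pd_psd/pB | exact: pB].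
apply: (Mc_eq oO _ (Mc_vec_mx (McM oO (Mc_mxvec cdA) cQ))) => x Ox.
symmetry; apply: sylvester_solve; [exact/pd_psd/pB | exact: pB | ].
rewrite /sylvester addrC -mderiveM; [|by move=> i j; exact: dB ..].
apply: mderive_near.
have nO : nbhs x O by exact: open_nbhs_nbhs.
by apply: filterS nO => y Oy; exact: BB.
Qed.

End SmoothSqrt.

(** * Endomorphisms of E as matrices *)

Section OrthonormalBasis.
Context {R : realType} {E : vectType R[i]} (dot : {dot E for (@conjC R[i])}).
Local Notation C := R[i].

Lemma orthonormal_extend k : (k <= \dim {:E})%N ->
  exists s : k.-tuple E, orthonormal dot s.
Proof.
elim: k => [|k IH] kn; first by exists [tuple].
have [s os] := IH (ltnW kn).
have /subvPn[v _ vs] : ~~ (fullv <= << s >>)%VS.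
  apply/negP => /dimvS h; have := leq_trans kn (leq_trans h (dim_span s)).
  by rewrite size_tuple ltnn.
have [X Xs [Y [vE _ oYs]]] := orthogonal_split dot s v.
have Y0 : Y != 0 by apply: contraNneq vs => Y0; rewrite vE Y0 addr0.
have sY0 : sqrtC (dot Y Y) != 0 by rewrite sqrt_dnorm_eq0.
exists [tuple of (sqrtC (dot Y Y))^-1 *: Y :: s].
move: os; rewrite /orthonormal /= => /andP[-> ->]; rewrite !andbT.
apply/andP; split; last first.
  apply/allP => u us /=; rewrite linearZl_LR /=.
  by rewrite (orthoPl oYs u us) mulr0.
rewrite dnormZ normfV exprVn ger0_norm ?sqrtC_ge0 ?dnorm_ge0 // sqrtCK.
by rewrite mulVf // dnorm_eq0.
Qed.

Definition onbasis n (e : 'I_n -> E) :=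
  (forall i j, dot (e i) (e j) = (i == j)%:R) /\
  (forall u, u = \sum_i dot u (e i) *: e i).

Lemma onbasis_exists (n : nat) : \dim {:E} = n -> exists e : 'I_n -> E, onbasis e.
Proof.
move=> dE; have [s os] := orthonormal_extend (eq_leq (esym dE)).
have fs := orthonormal_free os.
have bs : basis_of fullv s by rewrite basisEfree fs subvf size_tuple dE leqnn.
have oe (i j : 'I_n) : dot s`_i s`_j = (i == j)%:R.
  have /orthonormalP[us os'] := os; rewrite os' ?mem_nth ?size_tuple //.
  by rewrite nth_uniq ?size_tuple.
exists (fun i : 'I_n => s`_i); split=> // u.
rewrite {1}(coord_basis bs (memvf u)); apply: eq_bigr => i _; congr (_ *: _).
rewrite {2}(coord_basis bs (memvf u)) linear_sumlz (bigD1 i) //= big1 ?addr0.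
  by rewrite linearZl_LR /= oe eqxx mulr1.
by move=> j ji; rewrite linearZl_LR /= oe (negPf ji) mulr0.
Qed.

End OrthonormalBasis.

Section Matrices.
Context {R : realType} {E : vectType R[i]} (dot : {dot E for (@conjC R[i])}).
Local Notation C := R[i].
Context {n : nat} (e : 'I_n -> E).
Hypothesis one : onbasis dot e.
Implicit Types (f g : 'End(E)) (u v : E).

Definition cv (u : E) : 'cV[C]_n := \col_i dot u (e i).
Definition vc (x : 'cV[C]_n) : E := \sum_i x i 0 *: e i.

Lemma cvK : cancel cv vc.
Proof. by move=> u; rewrite [RHS](proj2 one); apply: eq_bigr => i _; rewrite mxE. Qed.

Lemma vcK : cancel vc cv.
Proof.
move=> x; apply/matrixP => i j; rewrite mxE ord1 /vc linear_sumlz (bigD1 i) //=.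
rewrite big1 ?addr0 => [|k ki]; rewrite linearZl_LR /= (proj1 one).
  by rewrite eqxx mulr1.
by rewrite (negPf ki) mulr0.
Qed.

Lemma cv_linear : linear cv.
Proof. by move=> a u v; apply/matrixP => i j; rewrite !mxE linearDl linearZl_LR. Qed.

Lemma cv0 : cv 0 = 0.
Proof. by apply/matrixP => i j; rewrite !mxE linear0l. Qed.

Lemma cv_eq0 u : (cv u == 0) = (u == 0).
Proof.
apply/eqP/eqP => [u0|->]; last exact: cv0.
by rewrite -[u]cvK u0 -cv0 cvK.
Qed.

Lemma dot_cv u v : dot u v = (adj (cv v) *m cv u) 0 0.
Proof.
rewrite {1}(proj2 one u) linear_sumlz mxE; apply: eq_bigr => i _.
by rewrite linearZl_LR /= adjE !mxE mulrC hermC /= expr0 mul1r.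
Qed.

(* Sealed, because unification would otherwise compare matrices entrywise. *)
Fact mt_sealed : {M : 'End(E) -> 'M[C]_n |
  forall f i j, M f i j = dot (f (e j)) (e i)}.
Proof. by exists (fun f => \matrix_(i, j) dot (f (e j)) (e i)) => *; rewrite mxE. Qed.

Definition mt : 'End(E) -> 'M[C]_n := sval mt_sealed.

Lemma mtE f i j : mt f i j = dot (f (e j)) (e i).
Proof. exact: svalP mt_sealed f i j. Qed.

Lemma cv_mt f u : cv (f u) = mt f *m cv u.
Proof.
apply/matrixP => i j; rewrite mxE ord1 {1}(proj2 one u) linear_sum linear_sumlz.
by rewrite mxE; apply: eq_bigr => k _; rewrite linearZ linearZl_LR mtE !mxE mulrC.
Qed.

Lemma mt_mul (A : 'M[C]_n) f : (forall u, cv (f u) = A *m cv u) -> mt f = A.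
Proof.
move=> fA; apply/matrixP => i j.
have := fA (vc (delta_mx j 0)); rewrite vcK -colE => /matrixP/(_ i 0).
rewrite mtE !mxE => <-; congr (dot (f _) _); rewrite /vc (bigD1 j) //= big1 ?addr0.
  by rewrite mxE !eqxx scale1r.
by move=> k kj; rewrite mxE (negPf kj) scale0r.
Qed.

Lemma mt_inj : injective mt.
Proof.
move=> f g fg; apply/lfunP => u; apply: (can_inj cvK).
by rewrite !cv_mt fg.
Qed.

Lemma mt_comp f g : mt (f \o g)%VF = mt f *m mt g.
Proof. by apply: mt_mul => u; rewrite lfunE /= !cv_mt mulmxA. Qed.

Lemma mt1 : mt \1%VF = 1%:M.
Proof. by apply: mt_mul => u; rewrite lfunE /= mul1mx. Qed.

Lemma mt_linear : linear mt.
Proof.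
by move=> a f g; apply/matrixP => i j; rewrite !mxE !mtE !lfunE /= lfunE /= linearDl linearZl_LR.
Qed.

Lemma mtD f g : mt (f + g) = mt f + mt g.
Proof. by have := mt_linear 1 f g; rewrite !scale1r. Qed.

Lemma mt0 : mt 0 = 0.
Proof. by apply: mt_mul => u; rewrite lfunE /= mul0mx cv0. Qed.

Lemma mtZ a f : mt (a *: f) = a *: mt f.
Proof. by have := mt_linear a f 0; rewrite mt0 !addr0. Qed.

Lemma mtB f g : mt (f - g) = mt f - mt g.
Proof. by rewrite mtD -scaleN1r mtZ scaleN1r. Qed.

Definition em (A : 'M[C]_n) : 'End(E) := linfun (fun u => vc (A *m cv u)).

Lemma em_linear_fun A : linear (fun u => vc (A *m cv u)).
Proof.
move=> a u v; apply: (can_inj cvK); rewrite vcK cv_linear linearP /=.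
by rewrite cv_linear !vcK.
Qed.

Lemma emE A u : em A u = vc (A *m cv u).
Proof.
pose f : {linear E -> E} := HB.pack (fun u => vc (A *m cv u))
  (GRing.isLinear.Build _ _ _ _ _ (em_linear_fun A)).
exact: (lfunE f u).
Qed.

Lemma emK A : mt (em A) = A.
Proof. by apply: mt_mul => u; rewrite emE vcK. Qed.

Lemma mtK f : em (mt f) = f.
Proof. by apply: mt_inj; rewrite emK. Qed.

Lemma em_linear : linear em.
Proof. by move=> a A B; apply: mt_inj; rewrite mt_linear !emK. Qed.

Lemma dot_qf f u : dot (f u) u = qf (mt f) (cv u).
Proof. by rewrite dot_cv cv_mt mulmxA. Qed.

Lemma HE_mt f : HE dot f <-> adj (mt f) = mt f.
Proof.
split=> [hf|hf u v].
  apply/matrixP => i j; rewrite adjE !mtE hf.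
  by rewrite hermC /= expr0 mul1r conjCK.
by rewrite !dot_cv !cv_mt adjM hf mulmxA.
Qed.

Lemma psd_mt f : (forall u, 0 <= dot (f u) u) <-> psd (mt f).
Proof.
split=> [pf x|pf u]; last by rewrite dot_qf.
by rewrite -[x]vcK -dot_qf.
Qed.

Lemma HP_mt f : HP dot f <-> adj (mt f) = mt f /\ psd (mt f).
Proof. by split=> -[/HE_mt hf /psd_mt pf]. Qed.

End Matrices.

Section Trace.
Context {R : realType}.
Local Notation C := R[i].

Lemma endo_trace_comp (V1 V2 : vectType C) (f : 'Hom(V1, V2)) (g : 'Hom(V2, V1)) :
  endo_trace (g \o f)%VF = endo_trace (f \o g)%VF.
Proof.
rewrite /endo_trace.
transitivity (\sum_(j < \dim {:V1}) \sum_(k < \dim {:V2})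
    coord (vbasis {:V2}) k (f (vbasis {:V1})`_j) *
    coord (vbasis {:V1}) j (g (vbasis {:V2})`_k)).
  apply: eq_bigr => j _; rewrite lfunE /= {1}(coord_vbasis (memvf (f _))).
  by rewrite !linear_sum; apply: eq_bigr => k _; rewrite !linearZ.
rewrite exchange_big; apply: eq_bigr => k _.
rewrite lfunE /= [in RHS](coord_vbasis (memvf (g _))).
by rewrite !linear_sum; apply: eq_bigr => j _; rewrite !linearZ /= mulrC.
Qed.

Lemma endo_trace1 (V : vectType C) : endo_trace (\1%VF : 'End(V)) = (\dim {:V})%:R.
Proof.
rewrite /endo_trace (eq_bigr (fun=> 1)) ?sumr_const ?card_ord // => j _.
by rewrite lfunE /= coord_free ?eqxx // (basis_free (vbasisP _)).
Qed.

Lemma trace_mt (E : vectType C) (dot : {dot E for (@conjC C)}) n (e : 'I_n -> E) :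
  onbasis dot e -> forall f, endo_trace f = \tr (mt dot e f).
Proof.
move=> one f; rewrite /endo_trace.
transitivity (\sum_(j < \dim {:E}) \sum_(i < n)
    dot (f (vbasis {:E})`_j) (e i) * coord (vbasis {:E}) j (e i)).
  apply: eq_bigr => j _; rewrite {1}(proj2 one (f _)) linear_sum.
  by apply: eq_bigr => k _; rewrite linearZ.
rewrite exchange_big; apply: eq_bigr => i _; rewrite mtE.
rewrite {3}(coord_vbasis (memvf (e i))) linear_sum linear_sumlz.
by apply: eq_bigr => j _; rewrite linearZ linearZl_LR /= mulrC.
Qed.

End Trace.

(** * Orthogonal projections and endomorphisms of subspaces *)

Section Subspaces.
Context {R : realType} {E : vectType R[i]} (dot : {dot E for (@conjC R[i])}).
Local Notation C := R[i].
Implicit Types (W : {vspace E}) (u v : E).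

(* Sealed, to keep unification from unfolding projections to their matrices. *)
Fact pr_sealed : {p : {vspace E} -> 'End(E) |
  forall W, p W = daddv_pi W (perp dot W)}.
Proof. by exists (fun W => daddv_pi W (perp dot W)). Qed.

Definition pr : {vspace E} -> 'End(E) := sval pr_sealed.

Lemma prE W : pr W = daddv_pi W (perp dot W).
Proof. exact: svalP pr_sealed W. Qed.

Lemma perpP W u : reflect (forall v, v \in W -> dot u v = 0) (u \in perp dot W).
Proof. exact: mem_orthovP. Qed.

Lemma dotC u v : dot u v = conjC (dot v u).
Proof. by rewrite hermC /= expr0 mul1r. Qed.

Lemma add_perp W : (W + perp dot W)%VS = fullv.
Proof.
apply/eqP; rewrite eqEsubv subvf /=; apply/subvP => u _.
have [X XW [Y [-> _ oY]]] := orthogonal_split dot (vbasis W) u.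
rewrite memv_add //; first by rewrite -(span_basis (vbasisP W)).
apply/perpP => v vW; apply: (span_orthogonal oY); first by rewrite memv_span1.
by rewrite (span_basis (vbasisP W)).
Qed.

Lemma pr_mem W u : pr W u \in W.
Proof. by rewrite prE memv_pi. Qed.

Lemma pr_id W u : u \in W -> pr W u = u.
Proof. by rewrite prE; apply: daddv_pi_id; exact: cap_perp. Qed.

Lemma pr_compl_mem W u : u - pr W u \in perp dot W.
Proof.
rewrite -{1}[u](daddv_pi_add (cap_perp dot W) (w := u)) ?add_perp ?memvf //.
by rewrite prE addrC addKr memv_pi.
Qed.

Lemma memv_perp0 W u : u \in W -> u \in perp dot W -> u = 0.
Proof. by move=> uW uP; apply/eqP; rewrite -memv0 -(cap_perp dot W) memv_cap uW. Qed.

Lemma pr_eq W a b : a \in W -> b \in perp dot W -> pr W (a + b) = a.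
Proof.
move=> aW bP; apply/eqP; rewrite -subr_eq0; apply/eqP.
apply: (@memv_perp0 W); first by rewrite memvB ?pr_mem.
rewrite -[X in X \in _]opprK memvN opprB -[a - _](addrK b) [a - _ + b]addrAC.
by rewrite memvB // pr_compl_mem.
Qed.

Lemma pr0 W u : u \in perp dot W -> pr W u = 0.
Proof. by move=> uP; rewrite -[u]add0r pr_eq ?mem0v. Qed.

Lemma memv_perp2 W u : u \in W -> u \in perp dot (perp dot W).
Proof. by move=> uW; apply/perpP => v /perpP vP; rewrite dotC vP // conjC0. Qed.

Lemma pr_perp W : pr (perp dot W) = \1%VF - pr W.
Proof.
apply/lfunP => u; rewrite add_lfunE opp_lfunE id_lfunE -{1}[u](subrK (pr W u)) pr_eq ?pr_compl_mem //.
by rewrite memv_perp2 ?pr_mem.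
Qed.

Lemma pr_fixE W u : (pr W u == u) = (u \in W).
Proof. by apply/eqP/idP => [<-|/pr_id//]; exact: pr_mem. Qed.

Lemma pr_kerE W u : (pr W u == 0) = (u \in perp dot W).
Proof.
by apply/eqP/idP => [p0|/pr0//]; rewrite -[u]subr0 -p0 pr_compl_mem.
Qed.

Lemma pr_comp W : (pr W \o pr W)%VF = pr W.
Proof. by apply/lfunP => u; rewrite lfunE /= pr_id ?pr_mem. Qed.

Lemma dot_pr W u v : dot (pr W u) v = dot u (pr W v).
Proof.
have h x y : dot (pr W x) y = dot (pr W x) (pr W y).
  rewrite -{1}[y](subrK (pr W y)) linearDr /= dotC.
  have /perpP -> := pr_compl_mem W y; last exact: pr_mem.
  by rewrite conjC0 add0r.
by rewrite [LHS]h [RHS]dotC [dot (pr W v) u]h -dotC.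
Qed.

Lemma pr_inj W1 W2 : pr W1 = pr W2 -> W1 = W2.
Proof. by move=> p12; apply/vspaceP => u; rewrite -!pr_fixE p12. Qed.

Lemma pr_limg (f : 'End(E)) : HE dot f -> (f \o f)%VF = f -> pr (limg f) = f.
Proof.
move=> hf ff; apply/lfunP => u; rewrite -{1}[u](subrK (f u)) addrC pr_eq //.
  by rewrite memv_img ?memvf.
apply/perpP => v /memv_imgP[w _ ->]; rewrite -hf linearB /= -comp_lfunE ff.
by rewrite subrr linear0l.
Qed.

Lemma dim_limg_perp W : (\dim W + \dim (perp dot W))%N = \dim {:E}.
Proof. by rewrite -(add_perp W) dimv_disjoint_sum // cap_perp. Qed.

(** Extension by zero on the orthogonal complement. *)
Fact hat_sealed W1 W2 : {F : 'Hom(subvs_of W1, subvs_of W2) -> 'End(E) |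
  forall h, F h = (linfun vsval \o h \o linfun (vsproj W1) \o pr W1)%VF}.
Proof. by eexists=> h. Qed.

Definition hat W1 W2 : 'Hom(subvs_of W1, subvs_of W2) -> 'End(E) :=
  sval (hat_sealed W1 W2).

Lemma hat_def W1 W2 (h : 'Hom(subvs_of W1, subvs_of W2)) :
  hat h = (linfun vsval \o h \o linfun (vsproj W1) \o pr W1)%VF.
Proof. exact: svalP (hat_sealed W1 W2) h. Qed.

(** A left inverse of the extension by zero: restriction to W1 followed by the
    orthogonal projection onto W2. *)
Fact compression_sealed W1 W2 :
  {F : 'End(E) -> 'Hom(subvs_of W1, subvs_of W2) |
  forall f, F f = (linfun (vsproj W2) \o pr W2 \o f \o linfun vsval)%VF}.
Proof. by eexists=> f. Qed.

Definition compression W1 W2 : 'End(E) -> 'Hom(subvs_of W1, subvs_of W2) :=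
  sval (compression_sealed W1 W2).

Lemma compression_def W1 W2 f :
  compression W1 W2 f = (linfun (vsproj W2) \o pr W2 \o f \o linfun vsval)%VF.
Proof. exact: svalP (compression_sealed W1 W2) f. Qed.

Lemma hatE W1 W2 (h : 'Hom(subvs_of W1, subvs_of W2)) u :
  hat h u = vsval (h (vsproj W1 (pr W1 u))).
Proof. by rewrite hat_def !comp_lfunE !lfunE /=. Qed.

Lemma compressionE W1 W2 f w :
  vsval (@compression W1 W2 f w) = pr W2 (f (vsval w)).
Proof. by rewrite compression_def !comp_lfunE !lfunE /= vsprojK ?pr_mem. Qed.

Lemma hat_val W1 W2 (h : 'Hom(subvs_of W1, subvs_of W2)) w :
  hat h (vsval w) = vsval (h w).
Proof. by rewrite hatE pr_id ?subvsP // vsvalK. Qed.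

Lemma hatK W1 W2 (h : 'Hom(subvs_of W1, subvs_of W2)) :
  compression W1 W2 (hat h) = h.
Proof.
apply/lfunP => w; apply: subvs_inj.
by rewrite compressionE hat_val pr_id ?subvsP.
Qed.

Lemma compressionK W1 W2 f :
  hat (compression W1 W2 f) = (pr W2 \o f \o pr W1)%VF.
Proof.
apply/lfunP => u; by rewrite hatE compressionE !comp_lfunE vsprojK ?pr_mem.
Qed.

Lemma hat_comp W1 W2 W3 (h : 'Hom(subvs_of W1, subvs_of W2))
    (k : 'Hom(subvs_of W2, subvs_of W3)) : hat (k \o h)%VF = (hat k \o hat h)%VF.
Proof.
apply/lfunP => u; by rewrite comp_lfunE [hat h u]hatE hat_val hatE comp_lfunE.
Qed.

Lemma hat1 W : hat (\1%VF : 'End(subvs_of W)) = pr W.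
Proof. by apply/lfunP => u; rewrite hatE lfunE /= vsprojK ?pr_mem. Qed.

Lemma hat_inj W1 W2 : injective (@hat W1 W2).
Proof. exact: can_inj (@hatK W1 W2). Qed.

Lemma hat_prr W1 W2 (h : 'Hom(subvs_of W1, subvs_of W2)) :
  (hat h \o pr W1)%VF = hat h.
Proof. by rewrite -[RHS](congr1 (@hat W1 W2) (comp_lfun1r h)) hat_comp hat1. Qed.

Lemma hat_prl W1 W2 (h : 'Hom(subvs_of W1, subvs_of W2)) :
  (pr W2 \o hat h)%VF = hat h.
Proof. by rewrite -[RHS](congr1 (@hat W1 W2) (comp_lfun1l h)) hat_comp hat1. Qed.

Lemma hat_proj_between W1 W2 : hat (proj_between dot W1 W2) = (pr W2 \o pr W1)%VF.
Proof.
apply/lfunP => u; rewrite hatE /proj_between -prE !comp_lfunE !lfunE /=.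
by rewrite vsprojK ?pr_mem // vsprojK ?pr_mem.
Qed.

Lemma compression_linear W1 W2 : linear (@compression W1 W2).
Proof.
move=> a f g; apply/lfunP => w; apply: subvs_inj.
by rewrite compressionE !add_lfunE !scale_lfunE !linearP /= !compressionE.
Qed.

(** The inclusion of W followed by the projection onto W is the identity, so
    cyclicity of the trace removes both. *)
Lemma endo_trace_hat W (h : 'End(subvs_of W)) : endo_trace (hat h) = endo_trace h.
Proof.
have -> : hat h = (linfun vsval \o (h \o (linfun (vsproj W) \o pr W)))%VF.
  by rewrite hat_def !comp_lfunA.
rewrite endo_trace_comp; congr endo_trace; apply/lfunP => w.
by rewrite !comp_lfunE !lfunE /= pr_id ?subvsP // vsvalK.
Qed.

Lemma endo_trace_pr W : endo_trace (pr W) = (\dim W)%:R.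
Proof. by rewrite -hat1 endo_trace_hat endo_trace1 dimvf /dim /= . Qed.

Lemma HE_hat W (h : 'End(subvs_of W)) :
  HE (@sub_metric R E dot W) h <-> HE dot (hat h).
Proof.
split=> hh u v; last by have := hh (vsval u) (vsval v); rewrite !hat_val.
have hw x : hat h x = pr W (hat h x) by rewrite pr_id // hatE subvsP.
rewrite (hw u) (hw v) dot_pr -[RHS]dot_pr !hatE.
have := hh (vsproj W (pr W u)) (vsproj W (pr W v)).
by rewrite /sub_metric !vsprojK ?pr_mem.
Qed.

Lemma dot_hat W (h : 'End(subvs_of W)) u :
  dot (hat h u) u = sub_metric dot (h (vsproj W (pr W u))) (vsproj W (pr W u)).
Proof. by rewrite /sub_metric vsprojK ?pr_mem // -dot_pr pr_id ?hatE ?subvsP. Qed.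

Lemma HP_hat W (h : 'End(subvs_of W)) :
  HP (@sub_metric R E dot W) h <-> HP dot (hat h).
Proof.
split=> -[/HE_hat hh ph]; split=> // u; first by rewrite dot_hat.
by have := ph (vsval u); rewrite hat_val.
Qed.

Lemma HPD_hat W (h : 'End(subvs_of W)) :
  HPD (@sub_metric R E dot W) h <->
  HE dot (hat h) /\ forall u, u \in W -> u != 0 -> 0 < dot (hat h u) u.
Proof.
split=> -[/HE_hat hh ph]; split=> // u.
  move=> uW u0; rewrite dot_hat ph // pr_id //; apply: contraNneq u0 => u0.
  by rewrite -(vsprojK uW) u0.
move=> u0; have := ph (vsval u); rewrite hat_val; apply; first exact: subvsP.
by apply: contraNneq u0 => u0; apply/eqP/subvs_inj; rewrite u0.
Qed.

End Subspaces.

(** * Smooth maps in realified coordinates *)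

Section Realify.
Context {R : realType} {m : nat}.
Local Notation C := R[i].
Implicit Types (O : set 'rV[R]_m).

Lemma C_on_Ck p k O (F : 'rV[R]_m -> 'rV[R]_p) : C_on k O F = Ck k O F.
Proof.
elim: k F => [|k IH] F //=; congr (_ /\ _).
by apply/propext; split=> h v; [rewrite -IH | rewrite IH]; exact: h.
Qed.

Lemma C_on_coord p k O (F : 'rV[R]_m -> 'rV[R]_p) j : open O -> C_on k O F ->
  Ck k O (fun r => F r 0 j).
Proof.
rewrite C_on_Ck => oO cF.
have lin : linear (fun r : 'rV[R]_p => r 0 j) by move=> a u v; rewrite !mxE.
pose L : {linear 'rV[R]_p -> R} := HB.pack (fun r : 'rV[R]_p => r 0 j)
  (GRing.isLinear.Build _ _ _ _ _ lin).
by apply: (Ck_lin (L := L) oO _ cF); exact: coord_continuous.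
Qed.

Lemma C_on_of_coord p k O (F : 'rV[R]_m -> 'rV[R]_p) : open O ->
  (forall j, Ck k O (fun r => F r 0 j)) -> C_on k O F.
Proof.
move=> oO cF; rewrite C_on_Ck.
suff : Ck k O (fun r => \sum_j F r 0 j *: (delta_mx 0 j : 'rV[R]_p)).
  by apply: Ck_eq => // r _; rewrite -row_sum_delta.
apply: Ck_sum => // j _.
have lin : linear (fun a : R => a *: (delta_mx 0 j : 'rV[R]_p)).
  by move=> a u v; rewrite scalerDl scalerA.
pose L : {linear R -> 'rV[R]_p} := HB.pack (fun a : R => a *: (delta_mx 0 j : 'rV[R]_p))
  (GRing.isLinear.Build _ _ _ _ _ lin).
apply: (Ck_lin (L := L) oO _ (cF j)); exact: scalel_continuous.
Qed.

Section Target.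
Context {V : vectType C}.

Definition unrealify (r : 'rV[R]_(\dim {:V} + \dim {:V})) : V :=
  \sum_j (r 0 (lshift _ j) +i* r 0 (rshift _ j)) *: (vbasis {:V})`_j.

Lemma realifyK : cancel (@realify R V) unrealify.
Proof.
move=> v; rewrite [RHS](coord_vbasis (memvf v)); apply: eq_bigr => j _.
rewrite /realify row_mxEl row_mxEr !mxE; congr (_ *: _).
by case: (coord _ j v).
Qed.

Lemma Cc_unrealify k O (F : 'rV[R]_m -> 'rV[R]_(\dim {:V} + \dim {:V}))
    (l : {scalar V}) : open O -> C_on k O F -> Cc k O (fun r => l (unrealify (F r))).
Proof.
move=> oO cF.
suff : Cc k O (fun r => \sum_j (F r 0 (lshift _ j) +i* F r 0 (rshift _ j))
    * l (vbasis {:V})`_j).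
  apply: Cc_eq => // r _; rewrite linear_sum; apply: eq_bigr => j _.
  by rewrite linearZ.
apply: Cc_sum => // j _; apply: CcM => //; last exact: Cc_cst.
by split; exact: C_on_coord.
Qed.

Lemma C_on_realify k O (Phi : 'rV[R]_m -> V) : open O ->
  (forall j, Cc k O (fun r => coord (vbasis {:V}) j (Phi r))) ->
  C_on k O (fun r => realify (Phi r)).
Proof.
move=> oO cP; apply: C_on_of_coord => // j.
rewrite -(fintype.splitK j); case: (fintype.split j) => l /=.
  by apply: Ck_eq (proj1 (cP l)) => // r _; rewrite row_mxEl mxE.
by apply: Ck_eq (proj2 (cP l)) => // r _; rewrite row_mxEr mxE.
Qed.

End Target.

Lemma C_on_id k O : open O -> C_on k O (@id 'rV[R]_m).
Proof.
move=> oO; rewrite C_on_Ck.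
elim: k => [|k _]; first by move=> x _; exact: cvg_id.
split=> [x _|v]; first by case: (is_diff_id x).
by apply: (Ck_eq oO _ (Ck_cst k O v)) => x _; rewrite derive_id.
Qed.

Lemma Cc_linear_mx p q k O (A : 'rV[R]_m -> 'M[C]_(p, q)) (l : {scalar 'M[C]_(p, q)}) :
  open O -> Mc k O A -> Cc k O (fun r => l (A r)).
Proof.
move=> oO cA.
suff : Cc k O (fun r => \sum_i \sum_j A r i j * l (delta_mx i j)).
  apply: Cc_eq => // r _; rewrite {2}[A r]matrix_sum_delta linear_sum.
  by apply: eq_bigr => i _; rewrite linear_sum; apply: eq_bigr => j _; rewrite linearZ.
by apply: Cc_sum => // i _; apply: Cc_sum => // j _; apply: CcM => //; exact: Cc_cst.
Qed.

Lemma open_neq0 O (f : 'rV[R]_m -> C) : open O -> Cc 0 O f ->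
  open [set r | O r /\ f r != 0].
Proof.
move=> oO cf; rewrite openE => r [Or f0].
have e0 : 0 < `|f r| / 2 by rewrite divr_gt0 ?normr_gt0 ?ltr0n.
have nO : nbhs r O by exact: open_nbhs_nbhs.
apply: filterS2 nO (Cc_ccont cf Or e0) => y Oy h; split=> //.
apply: contraTneq h => ->; rewrite sub0r normrN lt_geF //.
by rewrite ltr_pdivrMr ?ltr0n // mulr_natr mulr2n ltrDl normr_gt0.
Qed.

End Realify.

Section DropMiddle.
Context {R : realType} (V1 V2 V3 : vectType R[i]).
Local Notation V123 := (V1 * V2 * V3)%type.
Local Notation V13 := (V1 * V3)%type.

Definition drop_middle (r : 'rV[R]_(\dim {:V123} + \dim {:V123})) :=
  realify ((unrealify (V := V123) r).1.1, (unrealify (V := V123) r).2).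

Lemma drop_middle_realify u v w :
  drop_middle (realify ((u, v, w) : V123)) = realify ((u, w) : V13).
Proof. by rewrite /drop_middle realifyK. Qed.

Lemma C_on_drop_middle m k (D : set 'rV[R]_m) F : open D -> C_on k D F ->
  C_on k D (fun r => drop_middle (F r)).
Proof.
move=> oD cF; apply: (@C_on_realify R _ V13) => // j.
pose L (v : V123) : V13 := (v.1.1, v.2).
have lin : scalar (fun v => coord (vbasis {:V13}) j (L v)).
  by move=> a u v; rewrite -linearP.
pose l : {scalar V123} := HB.pack (fun v => coord (vbasis {:V13}) j (L v))
  (GRing.isLinear.Build _ _ _ _ _ lin).
exact: (@Cc_unrealify R _ V123 _ _ _ l oD cF).
Qed.

End DropMiddle.

(** * The charts of the bundles in terms of matrices *)

Section Charts.
Context {R : realType} {E : vectType R[i]} (dot : {dot E for (@conjC R[i])}).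
Local Notation C := R[i].
Context {n : nat} (e : 'I_n -> E).
Hypothesis one : onbasis dot e.
Implicit Types (W : {vspace E}).

Local Notation mt := (mt dot e).
Local Notation em := (em dot e).
Local Notation pr := (pr dot).
Local Notation perp := (perp dot).
Local Notation P W := (mt (pr W)).

Lemma oproj_pr W : oproj (P W).
Proof.
split; last by rewrite -mt_comp // pr_comp.
by apply/(HE_mt one) => u v; exact: dot_pr.
Qed.

Lemma mt_pr_perp W : P (perp W) = 1%:M - P W.
Proof. by rewrite pr_perp mtB // mt1. Qed.

Lemma trace_pr W : \tr (P W) = (\dim W)%:R.
Proof. by rewrite -trace_mt // endo_trace_pr. Qed.

Lemma trans_mt W0 W : trans (P W0) (P W) =
  mt ((pr W0 \o pr W)%VF + (pr (perp W0) \o pr (perp W))%VF).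
Proof.
rewrite (mtD dot e).
rewrite (mt_comp one (pr W0)).
rewrite (mt_comp one (pr (perp W0))).
rewrite (mt_pr_perp W0).
rewrite (mt_pr_perp W).
by [].
Qed.

Lemma trans_unitP W0 W : \dim W = \dim W0 ->
  (trans (P W0) (P W) \in unitmx) = ((W :&: perp W0)%VS == 0%VS).
Proof.
move=> dW; apply/idP/eqP => [uN|cap0].
  apply/eqP; rewrite -subv0; apply/subvP => u; rewrite memv_cap => /andP[uW uP].
  have Nu : trans (P W0) (P W) *m cv dot e u = 0.
    rewrite trans_mt -(cv_mt one) add_lfunE !comp_lfunE (pr_id dot uW) (pr0 uP).
    by rewrite (pr0 (memv_perp2 _ uW)) linear0 addr0 cv0.
  by rewrite memv0 -(cv_eq0 one) -[cv _ _ _](mulKmx uN) Nu mulmx0.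
apply: trans_unit; try exact: oproj_pr.
  move=> x Wx W0x; rewrite -[x](vcK one); apply/eqP; rewrite (cv_eq0 one).
  have := memv0 (vc e x); rewrite -cap0 memv_cap => <-; apply/andP; split.
    by rewrite -(pr_fixE dot); apply/eqP/(can_inj (cvK one)); rewrite (cv_mt one) (vcK one).
  by rewrite -(pr_kerE dot) -(cv_eq0 one) (cv_mt one) (vcK one) W0x.
move=> x Wx W0x; rewrite -[x](vcK one); apply/eqP; rewrite (cv_eq0 one).
set u := vc e x.
have uW : u \in perp W by rewrite -pr_kerE -(cv_eq0 one) (cv_mt one) (vcK one) Wx.
have uW0 : u \in W0.
  by rewrite -(pr_fixE dot); apply/eqP/(can_inj (cvK one)); rewrite (cv_mt one) (vcK one).
have full : (W + perp W0)%VS = fullv.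
  apply/eqP; rewrite eqEdim subvf /= dimv_disjoint_sum // dW.
  by rewrite dim_limg_perp.
have : u \in (W + perp W0)%VS by rewrite full memvf.
case/memv_addP => a aW [b bP uE]; rewrite -(dnorm_eq0 dot) {2}uE linearDr /=.
have /perpP -> // := uW; rewrite add0r dotC.
by have /perpP -> := bP; rewrite ?conjC0.
Qed.

Lemma inv_lfun_eq (V1 V2 : vectType C) (f : 'Hom(V1, V2)) (g : 'Hom(V2, V1)) :
  (f \o g = \1)%VF -> (g \o f = \1)%VF -> (f^-1)%VF = g.
Proof.
move=> fg gf; apply/lfunP => v.
have fgv : f (g v) = v by rewrite -comp_lfunE fg id_lfunE.
have fi : f (f^-1%VF v) = v by rewrite limg_lfunVK // -fgv memv_img ?memvf.
by rewrite -[LHS](id_lfunE (f^-1%VF v)) -gf comp_lfunE fi.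
Qed.

Section OneChart.
Variables (W0 W : {vspace E}).
Local Notation N := (trans (P W0) (P W)).
Local Notation T := (invmx N).
Hypothesis uN : N \in unitmx.

Let tc := trans_inv_comm (oproj_pr W0) (oproj_pr W) uN.

(** On W the matrix [trans] acts as the projection to W0, so its inverse inverts
    that projection. *)
Lemma proj_between_inv : mt (hat dot (proj_between dot W W0)^-1%VF) = T *m P W0.
Proof.
pose q := compression dot W0 W (em (T *m P W0)).
have hq : mt (hat dot q) = T *m P W0.
  rewrite compressionK !mt_comp // emK // mulmxA -tc.
  by rewrite -!mulmxA !(proj2 (oproj_pr _)).
suff -> : (proj_between dot W W0)^-1%VF = q by [].
apply: inv_lfun_eq; apply: (@hat_inj _ _ dot); rewrite hat_comp hat1;
    apply: (mt_inj one); rewrite mt_comp // hat_proj_between mt_comp // hq.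
  rewrite -mulmxA [P W *m _]mulmxA -tc.
  by rewrite -mulmxA (proj2 (oproj_pr _)) mulmxA trans_inv_fix //; exact: oproj_pr.
rewrite -!mulmxA [P W0 *m (P W0 *m _)]mulmxA (proj2 (oproj_pr _)).
by rewrite -(trans_projr (P W0) (oproj_pr W)) mulmxA mulVmx // mul1mx.
Qed.

Lemma mt_graph_map : mt (hat dot (graph_map dot W0 W)) = (1%:M - P W0) *m T *m P W0.
Proof.
rewrite /graph_map hat_comp mt_comp // proj_between_inv hat_proj_between mt_comp //.
rewrite mt_pr_perp -mulmxA [P W *m _]mulmxA -tc.
by rewrite -[T *m P W0 *m P W0]mulmxA (proj2 (oproj_pr _)) mulmxA.
Qed.

Lemma mt_conj_endo (h : 'End(subvs_of W)) :
  mt (hat dot (conj_endo (proj_between dot W W0) h)) = N *m mt (hat dot h) *m T.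
Proof.
rewrite /conj_endo !hat_comp !mt_comp // proj_between_inv hat_proj_between mt_comp //.
rewrite tc; apply: trans_conj; first exact: oproj_pr.
  by rewrite -mt_comp // hat_prl.
by rewrite -mt_comp // hat_prr.
Qed.

End OneChart.

End Charts.

Section MatrixRealify.
Context {R : realType} {m : nat}.
Local Notation C := R[i].
Implicit Types (O : set 'rV[R]_m).

Lemma Mc_unrealify p q k O (V : vectType C) (L : V -> 'M[C]_(p, q))
    (F : 'rV[R]_m -> 'rV[R]_(\dim {:V} + \dim {:V})) :
  linear L -> open O -> C_on k O F -> Mc k O (fun r => L (unrealify (F r))).
Proof.
move=> linL oO cF i j.
have lin : scalar (fun v => L v i j) by move=> a u v; rewrite linL !mxE.
pose l : {scalar V} := HB.pack (fun v => L v i j)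
  (GRing.isLinear.Build _ _ _ _ _ lin).
exact: (Cc_unrealify l oO cF).
Qed.

Lemma Cc_coord_mx p q k O (V : vectType C) (L : 'M[C]_(p, q) -> V)
    (A : 'rV[R]_m -> 'M[C]_(p, q)) j :
  linear L -> open O -> Mc k O A -> Cc k O (fun r => coord (vbasis {:V}) j (L (A r))).
Proof.
move=> linL oO cA.
have lin : scalar (fun B => coord (vbasis {:V}) j (L B)).
  by move=> a u v; rewrite linL linearP.
pose l : {scalar 'M[C]_(p, q)} := HB.pack (fun B => coord (vbasis {:V}) j (L B))
  (GRing.isLinear.Build _ _ _ _ _ lin).
exact: (Cc_linear_mx l oO cA).
Qed.

Section Products.
Variables V1 V2 V3 : vectType C.
Local Notation V23 := (V1 * V2)%type.
Local Notation V123 := (V1 * V2 * V3)%type.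

Lemma Mc_pair1 p q k O (L : V1 -> 'M[C]_(p, q))
    (F : 'rV[R]_m -> 'rV[R]_(\dim {:V23} + \dim {:V23})) :
  linear L -> open O -> C_on k O F -> Mc k O (fun r => L (unrealify (F r)).1).
Proof.
move=> linL oO cF; apply: (@Mc_unrealify _ _ _ _ _ (fun v : V23 => L v.1)) => //.
by move=> a u v; exact: linL.
Qed.

Lemma Mc_pair2 p q k O (L : V2 -> 'M[C]_(p, q))
    (F : 'rV[R]_m -> 'rV[R]_(\dim {:V23} + \dim {:V23})) :
  linear L -> open O -> C_on k O F -> Mc k O (fun r => L (unrealify (F r)).2).
Proof.
move=> linL oO cF; apply: (@Mc_unrealify _ _ _ _ _ (fun v : V23 => L v.2)) => //.
by move=> a u v; exact: linL.
Qed.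

Lemma Mc_triple1 p q k O (L : V1 -> 'M[C]_(p, q))
    (F : 'rV[R]_m -> 'rV[R]_(\dim {:V123} + \dim {:V123})) :
  linear L -> open O -> C_on k O F -> Mc k O (fun r => L (unrealify (F r)).1.1).
Proof.
move=> linL oO cF; apply: (@Mc_unrealify _ _ _ _ _ (fun v : V123 => L v.1.1)) => //.
by move=> a u v; exact: linL.
Qed.

Lemma Mc_triple2 p q k O (L : V2 -> 'M[C]_(p, q))
    (F : 'rV[R]_m -> 'rV[R]_(\dim {:V123} + \dim {:V123})) :
  linear L -> open O -> C_on k O F -> Mc k O (fun r => L (unrealify (F r)).1.2).
Proof.
move=> linL oO cF; apply: (@Mc_unrealify _ _ _ _ _ (fun v : V123 => L v.1.2)) => //.
by move=> a u v; exact: linL.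
Qed.

Lemma Mc_triple3 p q k O (L : V3 -> 'M[C]_(p, q))
    (F : 'rV[R]_m -> 'rV[R]_(\dim {:V123} + \dim {:V123})) :
  linear L -> open O -> C_on k O F -> Mc k O (fun r => L (unrealify (F r)).2).
Proof.
move=> linL oO cF; apply: (@Mc_unrealify _ _ _ _ _ (fun v : V123 => L v.2)) => //.
by move=> a u v; exact: linL.
Qed.

Lemma C_on_triple p q k O (g1 : 'M[C]_(p, q) -> V1) (g2 : 'M[C]_(p, q) -> V2)
    (g3 : 'M[C]_(p, q) -> V3) (A1 A2 A3 : 'rV[R]_m -> 'M[C]_(p, q)) :
  linear g1 -> linear g2 -> linear g3 -> open O ->
  Mc k O A1 -> Mc k O A2 -> Mc k O A3 ->
  C_on k O (fun r => realify ((g1 (A1 r), g2 (A2 r), g3 (A3 r)) : V123)).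
Proof.
move=> lin1 lin2 lin3 oO c1 c2 c3; apply: (@C_on_realify _ _ V123) => // j.
pose L1 B : V123 := (g1 B, 0, 0); pose L2 B : V123 := (0, g2 B, 0).
pose L3 B : V123 := (0, 0, g3 B).
have l1 : linear L1.
  by move=> a u v; rewrite /L1 lin1; congr (_, _, _); rewrite /= scaler0 addr0.
have l2 : linear L2.
  by move=> a u v; rewrite /L2 lin2; congr (_, _, _); rewrite /= scaler0 addr0.
have l3 : linear L3.
  by move=> a u v; rewrite /L3 lin3; congr (_, _, _); rewrite /= scaler0 addr0.
have := CcD oO (CcD oO (Cc_coord_mx j l1 oO c1) (Cc_coord_mx j l2 oO c2))
  (Cc_coord_mx j l3 oO c3).
apply: Cc_eq => // r _; rewrite -!linearD; congr (coord _ _ _).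
by congr (_, _, _); rewrite /= ?addr0 ?add0r.
Qed.

End Products.

Lemma open_unitmx p O (A : 'rV[R]_m -> 'M[C]_p) : open O -> Mc 0 O A ->
  open [set r | O r /\ A r \in unitmx].
Proof.
move=> oO cA; rewrite (_ : mkset _ = [set r | O r /\ \det (A r) != 0]).
  exact/open_neq0/Cc_det.
by apply/seteqP; split=> r /= [Or]; rewrite unitmxE unitfE.
Qed.

End MatrixRealify.

Section Bundles.
Context {R : realType} {E : vectType R[i]} (dot : {dot E for (@conjC R[i])}).
Local Notation C := R[i].
Context {n : nat} (e : 'I_n -> E).
Hypothesis one : onbasis dot e.
Context {d : nat}.
Implicit Types (W : @grassmannian R E d).

Local Notation mt := (mt dot e).
Local Notation em := (em dot e).
Local Notation pr := (pr dot).
Local Notation perp := (perp dot).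
Local Notation P W := (mt (pr (val W))).
Local Notation hat := (hat dot).
Local Notation compression := (compression dot).

Lemma hat_linear (W1 W2 : {vspace E}) : linear (@hat W1 W2).
Proof.
move=> a f g; apply/lfunP => u.
by rewrite add_lfunE scale_lfunE !hatE add_lfunE scale_lfunE linearP.
Qed.

Lemma mt_hat_linear (W1 W2 : {vspace E}) : linear (fun h => mt (@hat W1 W2 h)).
Proof. by move=> a f g; rewrite hat_linear mt_linear. Qed.

Lemma compression_em_linear (W1 W2 : {vspace E}) :
  linear (fun A => compression W1 W2 (em A)).
Proof. by move=> a f g; rewrite (em_linear one) compression_linear. Qed.

(** The frame carrying the splitting of E at the center of a chart to the
    splitting at a point, in terms of the graph coordinate of the point. *)
Definition frame (X : 'M[C]_n) := 1%:M + X - adj X.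

Section At.
Variables (W0 : @grassmannian R E d) (W : @grassmannian R E d).
Hypothesis capW : (val W :&: perp (val W0) = 0)%VS.
Local Notation N := (trans (P W0) (P W)).

Lemma trans_unit_at : N \in unitmx.
Proof.
rewrite (trans_unitP one) ?capW ?eqxx //.
by rewrite (eqP (valP W)) (eqP (valP W0)).
Qed.

Lemma frame_graph :
  frame (mt (hat (graph_map dot (val W0) (val W)))) = invmx N.
Proof.
by rewrite /frame (mt_graph_map one trans_unit_at) -trans_graph ?trans_unit_at //;
  exact: oproj_pr.
Qed.

Lemma frame_projection (T := invmx N) : P W = T *m P W0 *m invmx T.
Proof.
rewrite /T invmxK trans_inv_comm ?trans_unit_at //; try exact: oproj_pr.
by rewrite -mulmxA mulVmx ?mulmx1 // trans_unit_at.
Qed.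

Lemma frame_conj_tautological (h : 'End(subvs_of (val W))) (T := invmx N) :
  mt (hat h) =
  T *m mt (hat (conj_endo (proj_between dot (val W) (val W0)) h)) *m invmx T.
Proof.
have uN := trans_unit_at.
by rewrite (mt_conj_endo one) // /T invmxK -!mulmxA mulVmx // mulmx1 mulKmx.
Qed.

Lemma mt_conj_endo_perp (h : 'End(subvs_of (perp (val W)))) :
  mt (hat (conj_endo (proj_between dot (perp (val W)) (perp (val W0))) h)) =
  N *m mt (hat h) *m invmx N.
Proof.
have uN := trans_unit_at.
rewrite (mt_conj_endo one) !(mt_pr_perp one) trans_compl //.
Qed.

Lemma frame_conj_orthogonal (h : 'End(subvs_of (perp (val W)))) (T := invmx N) :
  mt (hat h) =
  T *m mt (hat (conj_endo (proj_between dot (perp (val W)) (perp (val W0))) h)) *m invmx T.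
Proof.
have uN := trans_unit_at.
by rewrite mt_conj_endo_perp /T invmxK -!mulmxA mulVmx // mulmx1 mulKmx.
Qed.

End At.

Lemma cap_trans_unit W0 W :
  (val W :&: perp (val W0) = 0)%VS <-> trans (P W0) (P W) \in unitmx.
Proof.
rewrite (trans_unitP one); last by rewrite (eqP (valP W)) (eqP (valP W0)).
by split=> [->|/eqP].
Qed.

(** Matrices that determine a point of the bundle independently of charts. *)
Definition Pm (x : EndSSperp dot d) : 'M[C]_n := P (tag x).
Definition Hm (x : EndSSperp dot d) : 'M[C]_n := mt (hat (tagged x).1).
Definition Km (x : EndSSperp dot d) : 'M[C]_n := mt (hat (tagged x).2).

Section ChartW0.
Variable W0 : @grassmannian R E d.
Local Notation c := (EndSSperp_chart dot W0).
Local Notation G0 := 'Hom(subvs_of (val W0), subvs_of (perp (val W0))).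
Local Notation E0 := 'End(subvs_of (val W0)).
Local Notation E0p := 'End(subvs_of (perp (val W0))).
Local Notation V0 := (G0 * E0 * E0p)%type.

Lemma cdom_trans (x : EndSSperp dot d) : cdom c x <-> trans (P W0) (Pm x) \in unitmx.
Proof. exact: cap_trans_unit. Qed.

Definition chT (r : 'rV[R]_(cdim c)) := frame (mt (hat (unrealify (V := V0) r).1.1)).
Definition chH (r : 'rV[R]_(cdim c)) := mt (hat (unrealify (V := V0) r).1.2).
Definition chK (r : 'rV[R]_(cdim c)) := mt (hat (unrealify (V := V0) r).2).

Definition chdom : set 'rV[R]_(cdim c) := [set r | chT r \in unitmx].

Lemma unrealify_cmap x : unrealify (V := V0) (cmap c x) =
  (graph_map dot (val W0) (val (tag x)),
   conj_endo (proj_between dot (val (tag x)) (val W0)) (tagged x).1,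
   conj_endo (proj_between dot (perp (val (tag x))) (perp (val W0))) (tagged x).2).
Proof. exact: (@realifyK R V0). Qed.

Lemma chT_cmap x :
  chT (cmap c x) = frame (mt (hat (graph_map dot (val W0) (val (tag x))))).
Proof. by rewrite /chT unrealify_cmap. Qed.

Lemma chH_cmap x : chH (cmap c x) =
  mt (hat (conj_endo (proj_between dot (val (tag x)) (val W0)) (tagged x).1)).
Proof. by rewrite /chH unrealify_cmap. Qed.

Lemma chK_cmap x : chK (cmap c x) =
  mt (hat (conj_endo (proj_between dot (perp (val (tag x))) (perp (val W0))) (tagged x).2)).
Proof. by rewrite /chK unrealify_cmap. Qed.

Definition chPm r := chT r *m P W0 *m invmx (chT r).
Definition chHm r := chT r *m chH r *m invmx (chT r).
Definition chKm r := chT r *m chK r *m invmx (chT r).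

(** The three matrices are linear functions of the coordinates conjugated by
    the frame, so they depend smoothly on the coordinates. *)
Lemma chart_matrices x : cdom c x -> let r := cmap c x in
  [/\ chdom r, Pm x = chPm r, Hm x = chHm r & Km x = chKm r].
Proof.
move=> cx r; rewrite /chPm /chHm /chKm /chdom /mkset /r chT_cmap chH_cmap chK_cmap frame_graph //.
split; [|exact: frame_projection|exact: frame_conj_tautological
  |exact: frame_conj_orthogonal].
by rewrite unitmx_inv trans_unit_at.
Qed.

Lemma Mc_chT k : Mc k setT chT.
Proof.
have := Mc_triple1 (@mt_hat_linear _ _) openT (C_on_id k openT).
move=> c1; apply: McB; [exact: openT | | apply: Mc_adj; [exact: openT | exact: c1]].
by apply: McD; [exact: openT | exact: Mc_cst | exact: c1].
Qed.

Lemma open_chdom : open chdom.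
Proof.
have := open_unitmx openT (Mc_chT 0); congr open.
by apply/seteqP; split=> r //= [].
Qed.

Lemma Mc_chart k (A : 'rV[R]_(cdim c) -> 'M[C]_n) : Mc k setT A ->
  Mc k chdom (fun r => chT r *m A r *m invmx (chT r)).
Proof.
move=> cA; have o := open_chdom.
have cT : Mc k chdom chT by apply: Mc_sub (Mc_chT k).
apply: McM => //; first by apply: McM => //; apply: Mc_sub cA.
exact: Mc_inv.
Qed.

Lemma Mc_chH k : Mc k setT chH.
Proof. exact: Mc_triple2 (@mt_hat_linear _ _) openT (C_on_id k openT). Qed.

Lemma Mc_chK k : Mc k setT chK.
Proof. exact: Mc_triple3 (@mt_hat_linear _ _) openT (C_on_id k openT). Qed.

Lemma Mc_chPm k : Mc k chdom chPm. Proof. exact/Mc_chart/Mc_cst. Qed.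
Lemma Mc_chHm k : Mc k chdom chHm. Proof. exact/Mc_chart/Mc_chH. Qed.
Lemma Mc_chKm k : Mc k chdom chKm. Proof. exact/Mc_chart/Mc_chK. Qed.

Lemma Mc_trans m (O : set 'rV[R]_m) (A : 'rV[R]_m -> 'M[C]_n) k :
  open O -> Mc k O A -> Mc k O (fun r => trans (P W0) (A r)).
Proof.
move=> oO cA; apply: McD => //; first by apply: McM => //; exact: Mc_cst.
apply: McM => //; first exact: Mc_cst.
by apply: McB => //; exact: Mc_cst.
Qed.

(** The coordinates as explicit smooth functions of the matrices, conversely to
    [chart_matrices]. *)
Definition of_matrices (A H K : 'M[C]_n) : 'rV[R]_(cdim c) :=
  let N := trans (P W0) A in
  realify ((compression (val W0) (perp (val W0)) (em ((1%:M - P W0) *m invmx N *m P W0)),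
            compression (val W0) (val W0) (em (N *m H *m invmx N)),
            compression (perp (val W0)) (perp (val W0)) (em (N *m K *m invmx N))) : V0).

Lemma cmap_of_matrices x : cdom c x -> cmap c x = of_matrices (Pm x) (Hm x) (Km x).
Proof.
move=> cx; have uN := trans_unit_at cx; congr realify; congr (_, _, _).
- apply: etrans (esym (hatK dot _)) _; apply: congr1.
  apply: etrans (esym (mtK one _)) _; apply: congr1.
  exact: (mt_graph_map one uN).
- apply: etrans (esym (hatK dot _)) _; apply: congr1.
  apply: etrans (esym (mtK one _)) _; apply: congr1.
  exact: (mt_conj_endo one uN).
- apply: etrans (esym (hatK dot _)) _; apply: congr1.
  apply: etrans (esym (mtK one _)) _; apply: congr1.
  exact: (mt_conj_endo_perp cx).
Qed.

Lemma of_matrices_smooth m (O : set 'rV[R]_m) (A H K : 'rV[R]_m -> 'M[C]_n) k :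
  open O -> Mc k O A -> Mc k O H -> Mc k O K ->
  (forall r, O r -> trans (P W0) (A r) \in unitmx) ->
  C_on k O (fun r => of_matrices (A r) (H r) (K r)).
Proof.
move=> oO cA cH cK uN.
have cN := Mc_trans oO cA.
have cI : Mc k O (fun r => invmx (trans (P W0) (A r))) by exact: Mc_inv.
have c1 : Mc k O (fun r => (1%:M - P W0) *m invmx (trans (P W0) (A r)) *m P W0).
  by apply: McM => //; [apply: McM => //; exact: Mc_cst | exact: Mc_cst].
have c2 : Mc k O (fun r => trans (P W0) (A r) *m H r *m invmx (trans (P W0) (A r))).
  by apply: McM => //; exact: McM.
have c3 : Mc k O (fun r => trans (P W0) (A r) *m K r *m invmx (trans (P W0) (A r))).
  by apply: McM => //; exact: McM.
exact: (C_on_triple (@compression_em_linear _ _) (@compression_em_linear _ _)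
  (@compression_em_linear _ _) oO c1 c2 c3).
Qed.

End ChartW0.
End Bundles.

(** * Smooth maps are continuous for the topologies of the charts *)

Section ChartTopology.
Context {R : realType}.
Implicit Types M : chartedType R.

(** A charted space carries the topology for which a set is open as soon as it
    is so in every chart; that chart domains are open and charts continuous is
    a compatibility condition between the charts. *)
Definition compatible_charts M := forall (c c' : chart R M) (x : M) N,
  atlas c -> atlas c' -> cdom c x -> cdom c' x -> nbhs (cmap c x) N ->
  \forall v \near cmap c' x, forall y, cdom c' y -> cmap c' y = v ->
    cdom c y /\ N (cmap c y).

(** By compatibility, the points at which the chart has N as a neighborhood of
    its value form an open set. *)
Lemma chart_nbhs M (c : chart R M) x N : compatible_charts M -> atlas c ->
  cdom c x -> nbhs (cmap c x) N -> nbhs x [set y | cdom c y /\ N (cmap c y)].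
Proof.
move=> cM Ac cx nN; pose S := [set y | cdom c y /\ nbhs (cmap c y) N].
have oS : open S.
  apply/atlas_openE => c' Ac' y [cy nNy] c'y.
  have nNy' : nbhs (cmap c y) (fun v => nbhs v N) by exact: nbhs_interior.
  exact: cM Ac Ac' cy c'y nNy'.
apply: filterS (_ : nbhs x S) => [y [cy /nbhs_singleton]|] //.
exact: open_nbhs_nbhs.
Qed.

(** A neighborhood of the value in a chart pulls back to a neighborhood of the
    point by [chart_nbhs]. *)
Lemma smooth_continuous M (N : chartedType R) (A : set M) (f : M -> N) : compatible_charts M ->
  smooth_on A f -> {within A, continuous f}.
Proof.
move=> cM sf; apply/subspace_continuousP => x Ax U nU.
have [c Ac cx] := atlas_cover x; have [d Ad dfx] := atlas_cover (f x).
have [D [F [oD Dx cF fF]]] := sf x Ax c d Ac Ad cx dfx.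
have [_ FE] := fF x Ax cx Dx.
move: nU; rewrite nbhsE => -[U' [oU' U'fx] U'U].
have /(_ d Ad (f x) U'fx dfx) := (atlas_openE U').1 oU'.
rewrite FE => nU'.
have nF : nbhs (cmap c x) (F @^-1` [set v | forall y, cdom d y -> cmap d y = v -> U' y]).
  exact: (cF 0%N _ Dx) nU'.
have nO : nbhs (cmap c x) D by exact: open_nbhs_nbhs.
have nDF := @filterI _ _ (nbhs_filter (cmap c x)) _ _ nO nF.
have := chart_nbhs cM Ac cx nDF.
apply: filterS => y [cy [Dy Fy]] Ay.
have [dfy dfE] := fF y Ay cy Dy.
exact: (U'U (f y) (Fy (f y) dfy dfE)).
Qed.

Lemma smooth_on_sub M (N : chartedType R) (A B : set M) (f : M -> N) : B `<=` A ->
  smooth_on A f -> smooth_on B f.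
Proof.
move=> BA sf x Bx c d Ac Ad cx dfx.
have [D [F [oD Dx cF fF]]] := sf x (BA _ Bx) c d Ac Ad cx dfx.
by exists D, F; split=> // y /BA; exact: fF.
Qed.

(** Smoothness of the identity is smoothness of the transition maps. *)
Lemma compatible_smooth_id M : smooth_on [set: M] (fun x => x) -> compatible_charts M.
Proof.
move=> sid c c' x N Ac Ac' cx c'x nN.
have [D [F [oD Dx cF fF]]] := sid x I c' c Ac' Ac c'x cx.
have [_ FE] := fF x I c'x Dx.
rewrite FE in nN.
have nD : nbhs (cmap c' x) D by exact: open_nbhs_nbhs.
apply: filterS2 nD (cF 0%N _ Dx N nN) => v Dv NFv y c'y yv.
by have := fF y I c'y; rewrite yv => /(_ Dv)[cy ->].
Qed.

Lemma compatible_vect (V : vectType R[i]) : compatible_charts (vect_mfd V).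
Proof.
move=> c c' x N Ac Ac' _ _ nN.
have Ec : c = Chart setT (@realify R V : vect_mfd V -> _) := Ac.
have Ec' : c' = Chart setT (@realify R V : vect_mfd V -> _) := Ac'.
subst c c'.
apply: filterS nN => v Nv y _ yv.
by split=> //; rewrite yv.
Qed.

End ChartTopology.

Section NearSplits.
Context {R : realType} {V : normedModType R} {n : nat}.
Local Notation C := R[i].

Lemma near_splits O (A B : V -> 'M[C]_n) x : open O -> Mc 0 O A -> Mc 0 O B ->
  O x -> splits (A x) (B x) -> \forall y \near x, splits (A y) (B y).
Proof.
move=> oO cA cB Ox sx.
pose S y := symm ((1%:M - A y *+ 2) *m B y).
have cS : Mc 0 O S.
  have c1 : Mc 0 O (fun y => (1%:M - A y *+ 2) *m B y).
    apply: McM => //; apply: McB => //; first exact: Mc_cst.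
    by apply: (Mc_eq oO _ (McD oO cA cA)) => y _; rewrite mulr2n.
  by apply: McD => //; exact: Mc_adj.
have [delta d0 dP] := pd_open (adj_symm ((1%:M - A x *+ 2) *m B x)) sx.
apply: filterS (Mc0_near_small cS Ox d0) => y small.
rewrite /splits -[symm _](subrKC (S x)); apply: dP => //.
by rewrite adjB; congr (_ - _); exact: adj_symm.
Qed.

End NearSplits.

Section Gluing.
Context {R : realType} {E : vectType R[i]} (dot : {dot E for (@conjC R[i])}).
Local Notation C := R[i].
Context {n : nat} (e : 'I_n -> E).
Hypothesis one : onbasis dot e.
Context {d : nat}.

Local Notation mt := (mt dot e).
Local Notation em := (em dot e).
Local Notation pr := (pr dot).
Local Notation perp := (perp dot).
Local Notation P W := (mt (pr (val W))).
Local Notation hat := (hat dot).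
Local Notation M2 := (EndSSperp dot d).
Local Notation M1 := (EndSperp dot d).
Local Notation M0 := (vect_mfd 'End(E)).
Local Notation Pm := (@Pm R E dot n e d).
Local Notation Hm := (@Hm R E dot n e d).
Local Notation Km := (@Km R E dot n e d).

(** The coordinates in any chart are smooth functions of the three matrices;
    the chart only restricts these to the open set where [trans] is invertible. *)
Lemma smooth_into_bundle (M : chartedType R) (S : set M) (f : M -> M2) :
  (forall x, S x -> forall c : chart R M, atlas c -> cdom c x ->
    exists O (A H K : 'rV[R]_(cdim c) -> 'M[C]_n),
    [/\ open O, O (cmap c x), (forall k, [/\ Mc k O A, Mc k O H & Mc k O K]) &
      forall y, S y -> cdom c y -> O (cmap c y) ->
      [/\ Pm (f y) = A (cmap c y), Hm (f y) = H (cmap c y) & Km (f y) = K (cmap c y)]]) ->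
  smooth_on S f.
Proof.
move=> loc x Sx c d' Ac [W0 _ Ed] cx; subst d' => dfx.
have [D [A [H [K [oD Dx sm fE]]]]] := loc x Sx c Ac cx.
pose O := [set r | D r /\ trans (P W0) (A r) \in unitmx].
have oO : open O by apply: open_unitmx => //; apply: Mc_trans => //; case: (sm 0%N).
have sO : O `<=` D by move=> s [].
exists O, (fun r => of_matrices dot e W0 (A r) (H r) (K r)); split=> //.
- split=> //; have [<- _ _] := fE x Sx cx Dx; exact/(cdom_trans one).
- move=> k; have [cA cH cK] := sm k; apply: of_matrices_smooth => //.
  + exact: Mc_sub sO cA.
  + exact: Mc_sub sO cH.
  + exact: Mc_sub sO cK.
  + by move=> r [].
- move=> y Sy cy [Dy uy]; have [PE HE KE] := fE y Sy cy Dy.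
  have c0y : cdom (EndSSperp_chart dot W0) (f y) by apply/(cdom_trans one); rewrite PE.
  by split=> //; rewrite (cmap_of_matrices one c0y) PE HE KE.
Qed.

Lemma compatible_EndSSperp : compatible_charts M2.
Proof.
apply: compatible_smooth_id; apply: smooth_into_bundle => x _ c [W1 _ Ec] cx.
subst c; exists (chdom e (W0 := W1)), (chPm e (W0 := W1)), (chHm e (W0 := W1)), (chKm e (W0 := W1)).
split.
- exact: open_chdom.
- by have [] := chart_matrices one cx.
- by move=> k; split; [exact: Mc_chPm | exact: Mc_chHm | exact: Mc_chKm].
- by move=> y _ cy _; have [] := chart_matrices one cy.
Qed.

End Gluing.

Section Gluing.
Context {R : realType} {E : vectType R[i]} (dot : {dot E for (@conjC R[i])}).
Local Notation C := R[i].
Context {n : nat} (e : 'I_n -> E).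
Hypothesis one : onbasis dot e.
Context {d : nat}.

Local Notation mt := (mt dot e).
Local Notation em := (em dot e).
Local Notation pr := (pr dot).
Local Notation perp := (perp dot).
Local Notation P W := (mt (pr (val W))).
Local Notation hat := (hat dot).
Local Notation M2 := (EndSSperp dot d).
Local Notation M1 := (EndSperp dot d).
Local Notation M0 := (vect_mfd 'End(E)).
Local Notation Pm := (@Pm R E dot n e d).
Local Notation Hm := (@Hm R E dot n e d).
Local Notation Km := (@Km R E dot n e d).
Local Notation chdom W0 := (@chdom R E dot n e d W0).
Local Notation chPm W0 := (@chPm R E dot n e d W0).
Local Notation chHm W0 := (@chHm R E dot n e d W0).
Local Notation chKm W0 := (@chKm R E dot n e d W0).

(** * The gluing map *)

(** As [em] is linear, the coordinates of f are smooth once its matrix is. *)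
Lemma smooth_into_endo (M : chartedType R) (S : set M) (f : M -> M0) :
  (forall x, S x -> forall c : chart R M, atlas c -> cdom c x ->
    exists O (A : 'rV[R]_(cdim c) -> 'M[C]_n),
    [/\ open O, O (cmap c x), (forall k, Mc k O A) &
      forall y, S y -> cdom c y -> O (cmap c y) -> mt (f y) = A (cmap c y)]) ->
  smooth_on S f.
Proof.
move=> loc x Sx c d' Ac Ed cx.
have Ed' : d' = Chart setT (@realify R 'End(E) : M0 -> _) := Ed.
subst d' => _; have [D [A [oD Dx sm fE]]] := loc x Sx c Ac cx.
exists D, (fun r => realify (em (A r))); split=> //.
  move=> k; apply: C_on_realify => // j.
  exact: (Cc_coord_mx j (em_linear one) oD (sm k)).
by move=> y Sy cy Dy; split=> //=; rewrite -fE // (mtK one).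
Qed.

(** A point of the join of HP_1 (W) and HPD_1 (perp W) inside HP_1 (E): the
    trace of h is the join parameter. *)
Definition glue (x : M2) : M0 := em (Hm x + (1 - \tr (Hm x)) *: Km x).

Lemma mt_glue x : mt (glue x) = Hm x + (1 - \tr (Hm x)) *: Km x.
Proof. exact: emK. Qed.

Definition glue_chart (W0 : @grassmannian R E d) r :=
  chHm W0 r + (1 - \tr (chHm W0 r)) *: chKm W0 r.

Arguments glue_chart : clear implicits.

Lemma Mc_glue_chart W0 k : Mc k (chdom W0) (glue_chart W0).
Proof.
have o : open (chdom W0) by exact: open_chdom.
apply: McD => //; first exact: Mc_chHm.
apply: McZ => //; last exact: Mc_chKm.
by apply: CcB => //; [exact: Cc_cst | apply: Cc_trace => //; exact: Mc_chHm].
Qed.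

Lemma glue_chartE W0 x : cdom (EndSSperp_chart dot W0) x ->
  mt (glue x) = glue_chart W0 (cmap (EndSSperp_chart dot W0) x).
Proof. by move=> cx; have [_ _ HE KE] := chart_matrices one cx; rewrite mt_glue HE KE. Qed.

Lemma smooth_glue S : smooth_on S glue.
Proof.
apply: smooth_into_endo => x _ c [W0 _ Ec] cx; subst c.
exists (chdom W0), (glue_chart W0); split.
- exact: open_chdom.
- by have [] := chart_matrices one cx.
- exact: Mc_glue_chart.
- by move=> y _ cy _; exact: glue_chartE.
Qed.

(** For Hermitian f: the number c is not an eigenvalue, and exactly d eigenvalues
    lie below it.  The witness A need not commute with f, so that it can be kept
    fixed when f moves. *)
Definition gapped : set M0 := [set f | exists (A : 'M[C]_n) c,
  [/\ oproj A, \tr A = d%:R, 0 < c & splits A (mt f - c%:M)]].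

(** Some c exceeds the eigenvalues of h and lies below those of (1 - tr h) k. *)
Definition glue_gapped : set M2 := [set x |
  exists2 c, 0 < c & splits (Pm x) (mt (glue x) - c%:M)].

Lemma Mc_mt_unrealify k O : open O ->
  Mc k O (fun r => mt (unrealify (V := 'End(E)) r)).
Proof.
move=> oO.
exact: (Mc_unrealify (fun a f g => mt_linear dot e a f g) oO (C_on_id k oO)).
Qed.

Lemma open_gapped : open gapped.
Proof.
rewrite openE => f [A [c [oA tA c0 sA]]]; rewrite /interior.
pose ch := Chart setT (@realify R 'End(E) : M0 -> _).
have cB : Mc 0 setT (fun r => mt (unrealify (V := 'End(E)) r) - c%:M).
  apply: McB; [exact: openT | exact/Mc_mt_unrealify/openT | exact: Mc_cst].
have sA' : splits A (mt (unrealify (cmap ch f)) - c%:M) by rewrite /= realifyK.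
have := near_splits openT (Mc_cst 0 setT A) cB I sA'.
move/(chart_nbhs (@compatible_vect _ _) (erefl : atlas ch) (I : cdom ch f)).
apply: filterS => g [_ /=]; rewrite realifyK => sg.
by exists A, c.
Qed.

Lemma open_glue_gapped : open glue_gapped.
Proof.
rewrite openE => x [c c0 sx]; rewrite /interior.
have [ch Ach chx] := atlas_cover x; case: (Ach) => W0 _ Ec; subst ch.
have [x0 PE HE KE] := chart_matrices one chx.
have o : open (chdom W0) by exact: open_chdom.
have cB : Mc 0 (chdom W0) (fun r => glue_chart W0 r - c%:M).
  by apply: McB => //; [exact: Mc_glue_chart | exact: Mc_cst].
rewrite PE (glue_chartE chx) in sx.
have cP : Mc 0 (chdom W0) (chPm W0) by exact: Mc_chPm.
have := near_splits o cP cB x0 sx.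
move/(chart_nbhs (compatible_EndSSperp one) Ach chx).
apply: filterS => y [cy]; rewrite -(glue_chartE cy).
by have [_ <- _ _] := chart_matrices one cy; exists c.
Qed.

Local Notation tg x := (val (tag x)).

(** * Points of the bundle as pairs of positive matrices *)

Lemma HP_hat_mt (W : {vspace E}) (h : 'End(subvs_of W)) :
  HP (@sub_metric R E dot W) h <-> adj (mt (hat h)) = mt (hat h) /\ psd (mt (hat h)).
Proof. by split=> [/HP_hat/(HP_mt one)|/(HP_mt one)/HP_hat]. Qed.

Lemma trace_hat (W : {vspace E}) (h : 'End(subvs_of W)) :
  endo_trace h = \tr (mt (hat h)).
Proof. by rewrite -(trace_mt one) endo_trace_hat. Qed.

Lemma mt_hatZ (W : {vspace E}) a (h : 'End(subvs_of W)) :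
  mt (hat (a *: h)) = a *: mt (hat h).
Proof.
have h0 : hat (0 : 'End(subvs_of W)) = 0.
  by apply/lfunP => u; rewrite hatE !zero_lfunE.
by have := hat_linear dot a h 0; rewrite h0 !addr0 => ->; rewrite mtZ.
Qed.

Lemma mt_hat_eq0 (W : {vspace E}) (h : 'End(subvs_of W)) : mt (hat h) = 0 -> h = 0.
Proof.
move=> h0; have := mt_hatZ 0 h; rewrite !scale0r -h0.
by move/(mt_inj one)/(@hat_inj _ _ dot)/esym.
Qed.

Lemma mt_hat0 (W : {vspace E}) : mt (hat (0 : 'End(subvs_of W))) = 0.
Proof. by have := mt_hatZ 0 (0 : 'End(subvs_of W)); rewrite scaler0 scale0r. Qed.

(** The cone parameter t is recovered as the trace. *)
Lemma cone_mt (W : {vspace E}) (h : 'End(subvs_of W)) :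
  HP1_cone (@sub_metric R E dot W) h <->
  [/\ adj (mt (hat h)) = mt (hat h), psd (mt (hat h)) & \tr (mt (hat h)) <= 1].
Proof.
split=> [[->|[t [k [/andP[t0 t1] [/HP_hat_mt[hk pk] tk] ->]]]]|[hH pH tH]].
- rewrite mt_hat0 adj0 mxtrace0 ler01; split=> // x.
  by rewrite /qf mulmx0 mul0mx mxE.
- have t0' : 0 <= t%:C by rewrite ler0c.
  rewrite mt_hatZ; have [-> ps] := psdZ t0' hk pk; split=> //.
  by rewrite mxtraceZ -trace_hat tk mulr1 lecR.
have t0 : 0 <= \tr (mt (hat h)) by exact: psd_trace.
have tE : (complex.Re (\tr (mt (hat h))))%:C = \tr (mt (hat h)).
  by rewrite RRe_real // ger0_real.
have [z|nz] := eqVneq (\tr (mt (hat h))) 0.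
  by left; apply: mt_hat_eq0; exact: psd_trace_eq0.
right; exists (complex.Re (\tr (mt (hat h)))), ((\tr (mt (hat h)))^-1 *: h).
split.
- by rewrite -ler0c -(lecR _ 1) tE t0.
- split.
    by apply/HP_hat_mt; rewrite mt_hatZ; apply: psdZ => //; rewrite invr_ge0.
  by rewrite trace_hat mt_hatZ mxtraceZ mulVf.
- by rewrite tE scalerA divff // scale1r.
Qed.

Lemma pr_ker_mt (W : {vspace E}) u : (mt (pr W) *m cv dot e u == 0) = (u \in perp W).
Proof. by rewrite -(cv_mt one) (cv_eq0 one) pr_kerE. Qed.

Lemma HPD1_perp_mt (W : {vspace E}) (k : 'End(subvs_of (perp W))) :
  HPD1 (@sub_metric R E dot (perp W)) k <->
  [/\ adj (mt (hat k)) = mt (hat k),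
      forall v, mt (pr W) *m v = 0 -> v != 0 -> 0 < qf (mt (hat k)) v &
      \tr (mt (hat k)) = 1].
Proof.
rewrite /HPD1 /mkset HPD_hat (HE_mt one) trace_hat.
split=> [[[hk pk] tk]|[hk pk tk]]; split=> //.
  move=> v Pv v0; rewrite -[v](vcK one) -(dot_qf one) pk //.
    by rewrite -pr_ker_mt (vcK one) Pv.
  by apply: contraNneq v0 => v0; rewrite -[v](vcK one) v0 cv0.
split=> // u uP u0; rewrite (dot_qf one) pk //; last by rewrite (cv_eq0 one).
by apply/eqP; rewrite pr_ker_mt.
Qed.

Lemma hat_fix (W1 W2 : {vspace E}) (h : 'Hom(subvs_of W1, subvs_of W2)) :
  mt (pr W2) *m mt (hat h) = mt (hat h) /\ mt (hat h) *m mt (pr W1) = mt (hat h).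
Proof. by rewrite -!(mt_comp one) hat_prl hat_prr. Qed.

Lemma hat_fix_perp (W : {vspace E}) (k : 'End(subvs_of (perp W))) :
  mt (pr W) *m mt (hat k) = 0 /\ mt (hat k) *m mt (pr W) = 0.
Proof.
have [kl kr] := hat_fix k; rewrite !(mt_pr_perp one) in kl kr.
have o := oproj_pr one W; split.
  by rewrite -kl mulmxA oproj_complr // mul0mx.
by rewrite -kr -mulmxA oproj_compll // mulmx0.
Qed.

Lemma bundle_inj (x y : M2) : Pm x = Pm y -> Hm x = Hm y -> Km x = Km y -> x = y.
Proof.
case: x => [W [h k]]; case: y => [W' [h' k']] PE.
have WE : W = W' by apply/val_inj/(@pr_inj _ _ dot)/(mt_inj one).
subst W' => HE KE.
have -> : h = h' by exact: (hat_inj (mt_inj one HE)).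
by have -> : k = k' by exact: (hat_inj (mt_inj one KE)).
Qed.

Lemma trace_Pm x : \tr (Pm x) = d%:R.
Proof. by rewrite (trace_pr one) (eqP (valP (tag x))). Qed.

Lemma glue_block x : mt (glue x) = block_sum (Hm x) (Km x).
Proof. exact: mt_glue. Qed.

Lemma cone_block x : cone_HPD1 x -> block_data (Pm x) (Hm x) (Km x).
Proof.
move=> cx; rewrite /block_data; apply: And5.
- exact: oproj_pr one (tg x).
- exact: (proj1 (cone_mt (tagged x).1) (proj1 cx)).
- exact: (proj1 (HPD1_perp_mt (tagged x).2) (proj2 cx)).
- exact: (hat_fix (tagged x).1).
- exact: (hat_fix_perp (tagged x).2).
Qed.

Lemma block_cone x : block_data (Pm x) (Hm x) (Km x) -> cone_HPD1 x.
Proof. move=> [_ hc kc _ _]; apply: conj.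
  exact: (proj2 (cone_mt (tagged x).1) hc).
exact: (proj2 (HPD1_perp_mt (tagged x).2) kc).
Qed.

Lemma glue_HP1 x : cone_HPD1 x -> HP1 dot (glue x).
Proof.
move=> /cone_block b; split; last first.
  apply: etrans (trace_mt one (glue x)) _.
  by rewrite glue_block; exact: trace_block_sum b.
apply/(HP_mt one); rewrite glue_block.
by split; [exact: adj_block_sum b | exact: psd_block_sum b].
Qed.

Lemma glue_in_gapped x : glue_gapped x -> gapped (glue x).
Proof.
move=> [c c0 s]; exists (Pm x), c; split=> //; first exact: oproj_pr.
exact: trace_Pm.
Qed.

Lemma ker_pr_neq0 x : (d < \dim {:E})%N -> exists2 v : 'cV[C]_n, Pm x *m v = 0 & v != 0.
Proof.
move=> dE; exists (cv dot e (vpick (perp (tg x)))).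
  by apply/eqP; rewrite pr_ker_mt memv_pick.
rewrite (cv_eq0 one) vpick0 -dimv_eq0 -lt0n -(ltn_add2l d) addn0.
by rewrite -{2}(eqP (valP (tag x))) dim_limg_perp.
Qed.

Lemma glue_trace_neq1 x : (d < \dim {:E})%N -> cone_HPD1 x -> glue_gapped x ->
  1 - \tr (Hm x) != 0.
Proof.
move=> /(ker_pr_neq0 x)[v Pv v0] /cone_block b [c c0].
by rewrite glue_block => s; exact (block_trace_neq1 b c0 s Pv v0).
Qed.

Lemma glue_inj x y : (d < \dim {:E})%N -> cone_HPD1 x -> glue_gapped x ->
  cone_HPD1 y -> glue_gapped y -> glue x = glue y -> x = y.
Proof.
move=> dE cx gx cy gy xy.
have tx := glue_trace_neq1 dE cx gx; have ty := glue_trace_neq1 dE cy gy.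
have [[c c0 sx] [c' c0' sy]] := (gx, gy).
have F : block_sum (Hm x) (Km x) = block_sum (Hm y) (Km y).
  exact: etrans (esym (glue_block x)) (etrans (congr1 mt xy) (glue_block y)).
rewrite glue_block in sx; rewrite glue_block in sy.
have tr := etrans (trace_Pm x) (esym (trace_Pm y)).
have [PE HE KE] := block_sum_inj (cone_block cx) (cone_block cy)
  c0 sx c0' sy tr tx ty F.
exact: bundle_inj PE HE KE.
Qed.

(** The kernel of the glued endomorphism is that of its tautological part. *)
Lemma block_rank (W : {vspace E}) (h : 'End(subvs_of W)) (f : 'End(E)) K :
  mt f = block_sum (mt (hat h)) K ->
  block_data (mt (pr W)) (mt (hat h)) K -> 1 - \tr (mt (hat h)) != 0 ->
  (endo_rank f + \dim W = endo_rank h + \dim {:E})%N.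
Proof.
move=> fE b t1.
have kerE u : f u = 0 -> u \in W /\ h (vsproj W u) = 0.
  move=> fu; have Fu : block_sum (mt (hat h)) K *m cv dot e u = 0.
    by rewrite -fE -(cv_mt one) fu cv0.
  have [Pu Hu] := block_sum_ker b t1 Fu.
  have uW : u \in W.
    by rewrite -(pr_fixE dot); apply/eqP/(can_inj (cvK one)); rewrite (cv_mt one).
  split=> //; apply: subvs_inj; rewrite linear0 -(hat_val dot) vsprojK //.
  by apply/eqP; rewrite -(cv_eq0 one) (cv_mt one); apply/eqP.
have kE : lker f = (linfun vsval @: lker h)%VS.
  apply/vspaceP => u; rewrite memv_ker; apply/eqP/memv_imgP.
    case/kerE => uW hu; exists (vsproj W u); first by rewrite memv_ker hu.
    by rewrite lfunE /= vsprojK.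
  case=> w; rewrite memv_ker => /eqP hw ->; rewrite lfunE /=.
  apply/eqP; rewrite -(cv_eq0 one) (cv_mt one) fE; apply/eqP.
  have Pw : cv dot e (vsval w) = mt (pr W) *m cv dot e (vsval w).
    by rewrite -(cv_mt one) pr_id ?subvsP.
  have Hw : mt (hat h) *m cv dot e (vsval w) = 0.
    by rewrite -(cv_mt one) hat_val hw linear0 cv0.
  have [_ _ _ _ [_ KP]] := b.
  by rewrite mulmxDl Hw add0r -scalemxAl Pw mulmxA KP mul0mx scaler0.
have := limg_ker_dim f fullv; rewrite capfv kE.
rewrite limg_dim_eq; last first.
  apply/eqP; rewrite -subv0; apply/subvP => w; rewrite memv_cap => /andP[_].
  by rewrite memv_ker lfunE /= memv0 => /eqP w0; apply/eqP/subvs_inj.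
have := limg_ker_dim h fullv; rewrite capfv dimvf /dim /= /endo_rank => <- <-.
by rewrite addnCA addnA addnC addnA.
Qed.

Lemma glue_rank x : cone_HPD1 x -> 1 - \tr (Hm x) != 0 ->
  (endo_rank (glue x) + d = endo_rank (tagged x).1 + \dim {:E})%N.
Proof.
move=> /cone_block b t1; rewrite -(block_rank (glue_block x) b t1).
by congr (_ + _)%N; apply/esym/eqP/(valP (tag x)).
Qed.

Local Notation compression := (compression dot).

(** * Inverting the gluing map *)

Lemma dim_onbasis : \dim {:E} = n.
Proof.
have := trace_pr one fullv; have -> : pr fullv = \1%VF.
  by apply/lfunP => u; rewrite pr_id ?memvf // lfunE.
by rewrite (mt1 one) mxtrace1 => /eqP; rewrite eqr_nat => /eqP.
Qed.

Lemma exists_grassmannian : (d <= \dim {:E})%N -> exists W : {vspace E}, \dim W == d.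
Proof.
move=> dE; exists << take d (vbasis {:E}) >>%VS.
have := basis_free (vbasisP {:E}); rewrite -{1}(cat_take_drop d (vbasis {:E})).
move/catl_free; rewrite /free => /eqP ->; apply/eqP.
by apply: size_takel; rewrite size_tuple.
Qed.

(** The subspace W is the range of the projection A. *)
Lemma of_block (A H K : 'M[C]_n) : block_data A H K -> \tr A = d%:R ->
  exists x : M2, [/\ cone_HPD1 x, Pm x = A, Hm x = H & Km x = K].
Proof.
move=> b tA; have [oA _ _ [AH HA] [AK KA]] := b.
have PA : mt (pr (limg (em A))) = A.
  rewrite pr_limg ?(emK one) //.
    by apply/(HE_mt one); rewrite (emK one) (proj1 oA).
  by apply: (mt_inj one); rewrite (mt_comp one) (emK one) (proj2 oA).
have dW : \dim (limg (em A)) == d by rewrite -(eqr_nat C) -(trace_pr one) PA tA.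
pose W : @grassmannian R E d := exist (fun W0 : {vspace E} => \dim W0 == d) (limg (em A)) dW.
pose x : M2 := existT _ W ((compression (val W) (val W) (em H),
  compression (perp (val W)) (perp (val W)) (em K))).
have Px : Pm x = A by exact: PA.
have Hx : Hm x = H.
  apply: etrans (congr1 mt (@compressionK R E dot (val W) (val W) (em H))) _.
  rewrite !(mt_comp one) (emK one) PA.
  by rewrite AH HA.
have Kx : Km x = K.
  apply: etrans (congr1 mt (@compressionK R E dot (perp (val W)) (perp (val W)) (em K))) _.
  rewrite !(mt_comp one) (emK one) (mt_pr_perp one) PA.
  by rewrite mulmxBl AK mul1mx subr0 mulmxBr KA mulmx1 subr0.
exists x; split=> //; apply: block_cone; rewrite Px Hx Kx.
exact: b.
Qed.

Lemma oproj_ker (A : 'M[C]_n) : (d < n)%N -> oproj A -> \tr A = d%:R ->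
  exists2 v : 'cV[C]_n, A *m v = 0 & v != 0.
Proof.
move=> dn oA tA; have A1 : 1%:M - A != 0.
  apply: contraTneq dn => /(congr1 mxtrace); rewrite raddfB /= mxtrace1 tA mxtrace0.
  by move/eqP; rewrite subr_eq0 eqr_nat => /eqP ->; rewrite ltnn.
have [j cj] : exists j, col j (1%:M - A) != 0.
  apply/existsP; apply: contraNT A1; rewrite negb_exists => /forallP h.
  apply/eqP/matrixP => i j; have := h j; rewrite negbK => /eqP/matrixP/(_ i 0).
  by rewrite !mxE.
by exists (col j (1%:M - A)); rewrite // colE mulmxA oproj_complr // mul0mx.
Qed.

(** The spectral projection of f below c commutes with f, and the compressions
    of f to its range and kernel are h and (1 - tr h) k. *)
Lemma glue_surj f : (d < n)%N -> HP1 dot f -> gapped f ->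
  exists x, [/\ cone_HPD1 x, glue_gapped x & glue x = f].
Proof.
move=> dn [/(HP_mt one)[hf pf]]; rewrite (trace_mt one) => tf [A [c [oA tA c0 sA]]].
have hA : adj (mt f - c%:M) = mt f - c%:M.
  by rewrite adjB hf adj_scalar // gtr0_real.
have [B [D [[_ _ _ oD sD] [cD tD _]]]] := spectral_splitting oA hA sA.
have cDf : D *m mt f = mt f *m D.
  by move: cD; rewrite mulmxBr mulmxBl scalar_mxC => /addIr.
rewrite tA in tD; have [v Dv v0] := oproj_ker dn oD tD.
have [s0 b F] := block_data_compress oD hf pf tf cDf c0 sD Dv v0.
have [x [cx Px Hx Kx]] := of_block b tD.
have gx : mt (glue x) = mt f by rewrite glue_block Hx Kx F.
exists x; apply: And3; first exact: cx.
  by exists c; [exact: c0 | rewrite Px gx].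
exact: (mt_inj one gx).
Qed.

Lemma zero_cone (x : M2) : zero_HPD1 x -> cone_HPD1 x.
Proof. by move=> zx; apply: conj; [left; exact: (proj1 zx) | exact: (proj2 zx)]. Qed.

Lemma zero_Hm (x : M2) : (tagged x).1 = 0 -> Hm x = 0.
Proof.
move=> h0; apply: etrans (congr1 (fun h => mt (hat h)) h0) _.
exact: mt_hat0 (val (tag x)).
Qed.

Lemma zero_glue_gapped (x : M2) : zero_HPD1 x -> glue_gapped x.
Proof.
move=> zx; have b := cone_block (zero_cone zx).
have H0 : Hm x = 0 by exact: zero_Hm (proj1 zx).
have [oP _ [hK pK _] _ [_ KP]] := b; have := block_psdK b.
have gx : mt (glue x) = Km x.
  by rewrite glue_block H0 /block_sum mxtrace0 subr0 scale1r add0r.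
move=> psK; have [c c0 sc] := kernel_splits oP hK psK KP pK.
by exists c; [exact: c0 | rewrite gx; exact: sc].
Qed.

(** The projection onto the kernel of f witnesses a gap at a small c. *)
Lemma rank_gapped f : HP1 dot f -> (endo_rank f + d = \dim {:E})%N -> gapped f.
Proof.
move=> [/(HP_mt one)[hf pf] _] rf.
have oP := oproj_pr one (lker f).
have fP : mt f *m mt (pr (lker f)) = 0.
  rewrite -(mt_comp one); have -> : (f \o pr (lker f))%VF = 0.
    apply/lfunP => u; rewrite comp_lfunE zero_lfunE; apply/eqP.
    by rewrite -memv_ker pr_mem.
  by rewrite (mt0 one).
have pos (v : 'cV[C]_n) : mt (pr (lker f)) *m v = 0 -> v != 0 -> 0 < qf (mt f) v.
  move=> Pv v0; rewrite lt0r pf andbT; apply: contra v0 => /eqP q0.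
  have fv := psd_qf_eq0 hf pf q0.
  have uk : vc e v \in lker f.
    by rewrite memv_ker -(cv_eq0 one) (cv_mt one) (vcK one) fv.
  by rewrite -Pv -{2}[v](vcK one) -(cv_mt one) pr_id // (vcK one).
have [c c0 sc] := kernel_splits oP hf pf fP pos.
exists (mt (pr (lker f))), c; split=> //.
rewrite (trace_pr one); have := limg_ker_dim f fullv.
by rewrite capfv -rf addnC => /addnI ->.
Qed.

(** Below a spectral gap the projection depends smoothly on the matrix:
    it is built from the positive square root of the square. *)
Lemma spectral_smooth m (D : set 'rV[R]_m) (A0 : 'M[C]_n) (F : 'rV[R]_m -> 'M[C]_n) :
  open D -> (forall k, Mc k D F) -> oproj A0 ->
  (forall r, D r -> adj (F r) = F r) -> (forall r, D r -> splits A0 (F r)) ->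
  exists2 Pf, forall k, Mc k D Pf & forall r, D r ->
    [/\ oproj (Pf r), splits (Pf r) (F r), Pf r *m F r = F r *m Pf r &
        \tr (Pf r) = \tr A0].
Proof.
move=> oD cF oA hF sF.
have ex r : exists B, D r -> exists Q,
    [/\ adj B = B, pd B, B *m B = F r *m F r, oproj Q & splits Q (F r)] /\
    [/\ Q *m F r = F r *m Q, \tr Q = \tr A0 & Q = 2^-1 *: (1%:M - F r *m invmx B)].
  have [Dr|nDr] := pselect (D r); last by exists 0.
  by have [B [Q h]] := spectral_splitting oA (hF r Dr) (sF r Dr); exists B => _; exists Q.
have [Bf hB] := choice ex.
have cB : forall k, Mc k D Bf.
  apply: (sqrt_smooth oD (A := fun r => F r *m F r)).
  - by move=> r /hB[Q [[]]].
  - by move=> r /hB[Q [[]]].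
  - by move=> r /hB[Q [[]]].
  - by move=> k; apply: McM.
exists (fun r => 2^-1 *: (1%:M - F r *m invmx (Bf r))).
  move=> k; apply: McZ => //; first exact: Cc_cst.
  apply: McB => //; first exact: Mc_cst.
  apply: McM => //; apply: Mc_inv => // r Dr.
  by have [Q [[_ pB _ _ _] _]] := hB r Dr; exact: pd_unit.
by move=> r Dr; have [Q [[_ _ _ oQ sQ] [cQ tQ <-]]] := hB r Dr.
Qed.

(** Around a point f, with gap witness A at c, the spectral projections of the
    matrices below c form a smooth family.  By [block_sum_inj], they and the
    compressions are the matrices of u. *)
Lemma smooth_unglue (u : M0 -> M2) : (d < n)%N ->
  (forall f, HP1_mfd dot f -> gapped f ->
    [/\ cone_HPD1 (u f), glue_gapped (u f) & glue (u f) = f]) ->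
  smooth_on (HP1_mfd dot `&` gapped) u.
Proof.
move=> dn uP; apply: (smooth_into_bundle one) => f Uf ch Ach _.
have Ech : ch = Chart setT (@realify R 'End(E) : M0 -> _) := Ach.
subst ch; have [[hpf _] [A [c [oA tA c0 sA]]]] := Uf.
(* The Hermitian part, as the open set contains non-Hermitian matrices. *)
pose G r := 2^-1 *: symm (mt (unrealify (V := 'End(E)) r)).
have cG k D : open D -> Mc k D G.
  move=> oD; have cM : Mc k D (fun r => mt (unrealify (V := 'End(E)) r)).
    exact: Mc_mt_unrealify.
  apply: McZ => //; first exact: Cc_cst.
  by apply: McD => //; exact: Mc_adj.
have hG r : adj (G r) = G r.
  rewrite /G adjZ adj_symm; congr (_ *: _).
  by apply/CrealP; rewrite gtr0_real // invr_gt0 ltr0n.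
have GE y : HP1_mfd dot y -> G (realify y) = mt y.
  move=> [/(HP_mt one)[hy _] _]; rewrite /G realifyK /symm hy -mulr2n -[mt y *+ 2]scaler_nat.
  by rewrite scalerA mulVf ?scale1r // pnatr_eq0.
pose D1 := [set r | splits A (G r - c%:M)].
have oD1 : open D1.
  rewrite openE => r Dr; rewrite /interior.
  have cB : Mc 0 setT (fun r => G r - c%:M).
    by apply: McB; [exact: openT | exact/cG/openT | exact: Mc_cst].
  exact: (@near_splits R _ n setT (fun=> A) _ r openT (Mc_cst 0 setT A) cB I Dr).
have hF r : D1 r -> adj (G r - c%:M) = G r - c%:M.
  by move=> _; rewrite adjB hG adj_scalar // gtr0_real.
have cF k : Mc k D1 (fun r => G r - c%:M).
  by apply: McB => //; [exact: cG | exact: Mc_cst].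
have [Pf cP PfE] := spectral_smooth oD1 cF oA hF (fun r h => h).
pose s r := 1 - \tr (G r *m Pf r).
have cGP k : Mc k D1 (fun r => G r *m Pf r) by apply: McM => //; exact: cG.
have cs k : Cc k D1 s by apply: CcB => //; [exact: Cc_cst | exact: Cc_trace].
have oD2 := open_neq0 oD1 (cs 0%N).
set D2 := mkset _ in oD2.
have D21 : D2 `<=` D1 by move=> r [].
have split_at y : HP1_mfd dot y -> D1 (realify y) -> let r := realify y in
    [/\ s r != 0, block_data (Pf r) (G r *m Pf r) ((s r)^-1 *: (G r *m (1%:M - Pf r))) &
      block_sum (G r *m Pf r) ((s r)^-1 *: (G r *m (1%:M - Pf r))) = mt y].
  move=> Hy Dy r; have [oP sP cPG tP] := PfE r Dy.
  have [/(HP_mt one)[hy py]] := Hy; rewrite (trace_mt one) => ty.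
  rewrite tA in tP; have [v Pv v0] := oproj_ker dn oP tP.
  have cPF : Pf r *m G r = G r *m Pf r.
    by move: cPG; rewrite mulmxBr mulmxBl scalar_mxC => /addIr.
  move: sP cPF; rewrite /s (GE y Hy) => sP cPF.
  exact: block_data_compress oP hy py ty cPF c0 sP Pv v0.
exists D2, Pf, (fun r => G r *m Pf r), (fun r => (s r)^-1 *: (G r *m (1%:M - Pf r))).
split.
- exact: oD2.
- have Df : D1 (realify f) by rewrite /D1 /mkset GE //; case: Uf.
  by split=> //; have [] := split_at f (proj1 Uf) Df.
- move=> k; split.
  + exact: Mc_sub (cP k).
  + exact: Mc_sub (cGP k).
  + apply: McZ => //; first by apply: CcV => [//|r []//|]; exact: Cc_sub (cs k).
    apply: McM => //; first exact: cG.
    by apply: McB => //; [exact: Mc_cst | exact: Mc_sub (cP k)].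
- move=> y [Hy gy] _ [Dy sy]; have [s0 b F] := split_at y Hy Dy.
  have [cx gx xy] := uP y Hy gy.
  have [oP sP cPG tP] := PfE _ Dy.
  have t1 : 1 - \tr (Hm (u y)) != 0.
    by apply: glue_trace_neq1 => //; rewrite dim_onbasis.
  have [c' c0' sx] := gx; rewrite glue_block in sx.
  have FF := etrans (etrans (esym (glue_block (u y))) (congr1 mt xy)) (esym F).
  have tt : \tr (Pm (u y)) = \tr (Pf (realify y)) by rewrite trace_Pm tP.
  have sP' : splits (Pf (realify y)) (block_sum (G (realify y) *m Pf (realify y))
      ((s (realify y))^-1 *: (G (realify y) *m (1%:M - Pf (realify y)))) - c%:M).
    rewrite F; move: sP; rewrite (GE y Hy) => sP; exact: sP.
  have bx := cone_block cx.
  have [PE HE KE] := block_sum_inj bx b c0' sx c0 sP' tt t1 s0 FF.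
  apply: And3; [exact: PE | exact: HE | exact: KE].
Qed.

(** * The zero section *)

Definition forget (x : M2) : M1 := existT _ (tag x) (tagged x).2.

Definition zero_section (y : M1) : M2 := existT _ (tag y) (0, tagged y).

Lemma forgetK (x : M2) : (tagged x).1 = 0 -> zero_section (forget x) = x.
Proof.
case: x => W [h k] h0.
exact: (congr1 (fun a => existT _ W (a, k) : M2) (esym h0)).
Qed.

Lemma zero_sectionK y : forget (zero_section y) = y.
Proof. by case: y. Qed.

Lemma smooth_forget (M : chartedType R) (S : set M) (f : M -> M2) :
  smooth_on S f -> smooth_on S (forget \o f).
Proof.
move=> sf x Sx c d' Ac [W0 _ Ed] cx; subst d' => dfx.
have Ac2 : atlas (EndSSperp_chart dot W0) by exists W0.
have [D [F [oD Dx smF FE]]] := sf x Sx c (EndSSperp_chart dot W0) Ac Ac2 cx dfx.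
exists D, (fun r => drop_middle (F r)); split.
- exact: oD.
- exact: Dx.
- move=> k; exact: C_on_drop_middle.
- move=> y Sy cy Dy; have [dy yE] := FE y Sy cy Dy; split; first exact: dy.
  apply: etrans (congr1 _ yE).
  exact: (esym (drop_middle_realify
    (graph_map dot (val W0) (val (tag (f y))))
    (conj_endo (proj_between dot (val (tag (f y))) (val W0)) (tagged (f y)).1)
    (conj_endo (proj_between dot (perp (val (tag (f y)))) (perp (val W0)))
       (tagged (f y)).2))).
Qed.

Lemma glue_zero_section y : mt (glue (zero_section y)) = mt (hat (tagged y)).
Proof.
have H0 : Hm (zero_section y) = 0 by exact: zero_Hm.
by rewrite glue_block H0 /block_sum mxtrace0 subr0 scale1r add0r.
Qed.

Lemma smooth_glue_zero_section (S : set M1) : smooth_on S (glue \o zero_section).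
Proof.
apply: smooth_into_endo => y _ c [W0 _ Ec] cy; subst c.
pose G0 : vectType C := 'Hom(subvs_of (val W0), subvs_of (perp (val W0))).
pose K0 : vectType C := 'End(subvs_of (perp (val W0))).
pose V1 : vectType C := (G0 * K0)%type.
pose c := EndSperp_chart dot W0.
pose T (r : 'rV[R]_(cdim c)) := frame (mt (hat (unrealify (V := V1) r).1)).
pose K (r : 'rV[R]_(cdim c)) := mt (hat (unrealify (V := V1) r).2).
have cT k : Mc k setT T.
  have c1 : Mc k setT (fun r : 'rV[R]_(cdim c) => mt (hat (unrealify (V := V1) r).1)).
    exact: (@Mc_pair1 R _ G0 K0 n n k setT _ id (@mt_hat_linear R E dot n e _ _)
      openT (C_on_id k openT)).
  apply: McB; [exact: openT | | apply: Mc_adj; [exact: openT | exact: c1]].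
  by apply: McD; [exact: openT | exact: Mc_cst | exact: c1].
have cK k : Mc k setT K.
  exact: (@Mc_pair2 R _ G0 K0 n n k setT _ id (@mt_hat_linear R E dot n e _ _)
      openT (C_on_id k openT)).
pose D := [set r | T r \in unitmx].
have oD : open D.
  have := open_unitmx openT (cT 0%N); congr open.
  by apply/seteqP; split=> r //= [].
have at_chart z : cdom c z ->
    T (cmap c z) \in unitmx /\
    mt (hat (tagged z)) = T (cmap c z) *m K (cmap c z) *m invmx (T (cmap c z)).
  move=> cz; have uz : unrealify (V := V1) (cmap c z) =
      (graph_map dot (val W0) (val (tag z)),
       conj_endo (proj_between dot (perp (val (tag z))) (perp (val W0))) (tagged z)).
    exact: (@realifyK R V1).
  rewrite /T /K uz (frame_graph one cz); split.
    by rewrite unitmx_inv (trans_unit_at one cz).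
  exact: frame_conj_orthogonal.
exists D, (fun r => T r *m K r *m invmx (T r)); split.
- exact: oD.
- exact: (proj1 (at_chart y cy)).
- move=> k; have cT' : Mc k D T by exact: Mc_sub (cT k).
  apply: McM => //; last exact: Mc_inv.
  by apply: McM => //; exact: Mc_sub (cK k).
- move=> z _ cz _; apply: etrans (glue_zero_section z) _.
  exact: (proj2 (at_chart z cz)).
Qed.

Hypothesis dn : (d < n)%N.
Local Notation U := (HP1_mfd dot `&` gapped).
Local Notation V := ((@cone_HPD1 R E dot d) `&` glue_gapped).

(** * Correspondence of the strata *)

Definition glue_section (u : M0 -> M2) := forall f, HP1_mfd dot f -> gapped f ->
  [/\ cone_HPD1 (u f), glue_gapped (u f) & glue (u f) = f].

Lemma exists_unglue : exists u, glue_section u.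
Proof.
have dE : (d <= \dim {:E})%N by rewrite dim_onbasis ltnW.
have [W dW] := exists_grassmannian dE.
(* The value of u outside the neighborhood. *)
pose x0 : M2 := existT _ (exist (fun W0 : {vspace E} => \dim W0 == d) W dW) (0, 0).
have ex f : exists x : M2, HP1_mfd dot f -> gapped f ->
    [/\ cone_HPD1 x, glue_gapped x & glue x = f].
  have [[Hf gf]|nU] := pselect (HP1_mfd dot f /\ gapped f).
    by have [x hx] := glue_surj dn Hf gf; exists x => _ _; exact: hx.
  by exists x0 => Hf gf; case: nU; apply: conj; [exact: Hf | exact: gf].
by have [u hu] := choice ex; exists u; exact: hu.
Qed.

Lemma endo_rank_eq0 (V1 : vectType C) (h : 'End(V1)) : endo_rank h = 0%N -> h = 0.
Proof.
move/eqP; rewrite dimv_eq0 => /eqP h0; apply/lfunP => v; rewrite zero_lfunE.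
by apply/eqP; rewrite -memv0 -h0 memv_img // memvf.
Qed.

Lemma endo_rank0 (V1 : vectType C) : endo_rank (0 : 'End(V1)) = 0%N.
Proof. by rewrite /endo_rank lim0g dimv0. Qed.

Lemma glue_U x : V x -> U (glue x).
Proof.
move=> Vx; apply: conj; first exact: (glue_HP1 (proj1 Vx)).
exact: (glue_in_gapped (proj2 Vx)).
Qed.

Lemma rank_V x : V x -> (endo_rank (glue x) + d = endo_rank (tagged x).1 + n)%N.
Proof.
move=> Vx; have dE : (d < \dim {:E})%N by rewrite dim_onbasis.
have t1 := glue_trace_neq1 dE (proj1 Vx) (proj2 Vx).
by rewrite (glue_rank (proj1 Vx) t1) dim_onbasis.
Qed.

Section Inverse.
Variable u : M0 -> M2.
Hypothesis uP : glue_section u.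

Lemma unglue_V f : U f -> V (u f).
Proof. by move=> Uf; have [cx gx _] := uP (proj1 Uf) (proj2 Uf); apply: conj. Qed.

Lemma unglueK f : U f -> glue (u f) = f.
Proof. by move=> Uf; have [_ _ xf] := uP (proj1 Uf) (proj2 Uf). Qed.

Lemma glueK x : V x -> u (glue x) = x.
Proof.
move=> Vx; have dE : (d < \dim {:E})%N by rewrite dim_onbasis.
have Uf := glue_U Vx; have Vu := unglue_V Uf.
exact: (glue_inj dE (proj1 Vu) (proj2 Vu) (proj1 Vx) (proj2 Vx) (unglueK Uf)).
Qed.

Lemma unglue_smooth : smooth_on U u.
Proof. exact: (smooth_unglue dn uP). Qed.

Lemma unglue_homeo : homeo_on U V u glue.
Proof.
split.
- apply: conj.
    by move=> f Uf; apply: conj; [exact: unglue_V | exact: unglueK].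
  by move=> x Vx; apply: conj; [exact: glue_U | exact: glueK].
- exact: (smooth_continuous (@compatible_vect R _) unglue_smooth).
- exact: (smooth_continuous (compatible_EndSSperp one) (smooth_glue (S := V))).
Qed.

(** By the rank formula, the rank of f and that of h determine each other. *)
Lemma unglue_stratum r f : U f -> Sigma0 dot r f ->
  let j := endo_rank (tagged (u f)).1 in
  u @` (Sigma0 dot r `&` U) = cone_stratum j `&` V.
Proof.
move=> Uf Sf j; have rj : (r + d = j + n)%N.
  by rewrite -(rank_V (unglue_V Uf)) (unglueK Uf) (proj2 Sf).
apply/seteqP; split=> x.
  case=> g [Sg Ug] <-; have Vg := unglue_V Ug; apply: conj; last exact: Vg.
  apply: conj; first exact: (proj1 Vg).
  by apply/eqP; rewrite -(eqn_add2r n) -(rank_V Vg) (unglueK Ug) (proj2 Sg) rj.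
move=> [Sx Vx]; exists (glue x); last exact: glueK.
have Ux := glue_U Vx; apply: conj; last exact: Ux.
apply: conj; first exact: (proj1 Ux).
by apply/eqP; rewrite -(eqn_add2r d) (rank_V Vx) (proj2 Sx) rj.
Qed.

Lemma unglue_diffeo S : S `<=` U -> diffeo_on S (u @` S) u glue.
Proof.
move=> SU; split.
- apply: conj.
    move=> f Sf; apply: conj; last exact: (unglueK (SU f Sf)).
    by exists f.
  move=> x [f Sf <-]; have gf := unglueK (SU f Sf).
  by apply: conj; rewrite gf.
- exact: (smooth_on_sub SU unglue_smooth).
- exact: smooth_glue.
Qed.

Lemma unglue_stratified : stratified_isomorphic
  (restrict_strata (HP1_strata dot) U) U (restrict_strata (@cone_strata R E dot d) V) V.
Proof.
exists u, glue; split; first exact: unglue_homeo.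
move=> S [[f Sf] [S' [r /andP[r1 rn] Sr] SE]]; subst S S'.
have [Sf1 Uf] := Sf; split; last by apply: unglue_diffeo => g [].
apply: conj; first by exists (u f); exists f.
exists (cone_stratum (endo_rank (tagged (u f)).1)); last exact: unglue_stratum.
exists (endo_rank (tagged (u f)).1); last by [].
rewrite /mkset -(leq_add2r n) -(rank_V (unglue_V Uf)) (unglueK Uf) (proj2 Sf1).
by rewrite addnC leq_add2l -dim_onbasis.
Qed.

Lemma sigma_sub_U i : (i + d = n)%N -> Sigma0 dot i `<=` U.
Proof.
move=> id f Sf; apply: conj; first exact: (proj1 Sf).
apply: (rank_gapped (proj1 Sf)).
by rewrite (proj2 Sf) id dim_onbasis.
Qed.

Lemma zero_sub_V : @zero_HPD1 R E dot d `<=` V.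
Proof. by move=> x zx; apply: conj; [exact: zero_cone | exact: zero_glue_gapped]. Qed.

(** The rank formula leaves rank 0 for h. *)
Lemma unglue_Sigma0 i f : (i + d = n)%N -> Sigma0 dot i f -> (tagged (u f)).1 = 0.
Proof.
move=> id Sf; have Uf := sigma_sub_U id Sf; apply: endo_rank_eq0; apply/eqP.
by rewrite -(eqn_add2r n) -(rank_V (unglue_V Uf)) (unglueK Uf) (proj2 Sf) id.
Qed.

Lemma Sigma0_diffeo i : (i + d = n)%N ->
  diffeo_on (Sigma0 dot i) (@HPD1_Sperp R E dot d) (forget \o u)
    (glue \o zero_section).
Proof.
move=> id; split.
- apply: conj => [f Sf|y Ky].
    have Uf := sigma_sub_U id Sf; apply: conj.
      exact: (proj2 (proj1 (unglue_V Uf))).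
    apply: etrans (congr1 glue (forgetK (unglue_Sigma0 id Sf))) _.
    exact: unglueK.
  have zy : @zero_HPD1 R E dot d (zero_section y) by apply: conj.
  have Vy := zero_sub_V zy; apply: conj.
    apply: conj; first exact: (proj1 (glue_U Vy)).
    apply/eqP; rewrite -(eqn_add2r d) (rank_V Vy) id.
    by rewrite (endo_rank0 _).
  exact: etrans (congr1 (forget) (glueK Vy)) (zero_sectionK y).
- exact/smooth_forget/(smooth_on_sub (sigma_sub_U id))/unglue_smooth.
- exact: smooth_glue_zero_section.
Qed.

End Inverse.

End Gluing.

Theorem corollary20 (R : realType) (E : vectType R[i])
    (dot : {dot E for (@conjC R[i])}) (n i : nat) :
  \dim {:E} = n -> (1 <= n)%N -> (1 <= i <= n)%N ->
  diffeomorphic (Sigma0 dot i) (@HPD1_Sperp R E dot (n - i)%N) /\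
  exists (U : set (vect_mfd 'End(E))) (V : set (EndSSperp dot (n - i)%N)),
    [/\ open_nbhd_in (HP1_mfd dot) (Sigma0 dot i) U,
        open_nbhd_in (@cone_HPD1 R E dot (n - i)%N)
          (@zero_HPD1 R E dot (n - i)%N) V &
        stratified_isomorphic
          (restrict_strata (HP1_strata dot) U) U
          (restrict_strata (@cone_strata R E dot (n - i)%N) V) V].
Proof.
move=> dimE n1 /andP[i1 ile]; have [e one] := onbasis_exists dot dimE.
have id : (i + (n - i) = n)%N by rewrite subnKC.
have dn : (n - i < n)%N by rewrite ltn_subrL i1.
have [u uP] := exists_unglue one dn.
split; first by do 2 eexists; exact: (Sigma0_diffeo one dn uP id).
exists (HP1_mfd dot `&` @gapped R E dot n e (n - i)%N),
  (@cone_HPD1 R E dot (n - i)%N `&` @glue_gapped R E dot n e (n - i)%N); split.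
- apply: conj; first exact: (sigma_sub_U one id).
  by exists (@gapped R E dot n e (n - i)%N); [exact: open_gapped | exact: erefl].
- apply: conj; first exact: (zero_sub_V one).
  exists (@glue_gapped R E dot n e (n - i)%N); last exact: erefl.
  exact: (open_glue_gapped one).
- exact: (unglue_stratified one dn uP).
Qed.
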